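(* Let $0<|q|<1$ and $a,b,c,d\in\mathbb C^\ast$ such that $|qa|<|cd|$, $|q^{1/2}b|<|\sqrt{cd}|$ and none of the denominator factors vanish. Then $${}_8\Psi_8\left(a;b,c,d,\pm\tfrac{\sqrt q\,a}{\sqrt{cd}},\tfrac{cd}{b};q,-\tfrac{qa}{cd}\right)$$ $$=\frac{\left(qa,\frac qa,-\frac qb,\frac ba,-\sqrt{\frac{qc}{d}},-\sqrt{\frac{qd}{c}},\frac{qa}{cd},\frac{\sqrt q\,b}{\sqrt{cd}},\frac{bcd}{a},-\sqrt{\frac{qc}{d}}\,b,-\sqrt{\frac{qd}{c}}\,b,-\frac{q^{3/2}a}{(cd)^{3/2}};q\right)_\infty}{\left(-\sqrt{qcd},-\sqrt{qcd}\,b,\frac{qa}{c},\frac{qa}{d},\frac{bc}{a},\frac{bd}{a},\frac{qb}{cd},\frac{\sqrt{qcd}}{a},-\frac{\sqrt q}{\sqrt{cd}},-\frac{\sqrt q\,b}{\sqrt{cd}},-\frac{q^{3/2}}{\sqrt{cd}\,b},-\frac{qa}{cd};q\right)_\infty}$$ $$\times\;{}_8\Psi_8\left(-\tfrac{\sqrt{cd}\,b}{\sqrt q};\pm b,c,d,-\tfrac{\sqrt q\,a}{\sqrt{cd}},-\tfrac{(cd)^{3/2}}{\sqrt q\,a};q,\tfrac{\sqrt q\,b}{\sqrt{cd}}\right)$$ $$+\frac{\left(q,qa,\frac qa,c,d,\frac{qa}{cd},\frac{qa}{cd},-\frac{\sqrt q\,a}{\sqrt{cd}},\frac{\sqrt{qcd}}{b},\frac{qb^2}{cd};q\right)_\infty\vartheta\left(-\sqrt{\frac{cd}{q}}\,\frac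 ba;q\right)\left(\frac{qbc}{a},\frac{qbd}{a},\frac{q^2ab}{c^2d},\frac{q^2ab}{cd^2};q^2\right)_\infty}{\left(\frac qb,\frac{qa}{b},\frac{qa}{c},\frac{qa}{d},\frac{bc}{a},\frac{bd}{a},\frac{\sqrt{qcd}}{a},\frac{qb}{cd},-\frac{\sqrt q\,b}{\sqrt{cd}},\frac{qab}{cd};q\right)_\infty\vartheta\left(-\sqrt{\frac{cd}{q}};q\right)\left(q,qcd,\frac{q^2b^2}{cd},\frac{q^2a^2}{c^2d^2};q^2\right)_\infty}.$$
   Context: $\mathbb C^\ast=\mathbb C\setminus\{0\}$. For a base $p$ ($p=q$ or $q^2$): $(x;p)_\infty=\prod_{n\ge0}(1-xp^n)$, $(x;p)_k=(x;p)_\infty/(xp^k;p)_\infty$ for $k\in\mathbb Z$, $(x_1,\dots,x_m;p)_k=\prod_i(x_i;p)_k$ for $k\in\mathbb Z\cup\{\infty\}$; $\vartheta(z;q)=(z,q/z;q)_\infty$. In lists, $\pm x$ stands for the two entries $x,-x$. Very-well-poised bilateral series: $${}_8\Psi_8(a;a_3,\dots,a_8;q,z)=\sum_{k=-\infty}^\infty\frac{1-aq^{2k}}{1-a}\prod_{j=3}^8\frac{(a_j;q)_k}{(qa/a_j;q)_k}\,z^k .$$ Square roots: fix one choice of $\sqrt q=q^{1/2}$ and one choice of $\sqrt{cd}$, and interpret all other roots consistently: $\sqrt{qcd}=\sqrt q\sqrt{cd}$, $\sqrt{qc/d}=\sqrt q\,c/\sqrt{cd}$, $\sqrt{qd/c}=\sqrt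 q\,d/\sqrt{cd}$, $\sqrt{cd/q}=\sqrt{cd}/\sqrt q$, $q^{3/2}=(\sqrt q)^3$, $(cd)^{3/2}=(\sqrt{cd})^3$. *)

(* Defs.v *)
From HB Require Import structures.
From mathcomp Require Export all_boot all_order all_algebra complex.
From mathcomp Require Export all_classical all_reals all_analysis.

Set Implicit Arguments.
Unset Strict Implicit.
Unset Printing Implicit Defensive.

Export Order.TTheory GRing.Theory Num.Theory.
Export numFieldNormedType.Exports.

Local Open Scope classical_set_scope.
Local Open Scope ring_scope.

(* The definitions are over an arbitrary K : numFieldType: it carries the      *)
(* topology of the norm, and R[i] (R : realType) is an instance, which has no  *)
(* topology declared on it directly.                                           *)

(* (x; p)_oo *)
Definition qinf (K : numFieldType) (p x : K) : K :=
  lim ((fun n : nat => \prod_(i < n) (1 - x * p ^+ i)) @ \oo).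

(* (x_1, ..., x_m; p)_oo *)
Definition qinfs (K : numFieldType) (p : K) (xs : seq K) : K :=
  \prod_(x <- xs) qinf p x.

Definition theta (K : numFieldType) (z q : K) : K := qinfs q [:: z; q / z].

(* (x; p)_k for k in Z. This is (x; p)_oo / (x p^k; p)_oo, see qpochE, but     *)
(* with the common factors cancelled, so that it keeps its usual value when    *)
(* this quotient reads 0 / 0 (e.g. x = p^-m, 0 <= k <= m).                     *)
Definition qpoch (K : numFieldType) (p x : K) (k : int) : K :=
  match k with
  | Posz n => \prod_(i < n) (1 - x * p ^+ i)
  | Negz n => (\prod_(i < n.+1) (1 - x * p ^- i.+1))^-1
  end.

Lemma qpochE (K : numFieldType) (p x : K) (k : int) : p != 0 ->
  cvg ((fun n : nat => \prod_(i < n) (1 - x * p ^ k * p ^+ i)) @ \oo) ->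
  qinf p (x * p ^ k) != 0 -> qpoch p x k = qinf p x / qinf p (x * p ^ k).
Proof.
have split_prod (y : K) m n : \prod_(i < m + n) (1 - y * p ^+ i) =
    \prod_(i < m) (1 - y * p ^+ i) * \prod_(i < n) (1 - y * p ^+ m * p ^+ i).
  rewrite big_split_ord /=; congr (_ * _).
  by apply: eq_bigr => i _; rewrite exprD mulrA.
have shift (y : K) (m : nat) :
    cvg ((fun n : nat => \prod_(i < n) (1 - y * p ^+ m * p ^+ i)) @ \oo) ->
    qinf p y = \prod_(i < m) (1 - y * p ^+ i) * qinf p (y * p ^+ m).
  move=> cv; apply: cvg_lim => //; rewrite -(cvg_shiftn m) /=.
  under eq_fun do rewrite addnC split_prod.
  exact: cvgMl_tmp.
move=> p0; case: k => m cv nz.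
  by rewrite (shift x m cv) mulfK.
have pm0 : p ^+ m.+1 != 0 by rewrite expf_neq0.
set y := x * p ^ Negz m in cv nz *.
have yE : y * p ^+ m.+1 = x by rewrite /y /= mulfVK.
set P := \prod_(i < m.+1) (1 - y * p ^+ i).
have PE : P = \prod_(i < m.+1) (1 - x * p ^- i.+1).
  rewrite /P (reindex_inj rev_ord_inj) /=; apply: eq_bigr => i _.
  rewrite -yE.
  have -> : p ^+ m.+1 = p ^+ (m.+1 - i.+1) * p ^+ i.+1.
    by rewrite -exprD subnK.
  by rewrite mulrA mulfK // expf_neq0.
have P0 : P != 0.
  apply: contra_neq nz => P0; apply: cvg_lim => //.
  rewrite -(cvg_shiftn m.+1) /=.
  under eq_fun do rewrite addnC split_prod -/P P0 mul0r.
  exact: cvg_cst.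
have cvx : cvg ((fun n : nat => \prod_(i < n) (1 - x * p ^+ i)) @ \oo).
  have -> : (fun n : nat => \prod_(i < n) (1 - x * p ^+ i)) =
      (fun n : nat => P^-1 * \prod_(i < n + m.+1) (1 - y * p ^+ i)).
    by apply/funext => n; rewrite addnC split_prod -/P yE mulKf.
  apply: is_cvgMl_tmp; move/cvg_ex: cv => [l cl]; apply/cvg_ex; exists l.
  by rewrite (cvg_shiftn m.+1 (fun n => \prod_(i < n) (1 - y * p ^+ i))).
have qy : qinf p y = P * qinf p x by rewrite -[in RHS]yE; apply: shift; rewrite yE.
rewrite /qpoch -PE qy invfM mulrCA divff ?mulr1 //.
by apply: contra_neq nz => x0; rewrite qy x0 mulr0.
Qed.

(* \sum_(k = -oo)^oo f k; Negz n is the integer - (n + 1) *)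
Definition bisum (K : numFieldType) (f : int -> K) : K :=
  lim (series (fun n : nat => f (Posz n)) @ \oo) +
  lim (series (fun n : nat => f (Negz n)) @ \oo).

Definition bisum_cvg (K : numFieldType) (f : int -> K) : Prop :=
  cvg (series (fun n : nat => f (Posz n)) @ \oo) /\
  cvg (series (fun n : nat => f (Negz n)) @ \oo).

Definition psi8_term (K : numFieldType) (a a3 a4 a5 a6 a7 a8 q z : K) (k : int) : K :=
  (1 - a * q ^ (2 * k)) / (1 - a) *
  (\prod_(x <- [:: a3; a4; a5; a6; a7; a8]) (qpoch q x k / qpoch q (q * a / x) k)) *
  z ^ k.

Definition psi8 (K : numFieldType) (a a3 a4 a5 a6 a7 a8 q z : K) : K :=
  bisum (psi8_term a a3 a4 a5 a6 a7 a8 q z).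

Definition psi8_cvg (K : numFieldType) (a a3 a4 a5 a6 a7 a8 q z : K) : Prop :=
  bisum_cvg (psi8_term a a3 a4 a5 a6 a7 a8 q z).

(* No denominator factor of a term of the series vanishes: the factors are     *)
(* 1 - a, those of (q a / a_j; q)_k for k > 0, and, for k < 0, those of the    *)
(* denominator of (a_j; q)_k.                                                  *)
Definition psi8_den_neq0 (K : numFieldType) (a a3 a4 a5 a6 a7 a8 q : K) : Prop :=
  1 - a != 0 /\
  forall x : K, x \in [:: a3; a4; a5; a6; a7; a8] -> forall n : nat,
    1 - q * a / x * q ^+ n != 0 /\ 1 - x * q ^- n.+1 != 0.

(* Main.v *)
From mathcomp Require Import ring lra zify.
Require Import Defs.

(* Write the parameters of the well-poised series as a = x^2 and a_j = x b_j,  *)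
(* and multiply it by the q-products that clear the denominators of its terms. *)
(* For fixed b_j the result G is a Laurent series in x on the punctured plane, *)
(* with G(q x) = G(x) / (q^2 x^6) and x^2 G(1/x) = - G(x); such functions form *)
(* a plane, spanned by two products of theta functions. Two of the b_j are e   *)
(* and -e, and at x = e and x = -e the bilateral series becomes unilateral and *)
(* is summed by a q-analogue of Whipple's theorem, proved by telescoping. Hence *)
(* the 8Psi8 is, up to q-products, a sum of two products of four theta         *)
(* functions. The second 8Psi8 is the first with - sqrt(cd) b / sqrt(q) for a  *)
(* and - sqrt(q) a / sqrt(cd) for b, and a three-term relation between theta   *)
(* functions links the two sums.                                               *)

(** Put a = x^2 and a_j = x b_j. Multiplied by 1 - a and by all (q/a_j, qa/a_j; q)_oo, the 8Psi8
    becomes, for fixed b_j, a Laurent function [wp_sum] of x ([psi8_wp_sum]). Shifting the summation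
    index amounts to x -> q x and reversing it to x -> 1/x. When z times the product of the b_j is
    q^2, this gives the functional equations [wp_sum_shift] and [wp_sum_inv]; read on Laurent
    coefficients, they leave only two of them free ([wp_space_det]). Two suitable values therefore
    determine the function.

    In both series of the theorem the b_j have the form A/e, q/(A e), D/e, q/(D e), e, - e. At x = e
    and x = - e the terms of negative index vanish, and the rest is a very-well-poised 8phi7 summed
    by the q-analogue of Whipple's theorem ([whipple_sum]). Interpolation in the basis [wp_theta e],
    [wp_theta (- e)] then gives a closed form at every x ([wp_sum_eval]), for generic e first and by
    continuity for the others. Up to q-products ([psi8_eval]) each 8Psi8 is theta(A) theta(D)
    theta(-e x) theta(-e/x) + theta(-A) theta(-D) theta(e x) theta(e/x).

    What remains is an identity between two such sums and a single product of theta functions, which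
    becomes the last term of the theorem: [theta_relation]. It follows from the addition formulas
    [theta_three_term] and [theta_square_diff], which both come from the product formula
    [theta_mul_base2]. [combine_evaluations] carries out the final algebra.

    The analysis stays elementary. Functions on the punctured plane are absolutely convergent series
    of Laurent polynomials with explicit majorants, and averages over roots of unity take the place
    of contour integrals in the uniqueness of coefficients ([lcoefs_eq0], [lcoefs_inj]). *)

Set Implicit Arguments.
Unset Strict Implicit.
Unset Printing Implicit Defensive.

Local Open Scope classical_set_scope.
Local Open Scope ring_scope.
Local Open Scope complex_scope.

(* The complex numbers, abstracted to the properties of the modulus that the   *)
(* analysis uses; [modulus] is real-valued, whereas the norm of a              *)
(* [numClosedFieldType] lies in the field itself.                              *)
Structure modulusField (R : realType) := ModulusField {
  modulus_carrier :> numClosedFieldType;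
  modulus : modulus_carrier -> R;
  modulusM : forall x y, modulus (x * y) = modulus x * modulus y;
  modulusD : forall x y, modulus (x + y) <= modulus x + modulus y;
  modulus_nat : forall n, modulus n%:R = n%:R;
  modulus_ge0 : forall x, 0 <= modulus x;
  modulus_eq0 : forall x, (modulus x == 0) = (x == 0);
  modulus_small : forall e : modulus_carrier, 0 < e -> exists2 r : R, 0 < r &
    forall x, modulus x < r -> `|x| < e;
  modulus_complete : forall (f : nat -> modulus_carrier) (b : nat -> R) (B : R),
    (forall k, modulus (f k) <= b k) -> (forall n, \sum_(k < n) b k <= B) ->
    exists l, forall e : R, 0 < e -> exists N, forall n, (N <= n)%N ->
      modulus (\sum_(k < n) f k - l) < e }.

Notation nm := (@modulus _ _).

(** * Arithmetic of the modulus *)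

Section Modulus.
Variables (R : realType) (K : modulusField R).
Implicit Types x y : K.

Lemma nmM x y : nm (x * y) = nm x * nm y. Proof. exact: modulusM. Qed.
Lemma nmD x y : nm (x + y) <= nm x + nm y. Proof. exact: modulusD. Qed.
Lemma nm_ge0 x : 0 <= nm x. Proof. exact: modulus_ge0. Qed.
Lemma nm_eq0 x : (nm x == 0) = (x == 0). Proof. exact: modulus_eq0. Qed.
Lemma nm0 : nm (0 : K) = 0. Proof. exact: (modulus_nat K 0). Qed.
Lemma nm1 : nm (1 : K) = 1. Proof. exact: (modulus_nat K 1). Qed.
Lemma nmX x n : nm (x ^+ n) = nm x ^+ n.
Proof. by elim: n => [|n IH]; rewrite ?expr0 ?nm1 // !exprS nmM IH. Qed.
Lemma nmN x : nm (- x) = nm x.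
Proof.
have h : nm (-1 : K) ^+ 2 = 1 by rewrite -nmX sqrrN expr1n nm1.
by rewrite -mulN1r nmM; move/eqP: h; rewrite sqrp_eq1 ?nm_ge0 // => /eqP ->; rewrite mul1r.
Qed.
Lemma nmV x : nm x^-1 = (nm x)^-1.
Proof.
have [->|x0] := eqVneq x 0; first by rewrite !(invr0, nm0).
have nx : nm x != 0 by rewrite nm_eq0.
by apply: (mulfI nx); rewrite -nmM !mulfV // nm1.
Qed.
Lemma nmB x y : nm (x - y) <= nm x + nm y.
Proof. by rewrite -(nmN y) nmD. Qed.
Lemma nm_gt0 x : (0 < nm x) = (x != 0).
Proof. by rewrite lt_def nm_ge0 andbT nm_eq0. Qed.
Lemma nm_distC x y : nm (x - y) = nm (y - x).
Proof. by rewrite -nmN opprB. Qed.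
Lemma nm_prod (I : Type) (s : seq I) (P : pred I) (F : I -> K) :
  nm (\prod_(i <- s | P i) F i) = \prod_(i <- s | P i) nm (F i).
Proof. exact: (big_morph nm nmM nm1). Qed.
Lemma nm_sum (I : Type) (s : seq I) (P : pred I) (F : I -> K) :
  nm (\sum_(i <- s | P i) F i) <= \sum_(i <- s | P i) nm (F i).
Proof.
elim/big_ind2: _ => [|u x v y ux vy|//]; first by rewrite nm0.
by rewrite (le_trans (nmD _ _)) // lerD.
Qed.
Lemma nm_triangle x y z : nm (x - z) <= nm (x - y) + nm (y - z).
Proof. by rewrite (le_trans _ (nmD _ _)) // addrA subrK. Qed.
End Modulus.

(** * Limits and series of moduli *)

Section Limits.
Variables (R : realType) (K : modulusField R).
Implicit Types (u v : nat -> K) (l : K) (b : nat -> R).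

(** Convergence with real epsilons; [clim_cvg] transfers it to the topology of [K], in which [qinf]
    and [bisum] are limits. *)
Definition clim u l :=
  forall e : R, 0 < e -> exists N, forall n, (N <= n)%N -> nm (u n - l) < e.

Lemma clim_cst l : clim (fun=> l) l.
Proof. by move=> e e0; exists 0%N => n _; rewrite subrr nm0. Qed.

Lemma clim_ext u v l : u =1 v -> clim u l -> clim v l.
Proof. by move=> /funext ->. Qed.

Lemma climD u v l m : clim u l -> clim v m -> clim (fun n => u n + v n) (l + m).
Proof.
move=> ul vm e e0; have e2 : 0 < e / 2 by rewrite divr_gt0.
have [N1 h1] := ul _ e2; have [N2 h2] := vm _ e2.
exists (maxn N1 N2) => n; rewrite geq_max => /andP[n1 n2].
have -> : u n + v n - (l + m) = (u n - l) + (v n - m) by ring.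
by rewrite (le_lt_trans (nmD _ _)) // (splitr e) ltrD ?h1 ?h2.
Qed.

Lemma clim_bounded u l : clim u l -> exists2 B : R, 0 < B & forall n, nm (u n) <= B.
Proof.
move=> /(_ 1 ltr01)[N h].
exists (1 + nm l + \sum_(i < N) nm (u i)).
  by rewrite ltr_wpDr ?sumr_ge0// ?ltr_wpDr ?nm_ge0 // => i _; rewrite nm_ge0.
move=> n; have [Nn|nN] := leqP N n.
  rewrite ler_wpDr ?sumr_ge0 // => [i _|]; first by rewrite nm_ge0.
  by rewrite -[u n](subrK l) (le_trans (nmD _ _)) // lerD2r ltW // h.
rewrite (bigD1 (Ordinal nN)) //= addrCA lerDl addr_ge0 ?sumr_ge0 //.
- by rewrite addr_ge0 ?nm_ge0.
- by move=> i _; rewrite nm_ge0.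
Qed.

Lemma climM u v l m : clim u l -> clim v m -> clim (fun n => u n * v n) (l * m).
Proof.
move=> ul vm; have [B B0 hB] := clim_bounded vm => e e0.
have e1 : 0 < e / 2 / B by rewrite !divr_gt0.
have e2 : 0 < e / 2 / (nm l + 1) by rewrite !divr_gt0 // ltr_wpDl ?nm_ge0.
have [N1 h1] := ul _ e1; have [N2 h2] := vm _ e2.
exists (maxn N1 N2) => n; rewrite geq_max => /andP[n1 n2].
have -> : u n * v n - l * m = (u n - l) * v n + l * (v n - m) by ring.
rewrite (le_lt_trans (nmD _ _)) // (splitr e) !nmM ltr_leD //.
  rewrite (@le_lt_trans _ _ (nm (u n - l) * B)) ?ler_wpM2l ?nm_ge0 //.
  by rewrite -ltr_pdivlMr // h1.
rewrite (@le_trans _ _ ((nm l + 1) * nm (v n - m))) //.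
  by rewrite ler_wpM2r ?nm_ge0 // lerDl.
by rewrite mulrC -ler_pdivlMr ?ltr_wpDl ?nm_ge0 // ltW // h2.
Qed.

Lemma climZ u l c : clim u l -> clim (fun n => c * u n) (c * l).
Proof. by move=> ul; apply: climM => //; exact: clim_cst. Qed.

Lemma climB u v l m : clim u l -> clim v m -> clim (fun n => u n - v n) (l - m).
Proof.
move=> ul vm; apply: climD => //; rewrite -mulN1r.
by apply: clim_ext (climZ (-1) vm) => n /=; rewrite mulN1r.
Qed.

Lemma climX u l k : clim u l -> clim (fun n => u n ^+ k) (l ^+ k).
Proof.
move=> ul; elim: k => [|k IH]; first by rewrite expr0; exact: clim_cst.
rewrite exprS; apply: clim_ext (climM ul IH) => n /=; by rewrite exprS.
Qed.

Lemma clim_prod (I : Type) (s : seq I) (f : nat -> I -> K) g :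
  (forall i, clim (f^~ i) (g i)) ->
  clim (fun n => \prod_(i <- s) f n i) (\prod_(i <- s) g i).
Proof.
move=> fg; elim: s => [|i s IH].
  by rewrite big_nil; apply: clim_ext (clim_cst 1) => n; rewrite big_nil.
by rewrite big_cons; apply: clim_ext (climM (fg i) IH) => n /=; rewrite big_cons.
Qed.

Lemma clim_sum (I : Type) (s : seq I) (f : nat -> I -> K) g :
  (forall i, clim (f^~ i) (g i)) ->
  clim (fun n => \sum_(i <- s) f n i) (\sum_(i <- s) g i).
Proof.
move=> fg; elim: s => [|i s IH].
  by rewrite big_nil; apply: clim_ext (clim_cst 0) => n; rewrite big_nil.
by rewrite big_cons; apply: clim_ext (climD (fg i) IH) => n /=; rewrite big_cons.
Qed.

Lemma clim_unique u l m : clim u l -> clim u m -> l = m.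
Proof.
move=> ul um; apply/eqP; rewrite -subr_eq0 -nm_eq0 eq_le nm_ge0 andbT.
apply/ler_addgt0Pl => e e0; rewrite addr0.
have e2 : 0 < e / 2 by rewrite divr_gt0.
have [N1 h1] := ul _ e2; have [N2 h2] := um _ e2.
have := h1 _ (leq_maxl N1 N2); have := h2 _ (leq_maxr N1 N2).
move=> a1 a2; rewrite (le_trans (nm_triangle _ (u (maxn N1 N2)) _)) //.
by rewrite (splitr e) lerD // ltW // nm_distC.
Qed.

Lemma clim_le u l (B : R) : clim u l -> (forall n, nm (u n) <= B) -> nm l <= B.
Proof.
move=> ul hB; apply/ler_addgt0Pl => e e0.
have [N h] := ul _ e0.
rewrite -[l](subrK (u N)) (le_trans (nmD _ _)) // lerD //.
by rewrite nm_distC ltW // h.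
Qed.

Lemma clim_shift u l k : clim u l -> clim (fun n => u (n + k)%N) l.
Proof.
move=> ul e /ul[N h]; exists N => n Nn.
by apply: h; rewrite (leq_trans Nn) // leq_addr.
Qed.

Lemma clim_unshift u l k : clim (fun n => u (n + k)%N) l -> clim u l.
Proof.
move=> ul e /ul[N h]; exists (N + k)%N => n Nn.
have := h (n - k)%N; rewrite subnK; last by rewrite (leq_trans _ Nn) // leq_addl.
by apply; lia.
Qed.

Lemma clim_cvg u l : clim u l -> ((u : nat -> (K : numFieldType)) @ \oo --> (l : (K : numFieldType))).
Proof.
move=> ul; apply/cvgrPdist_lt => e /modulus_small[r r0 hr].
have [N h] := ul _ r0; exists N => // n /= Nn.
by rewrite distrC hr // h.
Qed.

(** A majorant series. Only a bound on its sum is recorded; [bsum_tail] recovers small tails from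
    the supremum of the partial sums. *)
Definition bsum b (B : R) := (forall k, 0 <= b k) /\ forall n, \sum_(k < n) b k <= B.

Lemma bsum_ge0 b B : bsum b B -> 0 <= B.
Proof. by move=> [_ /(_ 0%N)]; rewrite big_ord0. Qed.

Lemma bsum_tail b B : bsum b B ->
  forall e : R, 0 < e -> exists N, forall m, \sum_(k < m) b (N + k)%N < e.
Proof.
move=> [b0 hB] e e0.
pose S := [set x : R | exists n, x = \sum_(k < n) b k].
have S0 : S !=set0 by exists 0; exists 0%N; rewrite big_ord0.
have hS : has_sup S by split=> //; exists B => x [n ->].
have [x [N xN] hx] := sup_adherent e0 hS.
exists N => m; rewrite -(ltrD2l (\sum_(k < N) b k)).
have -> : \sum_(k < N) b k + \sum_(k < m) b (N + k)%N = \sum_(k < N + m) b k.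
  by rewrite big_split_ord.
apply: (@le_lt_trans _ _ (sup S)); last by rewrite -ltrBlDr -xN.
by apply: ub_le_sup; [case: hS|exists (N + m)%N].
Qed.

(** The default value 0 is taken when the series diverges; [csumP] gives convergence under a
    majorant. *)
Definition csum (f : nat -> K) : K :=
  xget 0 [set l | clim (fun n => \sum_(k < n) f k) l].

Lemma csum_unique (f : nat -> K) l : clim (fun n => \sum_(k < n) f k) l -> csum f = l.
Proof.
move=> h; have : clim (fun n => \sum_(k < n) f k) (csum f).
  by apply: (@xgetPex _ 0 [set l | clim (fun n => \sum_(k < n) f k) l]); exists l.
by move/clim_unique; apply.
Qed.

Lemma csumP (f : nat -> K) b B : bsum b B -> (forall k, nm (f k) <= b k) ->
  clim (fun n => \sum_(k < n) f k) (csum f).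
Proof.
move=> bB fb.
have [l h] := modulus_complete fb bB.2.
by rewrite (csum_unique h).
Qed.
End Limits.

Section Series.
Variables (R : realType) (K : modulusField R).
Implicit Types (f g : nat -> K) (b : nat -> R).

Lemma csum_tail f b (B T : R) N : bsum b B -> (forall k, nm (f k) <= b k) ->
  (forall m, \sum_(k < m) b (N + k)%N <= T) ->
  nm (csum f - \sum_(k < N) f k) <= T.
Proof.
move=> bB fb hT; have fc := csumP bB fb.
have := climB (clim_shift N fc) (@clim_cst R K (\sum_(k < N) f k)).
move/clim_le; apply => n /=.
rewrite addnC big_split_ord /= addrAC subrr add0r (le_trans (nm_sum _ _ _)) //.
by apply: le_trans (hT n); apply: ler_sum => k _; exact: fb.
Qed.

(** Tannery's theorem: cut at an N beyond which the majorant contributes less than e / 3; the finite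
    head converges term by term. *)
Lemma csum_dominated (f : nat -> nat -> K) g b B :
  bsum b B -> (forall n k, nm (f n k) <= b k) ->
  (forall k, clim (f^~ k) (g k)) -> clim (fun n => csum (f n)) (csum g).
Proof.
move=> bB fb fg.
have gb k : nm (g k) <= b k by apply: clim_le (fg k) _ => n; exact: fb.
move=> e e0; have e3 : 0 < e / 3 by rewrite divr_gt0.
have [N hN] := bsum_tail bB e3.
have [M hM] := @clim_sum R K _ (index_enum 'I_N) (fun n (k : 'I_N) => f n k)
  (fun k : 'I_N => g k) (fun k => fg k) _ e3.
exists M => n Mn; have {hM} h2 := hM n Mn.
have h1 := csum_tail bB (fb n) (fun m => ltW (hN m)).
have h3 := csum_tail bB gb (fun m => ltW (hN m)).
rewrite nm_distC in h3.
have := nm_triangle (csum (f n)) (\sum_(k < N) f n k) (csum g).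
have := nm_triangle (\sum_(k < N) f n k) (\sum_(k < N) g k) (csum g).
by move: h1 h2 h3 => /=; lra.
Qed.

Lemma eq_csum f g : f =1 g -> csum f = csum g.
Proof. by move=> /funext ->. Qed.

Lemma csumD f g b B c D : bsum b B -> (forall k, nm (f k) <= b k) ->
  bsum c D -> (forall k, nm (g k) <= c k) ->
  csum (fun k => f k + g k) = csum f + csum g.
Proof.
move=> bB fb cD gc; apply: csum_unique.
by apply: clim_ext (climD (csumP bB fb) (csumP cD gc)) => n; rewrite big_split.
Qed.

Lemma csumZ f b B a : bsum b B -> (forall k, nm (f k) <= b k) ->
  csum (fun k => a * f k) = a * csum f.
Proof.
move=> bB fb; apply: csum_unique.
by apply: clim_ext (climZ a (csumP bB fb)) => n; rewrite mulr_sumr.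
Qed.

Lemma csum_recl f b B : bsum b B -> (forall k, nm (f k) <= b k) ->
  csum f = f 0%N + csum (fun k => f k.+1).
Proof.
move=> bB fb; have fc := csumP bB fb.
suff -> : csum (fun k => f k.+1) = csum f - f 0%N by rewrite addrC subrK.
apply: csum_unique.
apply: clim_ext (climB (clim_shift 1 fc) (clim_cst (f 0%N))) => n /=.
by rewrite addn1 big_ord_recl addrAC subrr add0r.
Qed.

Lemma bsum_shift b B : bsum b B -> bsum (fun k => b k.+1) B.
Proof.
move=> [b0 hB]; split=> [k|n]; first exact: b0.
by rewrite (le_trans _ (hB n.+1)) // big_ord_recl lerDr.
Qed.

Lemma bsumZ b B c : 0 <= c -> bsum b B -> bsum (fun k => c * b k) (c * B).
Proof.
move=> c0 [b0 hB]; split=> [k|n]; first by rewrite mulr_ge0.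
by rewrite -mulr_sumr ler_wpM2l.
Qed.

Lemma bsum_geo (c t : R) : 0 <= c -> 0 <= t < 1 ->
  bsum (fun k => c * t ^+ k) (c / (1 - t)).
Proof.
move=> c0 /andP[t0 t1]; apply: bsumZ => //; split=> [k|n]; first exact: exprn_ge0.
have d0 : 0 < 1 - t by rewrite subr_gt0.
have E : (1 - t) * \sum_(k < n) t ^+ k = 1 - t ^+ n.
  by rewrite -(opprB t) mulNr -subrX1 opprB.
rewrite -[_^-1]mul1r ler_pdivlMr // mulrC E.
by rewrite lerBlDr lerDl exprn_ge0.
Qed.

Lemma clim_geo (t : K) : nm t < 1 -> clim (fun n => t ^+ n) 0.
Proof.
move=> t1 e e0.
have h : bsum (fun k => 1 * nm t ^+ k) (1 / (1 - nm t)).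
  by apply: bsum_geo; rewrite ?nm_ge0.
have [N hN] := bsum_tail h e0; exists N => n Nn.
have := hN (n - N).+1; rewrite big_ord_recr /= mul1r subnKC // subr0 nmX.
by apply: le_lt_trans; rewrite lerDr sumr_ge0 // => k _; rewrite mul1r exprn_ge0 ?nm_ge0.
Qed.

End Series.

(** * Infinite q-products *)

Section QProducts.
Variables (R : realType) (K : modulusField R).
Implicit Types (p x y : K).

Definition qp p x n : K := \prod_(i < n) (1 - x * p ^+ i).

(** Majorant of all products of 1 + t |p|^i, by 1 + y <= exp y and the geometric series. *)
Definition ebd p (t : R) : R := expR (t / (1 - nm p)).

Lemma qp0 p x : qp p x 0 = 1.
Proof. by rewrite /qp big_ord0. Qed.

Lemma qpSr p x n : qp p x n.+1 = qp p x n * (1 - x * p ^+ n).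
Proof. by rewrite /qp big_ord_recr. Qed.

Lemma qpS p x n : qp p x n.+1 = (1 - x) * qp p (x * p) n.
Proof.
rewrite /qp big_ord_recl expr0 mulr1; congr (_ * _).
by apply: eq_bigr => i _; rewrite exprS mulrA.
Qed.

Lemma qpD p x m n : qp p x (m + n) = qp p x m * qp p (x * p ^+ m) n.
Proof.
rewrite /qp big_split_ord /=; congr (_ * _).
by apply: eq_bigr => i _; rewrite exprD mulrA.
Qed.

Variable p : K.
Hypothesis p1 : nm p < 1.

Let d0 : 0 < 1 - nm p. Proof. by rewrite subr_gt0. Qed.

Lemma ebd_ge0 t : 0 <= ebd p t. Proof. exact: expR_ge0. Qed.

Lemma ebd_homo (s t : R) : s <= t -> ebd p s <= ebd p t.
Proof. by move=> st; rewrite /ebd ler_expR ler_wpM2r // invr_ge0 ltW. Qed.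

Lemma geo_le (c : R) n : 0 <= c -> \sum_(i < n) c * nm p ^+ i <= c / (1 - nm p).
Proof. by move=> c0; case: (@bsum_geo R c (nm p)); rewrite ?nm_ge0. Qed.

Lemma prod_le_ebd (t : R) n : 0 <= t -> \prod_(i < n) (1 + t * nm p ^+ i) <= ebd p t.
Proof.
move=> t0; apply: (@le_trans _ _ (expR (\sum_(i < n) t * nm p ^+ i))).
  rewrite expR_sum; apply: ler_prod => i _.
  by rewrite expR_ge1Dx addr_ge0 ?mulr_ge0 ?exprn_ge0 ?nm_ge0.
by rewrite ler_expR geo_le.
Qed.

Lemma nm_qp_prod x n : nm (qp p x n) <= \prod_(i < n) (1 + nm x * nm p ^+ i).
Proof.
rewrite nm_prod; apply: ler_prod => i _; rewrite nm_ge0 /=.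
by rewrite (le_trans (nmB _ _)) // nm1 nmM nmX.
Qed.

Lemma nm_qp x n (t : R) : nm x <= t -> nm (qp p x n) <= ebd p t.
Proof.
move=> xt; rewrite (le_trans (nm_qp_prod _ _)) //.
by rewrite (le_trans (prod_le_ebd _ (nm_ge0 _))) // ebd_homo.
Qed.

(** The increments of the partial products turn the infinite product into a series with geometric
    majorant, so that convergence and continuity in x follow from [csumP] and [csum_dominated]. *)
Let dq x n := qp p x n.+1 - qp p x n.

Let dqE x n : dq x n = - (qp p x n * (x * p ^+ n)).
Proof. by rewrite /dq qpSr; ring. Qed.

Let dq_bound x (t : R) n : nm x <= t -> nm (dq x n) <= ebd p t * t * nm p ^+ n.
Proof.
move=> xt; rewrite dqE nmN !nmM nmX -mulrA ler_pM ?mulr_ge0 ?exprn_ge0 ?nm_ge0 ?nm_qp //.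
by rewrite ler_wpM2r // exprn_ge0 ?nm_ge0.
Qed.

Let dq_bsum (t : R) : 0 <= t ->
  bsum (fun n => ebd p t * t * nm p ^+ n) (ebd p t * t / (1 - nm p)).
Proof. by move=> t0; apply: bsum_geo; rewrite ?mulr_ge0 ?ebd_ge0 ?nm_ge0. Qed.

Let dq_sum x n : qp p x n = 1 + \sum_(k < n) dq x k.
Proof.
elim: n => [|n IH]; first by rewrite qp0 big_ord0 addr0.
by rewrite big_ord_recr /= addrA -IH /dq addrC subrK.
Qed.

Let qp_csum x : clim (qp p x) (1 + csum (dq x)).
Proof.
have h := csumP (dq_bsum (nm_ge0 x)) (fun n => dq_bound n (lexx (nm x))).
by apply: clim_ext (climD (clim_cst 1) h) => n; rewrite dq_sum.
Qed.

Lemma qinf_csum x : qinf p x = 1 + csum (dq x).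
Proof. exact: cvg_lim (clim_cvg (qp_csum x)). Qed.

Lemma qinf_clim x : clim (qp p x) (qinf p x).
Proof. by rewrite qinf_csum. Qed.

Lemma nm_qinf x (t : R) : nm x <= t -> nm (qinf p x) <= ebd p t.
Proof. by move=> xt; apply: clim_le (qinf_clim x) _ => n; exact: nm_qp. Qed.

Lemma qinf_cont u l : clim u l -> clim (fun n => qinf p (u n)) (qinf p l).
Proof.
move=> ul; have [B B0 hB] := clim_bounded ul.
rewrite qinf_csum.
suff h : clim (fun n => csum (dq (u n))) (csum (dq l)).
  by apply: clim_ext (climD (clim_cst 1) h) => n; rewrite qinf_csum.
apply: (csum_dominated (dq_bsum (ltW B0)) (fun n k => dq_bound k (hB n))) => k.
rewrite dqE -mulN1r; apply: (@clim_ext _ _ (fun n => -1 * (qp p (u n) k * (u n * p ^+ k)))).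
  by move=> n; rewrite dqE mulN1r.
apply: climZ; apply: climM.
  apply: clim_prod => i; apply: climB; first exact: clim_cst.
  by apply: climM => //; exact: clim_cst.
by apply: climM => //; exact: clim_cst.
Qed.

Lemma qinf_split x n : qinf p x = qp p x n * qinf p (x * p ^+ n).
Proof.
apply: (clim_unique (clim_shift n (qinf_clim x))).
apply: clim_ext (climZ (qp p x n) (qinf_clim (x * p ^+ n))) => m.
by rewrite addnC qpD.
Qed.

Lemma qinf_recl x : qinf p x = (1 - x) * qinf p (x * p).
Proof. by rewrite (qinf_split x 1) qpSr qp0 expr0 expr1 mulr1 mul1r. Qed.

Lemma qinf0 : qinf p 0 = 1.
Proof.
apply: (clim_unique (qinf_clim 0)); apply: clim_ext (clim_cst 1) => n.
by rewrite /qp big1 // => i _; rewrite mul0r subr0.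
Qed.

Lemma qinf1 : qinf p 1 = 0.
Proof. by rewrite qinf_recl subrr mul0r. Qed.

(** The Weierstrass product inequality, by induction from (1 - S)(1 - t) >= 1 - S - t. *)
Lemma nm_qp_ge x n : nm x / (1 - nm p) <= 1 -> 1 - \sum_(i < n) nm x * nm p ^+ i <= nm (qp p x n).
Proof.
move=> x1; elim: n => [|n IH]; first by rewrite big_ord0 subr0 qp0 nm1.
rewrite qpSr nmM big_ord_recr /=.
set S := \sum_(i < n) _ in IH *; set t := nm x * _.
have S1 : S <= 1 by rewrite (le_trans _ x1) // geo_le ?nm_ge0.
have S0 : 0 <= S by rewrite sumr_ge0 // => i _; rewrite mulr_ge0 ?exprn_ge0 ?nm_ge0.
have t0 : 0 <= t by rewrite mulr_ge0 ?exprn_ge0 ?nm_ge0.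
have h : 1 - t <= nm (1 - x * p ^+ n).
  have := nm_triangle 1 (1 - x * p ^+ n) 0.
  have -> : 1 - (1 - x * p ^+ n) = x * p ^+ n by ring.
  by rewrite !subr0 nm1 nmM nmX -/t; lra.
have n0 := nm_ge0 (1 - x * p ^+ n).
have := ler_wpM2r n0 IH; have : (1 - S) * (1 - t) <= (1 - S) * nm (1 - x * p ^+ n).
  by rewrite ler_wpM2l // subr_ge0.
by have := mulr_ge0 S0 t0; lra.
Qed.

(** After finitely many nonzero factors the argument y of the remaining product satisfies |y| / (1 -
    |p|) <= 1/2, and [nm_qp_ge] keeps its partial products at modulus at least 1/2. *)
Lemma qinf_neq0 x : (forall n, 1 - x * p ^+ n != 0) -> qinf p x != 0.
Proof.
move=> hx.
have e0 : 0 < (1 - nm p) / 2 by rewrite divr_gt0.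
have := climZ x (clim_geo p1); rewrite mulr0 => /(_ _ e0)[N /(_ N (leqnn _))].
rewrite subr0 => hN; rewrite (qinf_split x N) mulf_neq0 //.
  by apply/prodf_neq0 => i _; exact: hx.
set y := x * p ^+ N in hN *.
have y2 : nm y / (1 - nm p) <= 1 / 2.
  by rewrite ler_pdivrMr //; move: hN; lra.
apply/eqP => q0.
have : nm (1 - qinf p y) <= 1 / 2; last by rewrite q0 subr0 nm1; lra.
have h : forall n, 1 / 2 <= nm (qp p y n).
  move=> n; have y1 : nm y / (1 - nm p) <= 1 by lra.
  by have := nm_qp_ge n y1; have := geo_le n (nm_ge0 y); lra.
have h4 : 0 < (1 / 4 : R) by lra.
have [M /(_ M (leqnn _))] := qinf_clim y h4.
by rewrite q0 subr0; have := h M; lra.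
Qed.

Lemma sqr_lt1 : nm (p ^+ 2) < 1.
Proof. by rewrite nmX expr_lt1 ?nm_ge0. Qed.

End QProducts.

Section QProducts2.
Variables (R : realType) (K : modulusField R) (p : K).
Hypothesis p1 : nm p < 1.

Lemma qinf_sqr x : qinf p x * qinf p (- x) = qinf (p ^+ 2) (x ^+ 2).
Proof.
apply: (clim_unique (climM (qinf_clim p1 x) (qinf_clim p1 (- x)))).
apply: clim_ext (qinf_clim (sqr_lt1 p1) (x ^+ 2)) => n.
rewrite /qp -big_split /=; apply: eq_bigr => i _.
by rewrite -exprM mulnC exprM; ring.
Qed.

(** Separation of the factors of even and odd index, on partial products of length 2n. *)
Lemma qinf_double x : qinf p x = qinf (p ^+ 2) x * qinf (p ^+ 2) (x * p).
Proof.
have h := climM (qinf_clim (sqr_lt1 p1) x) (qinf_clim (sqr_lt1 p1) (x * p)).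
apply: clim_unique h => e /(qinf_clim p1 x)[N hN].
exists N => n Nn; have := hN (n + n)%N (leq_trans Nn (leq_addr _ _)).
suff -> : qp p x (n + n) = qp (p ^+ 2) x n * qp (p ^+ 2) (x * p) n by [].
elim: n {Nn} => [|n IH]; first by rewrite !qp0 mulr1.
rewrite addnS addSn !qpSr IH -exprM (exprS p (n + n)).
have -> : (2 * n = n + n)%N by lia.
by rewrite exprD; ring.
Qed.

End QProducts2.

(** * Laurent series on the punctured plane *)

Section LaurentPolynomials.
Variables (R : realType) (K : modulusField R).

(* A Laurent polynomial is a list of monomials (coefficient, exponent), with   *)
(* repetitions allowed, so that [lnorm] is multiplicative.                     *)
Definition lpoly := seq (K * int).
Implicit Types (P Q : lpoly) (x : K) (r : R).

Definition leval P x : K := \sum_(m <- P) m.1 * x ^ m.2.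
Definition lnorm P r : R := \sum_(m <- P) nm m.1 * r ^ m.2.
Definition lcoef P (n : int) : K := \sum_(m <- P | m.2 == n) m.1.
Definition lmul P Q : lpoly := [seq (m.1 * m'.1, m.2 + m'.2) | m <- P, m' <- Q].

Lemma nmXz x (n : int) : nm (x ^ n) = nm x ^ n.
Proof. by case: n => n; rewrite -?exprnN /= ?nmV ?nmX. Qed.

Lemma leval_cat P Q x : leval (P ++ Q) x = leval P x + leval Q x.
Proof. exact: big_cat. Qed.

Lemma lnorm_cat P Q r : lnorm (P ++ Q) r = lnorm P r + lnorm Q r.
Proof. exact: big_cat. Qed.

Lemma leval_mul P Q x : x != 0 -> leval (lmul P Q) x = leval P x * leval Q x.
Proof.
move=> x0; rewrite /leval big_allpairs_dep /= mulr_suml; apply: eq_bigr => m _.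
rewrite mulr_sumr; apply: eq_bigr => m' _.
by rewrite expfzDr // mulrACA.
Qed.

Lemma lnorm_mul P Q r : 0 < r -> lnorm (lmul P Q) r = lnorm P r * lnorm Q r.
Proof.
move=> r0; rewrite /lnorm big_allpairs_dep /= mulr_suml; apply: eq_bigr => m _.
rewrite mulr_sumr; apply: eq_bigr => m' _.
by rewrite expfzDr ?gt_eqF // nmM mulrACA.
Qed.

Lemma lnorm_ge0 P r : 0 < r -> 0 <= lnorm P r.
Proof.
by move=> r0; apply: sumr_ge0 => m _; rewrite mulr_ge0 ?nm_ge0 // exprz_ge0 ?(ltW r0).
Qed.

Lemma nm_leval P x : nm (leval P x) <= lnorm P (nm x).
Proof.
rewrite (le_trans (nm_sum _ _ _)) // ler_sum // => m _.
by rewrite nmM nmXz.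
Qed.

Lemma leval_flatten (s : seq nat) (D : nat -> lpoly) x :
  leval (flatten [seq D k | k <- s]) x = \sum_(k <- s) leval (D k) x.
Proof. by rewrite /leval big_flatten big_map. Qed.

Lemma lnorm_flatten (s : seq nat) (D : nat -> lpoly) r :
  lnorm (flatten [seq D k | k <- s]) r = \sum_(k <- s) lnorm (D k) r.
Proof. by rewrite /lnorm big_flatten big_map. Qed.

Lemma lcoef_flatten (s : seq nat) (D : nat -> lpoly) n :
  lcoef (flatten [seq D k | k <- s]) n = \sum_(k <- s) lcoef (D k) n.
Proof. by rewrite /lcoef big_flatten big_map. Qed.

Definition lpart (D : nat -> lpoly) n := flatten [seq D k | k <- iota 0 n].

Lemma leval_part D n x : leval (lpart D n) x = \sum_(k < n) leval (D k) x.
Proof. by rewrite leval_flatten -(big_mkord xpredT (fun k => leval (D k) x)) /index_iota subn0. Qed.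

Lemma lnorm_part D n r : lnorm (lpart D n) r = \sum_(k < n) lnorm (D k) r.
Proof. by rewrite lnorm_flatten -(big_mkord xpredT (fun k => lnorm (D k) r)) /index_iota subn0. Qed.

Lemma lcoef_part D n k : lcoef (lpart D n) k = \sum_(i < n) lcoef (D i) k.
Proof. by rewrite lcoef_flatten -(big_mkord xpredT (fun i => lcoef (D i) k)) /index_iota subn0. Qed.

Lemma nm_lcoef P n r : 0 < r -> nm (lcoef P n) * r ^ n <= lnorm P r.
Proof.
move=> r0; apply: (@le_trans _ _ (\sum_(m <- P | m.2 == n) nm m.1 * r ^ n)).
  by rewrite -mulr_suml ler_wpM2r ?exprz_ge0 ?(ltW r0) //; exact: nm_sum.
rewrite /lnorm big_mkcond /= ler_sum // => m _.
by case: eqP => [->|_] //; rewrite mulr_ge0 ?nm_ge0 // exprz_ge0 ?(ltW r0).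
Qed.

Lemma leval_coef (I : seq int) P x : uniq I ->
  \sum_(n <- I) lcoef P n * x ^ n = \sum_(m <- P | m.2 \in I) m.1 * x ^ m.2.
Proof.
move=> uI; rewrite [RHS]big_mkcond /=.
transitivity (\sum_(n <- I) \sum_(m <- P) (if m.2 == n then m.1 * x ^ m.2 else 0)).
  apply: eq_bigr => n _; rewrite mulr_suml big_mkcond /=; apply: eq_bigr => m _.
  by case: eqP => [->|].
rewrite exchange_big /=; apply: eq_bigr => m _.
case: (boolP (m.2 \in I)) => mI.
  rewrite (bigD1_seq m.2) //= eqxx big1 ?addr0 // => n.
  by rewrite eq_sym => /negbTE ->.
rewrite big_seq big1 // => n nI; case: eqP => // mn.
by rewrite mn nI in mI.
Qed.

(** A 2^k-th root of -1 has order dividing 2^(k+1) but not 2^k. *)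
Lemma prim_root_pow2 k : exists z : K, (2 ^ k.+1).-primitive_root z.
Proof.
have L0 : (0 < 2 ^ k)%N by rewrite expn_gt0.
pose z : K := (2 ^ k).-root (-1); exists z.
have zL : z ^+ (2 ^ k) = -1 by rewrite rootCK.
have zL2 : z ^+ (2 ^ k.+1) = 1 by rewrite expnS mulnC exprM zL sqrrN expr1n.
have L2 : (0 < 2 ^ k.+1)%N by rewrite expn_gt0.
have [m pm] := prim_order_exists L2 zL2.
case/(dvdn_pfactor _ _ (isT : prime 2)) => j; rewrite leq_eqVlt => /predU1P[->|].
  by move=> mE; rewrite -mE.
rewrite ltnS => jk mE; have : z ^+ (2 ^ k) == 1.
  by rewrite -(prim_order_dvd pm) mE dvdn_exp2l.
by rewrite zL eqNr oner_eq0.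
Qed.

(* Averaging over the roots of unity of large order isolates a coefficient. *)
Lemma nm_lcoef_sup P n (B : R) :
  (forall x, nm x = 1 -> nm (leval P x) <= B) -> nm (lcoef P n) <= B.
Proof.
move=> hB.
(* A root of unity of order L > k separates n from all other exponents of [P]: the average of z^((m
   - n) j) over j < L vanishes unless m = n. *)
pose k := (\max_(m <- P) `|(m.2 - n)%R|)%N.
have hk m : m \in P -> (`|(m.2 - n)%R| <= k)%N.
  by move=> mP; rewrite /k; apply: (@leq_bigmax_seq _ _ xpredT (fun m : K * int => `|(m.2 - n)%R|%N)).
have [z zp] := prim_root_pow2 k; set L := (2 ^ k.+1)%N in zp.
have kL : (k < L)%N by rewrite (ltn_trans (ltn_expl k (isT : (1 < 2)%N))) // ltn_exp2l.
have L0 : (0 < L)%N by exact: leq_trans kL.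
have z0 : z != 0.
  apply/eqP => zE; have := prim_expr_order zp.
  by rewrite zE expr0n gtn_eqF // => /eqP; rewrite eq_sym oner_eq0.
have nz : nm z = 1.
  have : nm z ^+ L = 1 by rewrite -nmX (prim_expr_order zp) nm1.
  by move/eqP; rewrite pexpr_eq1 ?nm_ge0 // => /eqP.
have ave m : m \in P -> \sum_(j < L) (z ^ (m.2 - n)) ^+ j = (if m.2 == n then L%:R else 0).
  move=> mP; case: eqP => [->|mn].
    rewrite subrr expr0z; under eq_bigr do rewrite expr1n.
    by rewrite sumr_const card_ord.
  set y := z ^ _.
  have yL : y ^+ L = 1.
    rewrite /y -[_ ^+ L]/(_ ^ (L%:Z)) exprzAC -[z ^ L]/(z ^+ L).
    by rewrite (prim_expr_order zp) exp1rz.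
  have y1 : y != 1.
    apply: contra_notN mn => /eqP y1.
    have : z ^+ `|m.2 - n| == 1.
      move: y1; rewrite /y; case: (m.2 - n)%R => l h; apply/eqP; first exact: h.
      by apply: invr_inj; rewrite invr1; exact: h.
    rewrite -(prim_order_dvd zp) => /dvdn_leq; have := hk _ mP.
    by lia.
  have /eqP : (y - 1) * \sum_(j < L) y ^+ j = 0 by rewrite -subrX1 yL subrr.
  by rewrite mulf_eq0 subr_eq0 (negbTE y1) => /eqP.
have E : L%:R * lcoef P n = \sum_(j < L) z ^ (- n * j%:Z) * leval P (z ^+ j).
  rewrite /lcoef /leval; under [RHS]eq_bigr do rewrite mulr_sumr.
  rewrite exchange_big /= mulr_sumr big_mkcond big_seq [RHS]big_seq.
  apply: eq_bigr => m mP /=.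
  transitivity (m.1 * \sum_(j < L) (z ^ (m.2 - n)) ^+ j).
    by rewrite ave //; case: ifP => _; rewrite ?mulr0 // mulrC.
  rewrite mulr_sumr; apply: eq_bigr => j _.
  rewrite mulrCA; congr (_ * _).
  rewrite -[_ ^+ j]/(_ ^ (j%:Z)) -[z ^+ j]/(z ^ (j%:Z)) !exprz_exp -expfzDr //.
  by congr (_ ^ _); ring.
have LR : 0 < L%:R :> R by rewrite ltr0n.
have nL : nm (L%:R : K) = L%:R by exact: modulus_nat.
rewrite -(ler_pM2l LR) -{1}nL -nmM E (le_trans (nm_sum _ _ _)) //.
have -> : L%:R * B = \sum_(j < L) B by rewrite sumr_const card_ord mulr_natl.
rewrite ler_sum // => j _.
rewrite nmM nmXz nz exp1rz mul1r hB // nmX nz expr1n //.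
Qed.

End LaurentPolynomials.

(** * Functions with a Laurent expansion, and their coefficients *)

Section LaurentFunctions.
Variables (R : realType) (K : modulusField R).
Implicit Types (f g h : K -> K) (N M : R -> R) (c d : int -> K) (x : K) (r : R).

Definition lexpansion (D : nat -> lpoly K) f N :=
  (forall r, 0 < r -> forall n, \sum_(k < n) lnorm (D k) r <= N r) /\
  (forall x, x != 0 -> clim (fun n => \sum_(k < n) leval (D k) x) (f x)).

(* [f] is the sum of a series of Laurent polynomials on the punctured plane,   *)
(* whose norms at each radius [r] add up to at most [N r].                     *)
Definition laurent f N := exists D, lexpansion D f N.

Lemma lexpansion_bsum D f N r : lexpansion D f N -> 0 < r ->
  bsum (fun k => lnorm (D k) r) (N r).
Proof. by move=> [hN _] r0; split; [move=> k; exact: lnorm_ge0|exact: hN]. Qed.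

Lemma laurent_ge0 f N r : laurent f N -> 0 < r -> 0 <= N r.
Proof. by move=> [D fD] r0; exact: bsum_ge0 (lexpansion_bsum fD r0). Qed.

Lemma nm_laurent f N x : laurent f N -> x != 0 -> nm (f x) <= N (nm x).
Proof.
move=> [D [hN hf]] x0; apply: clim_le (hf x x0) _ => n.
rewrite (le_trans (nm_sum _ _ _)) // (le_trans _ (hN _ _ n)) ?nm_gt0 //.
by apply: ler_sum => k _; exact: nm_leval.
Qed.

Lemma laurent_ext f g N : (forall x, x != 0 -> f x = g x) -> laurent f N -> laurent g N.
Proof.
move=> fg [D [hN hf]]; exists D; split=> // x x0.
by rewrite -fg //; exact: hf.
Qed.

Lemma laurent_le f N M : (forall r, 0 < r -> N r <= M r) -> laurent f N -> laurent f M.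
Proof.
by move=> NM [D [hN hf]]; exists D; split=> // r r0 n; rewrite (le_trans (hN _ r0 n)) ?NM.
Qed.

Lemma laurent_monomial (a : K) (n : int) :
  laurent (fun x => a * x ^ n) (fun r => nm a * r ^ n).
Proof.
exists (fun k => if k is 0%N then [:: (a, n)] else [::]); split=> [r r0 k|x x0].
  case: k => [|k]; first by rewrite big_ord0 mulr_ge0 ?nm_ge0 // exprz_ge0 // ltW.
  rewrite big_ord_recl big1 => [|i _]; rewrite /lnorm ?big_nil //.
  by rewrite big_seq1 addr0.
apply: (@clim_unshift _ _ _ _ 1); apply: clim_ext (clim_cst _) => k.
rewrite addn1 big_ord_recl big1 => [|i _]; rewrite /leval ?big_nil //.
by rewrite big_seq1 addr0.
Qed.

Lemma laurent_cst (a : K) : laurent (fun=> a) (fun=> nm a).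
Proof.
have [D [hN hf]] := laurent_monomial a 0; exists D; split=> [r r0 n|x x0].
  by have := hN r r0 n; rewrite expr0z mulr1.
by have := hf x x0; rewrite expr0z mulr1.
Qed.

Lemma laurentD f g N M : laurent f N -> laurent g M ->
  laurent (fun x => f x + g x) (fun r => N r + M r).
Proof.
move=> [D [hN hf]] [E [hM hg]]; exists (fun k => D k ++ E k); split=> [r r0 n|x x0].
  under eq_bigr do rewrite lnorm_cat; rewrite big_split lerD ?hN ?hM //.
apply: clim_ext (climD (hf x x0) (hg x x0)) => n /=.
by rewrite -big_split; apply: eq_bigr => k _; rewrite leval_cat.
Qed.

(** The double series is summed by squares: the k-th block is u_k (v_0 + ... + v_k) + (u_0 + ... +
    u_(k-1)) v_k, so that its partial sums are exactly products of partial sums. *)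
Lemma laurentM f g N M : laurent f N -> laurent g M ->
  laurent (fun x => f x * g x) (fun r => N r * M r).
Proof.
move=> [D [hN hf]] [E [hM hg]].
exists (fun k => lmul (D k) (lpart E k.+1) ++ lmul (lpart D k) (E k)).
have key (A : nzRingType) (u v : nat -> A) n : \sum_(k < n)
   (u k * (\sum_(i < k.+1) v i) + (\sum_(i < k) u i) * v k) =
   (\sum_(k < n) u k) * (\sum_(k < n) v k).
  elim: n => [|n IH]; first by rewrite !big_ord0 mul0r.
  rewrite big_ord_recr /= IH [in RHS]big_ord_recr /= mulrDl addrA addrAC.
  by rewrite big_ord_recr /= (mulrDr (\sum_(i < n) u i)) addrAC.
split=> [r r0 n|x x0].
  under eq_bigr do rewrite lnorm_cat !lnorm_mul // !lnorm_part.
  rewrite (key _ (fun k => lnorm (D k) r) (fun k => lnorm (E k) r)).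
  by rewrite ler_pM ?hN ?hM // sumr_ge0 // => k _; rewrite lnorm_ge0.
apply: clim_ext (climM (hf x x0) (hg x x0)) => n /=.
rewrite -(key _ (fun k => leval (D k) x) (fun k => leval (E k) x)).
by apply: eq_bigr => k _; rewrite leval_cat !leval_mul // !leval_part.
Qed.

Lemma laurentZ f N (a : K) : laurent f N -> laurent (fun x => a * f x) (fun r => nm a * N r).
Proof.
move=> hf; have := laurentM (laurent_monomial a 0) hf.
move=> [D [hN hx]]; exists D; split=> [r r0 n|x x0].
  by have := hN r r0 n; rewrite expr0z mulr1.
by have := hx x x0; rewrite expr0z mulr1.
Qed.

Lemma laurent_csum (f : nat -> K -> K) (N : nat -> R -> R) M :
  (forall k, laurent (f k) (N k)) ->
  (forall r, 0 < r -> bsum (fun k => N k r) (M r)) ->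
  laurent (fun x => csum (f^~ x)) M.
Proof.
move=> /choice[D hD] hM.
exists (fun m => flatten [seq D m i | i <- iota 0 m.+1]
             ++ flatten [seq D k m | k <- iota 0 m]).
have key (A : nmodType) (u : nat -> nat -> A) n : \sum_(m < n)
   (\sum_(i <- iota 0 m.+1) u m i + \sum_(k <- iota 0 m) u k m) =
   \sum_(k < n) \sum_(i < n) u k i.
  have io (v : nat -> A) m : \sum_(i <- iota 0 m) v i = \sum_(i < m) v i.
    by rewrite -(big_mkord xpredT v) /index_iota subn0.
  elim: n => [|n IH]; first by rewrite !big_ord0.
  rewrite big_ord_recr IH [RHS]big_ord_recr !io /=.
  have -> : \sum_(k < n) \sum_(i < n.+1) u k i =
      \sum_(k < n) \sum_(i < n) u k i + \sum_(k < n) u k n.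
    by rewrite -big_split /=; apply: eq_bigr => k _; rewrite big_ord_recr.
  by rewrite (addrC (\sum_(i < n.+1) _)) addrA.
split=> [r r0 n|x x0].
  under eq_bigr do rewrite lnorm_cat !lnorm_flatten.
  rewrite (key _ (fun k i => lnorm (D k i) r)).
  rewrite (le_trans _ ((hM r r0).2 n)) // ler_sum // => k _.
  by case: (hD k) => + _; apply.
(* The n by n square sum, read as a series over rows with the rows from n on set to 0, so that
   [csum_dominated] gives its limit. *)
pose F n k := if (k < n)%N then \sum_(i < n) leval (D k i) x else 0.
have nx : 0 < nm x by rewrite nm_gt0.
have bF n k : nm (F n k) <= N k (nm x).
  rewrite /F; case: ifP => _; last first.
    by rewrite nm0; apply: laurent_ge0 nx; exists (D k).
  rewrite (le_trans (nm_sum _ _ _)) // (le_trans _ ((hD k).1 _ nx n)) //.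
  by rewrite ler_sum // => i _; exact: nm_leval.
have : clim (fun n => csum (F n)) (csum (f^~ x)).
  apply: (csum_dominated (hM _ nx) bF) => k.
  apply: (@clim_unshift _ _ _ _ k.+1).
  apply: clim_ext (clim_shift k.+1 ((hD k).2 x x0)) => n /=.
  by rewrite /F addnS ltnS leq_addl.
move=> hF; apply: clim_ext hF => n; apply: csum_unique.
apply: (@clim_unshift _ _ _ _ n); apply: clim_ext (clim_cst _) => m.
rewrite addnC big_split_ord /= [X in _ = _ + X]big1 => [|i _]; last first.
  by rewrite /F ltnNge leq_addr.
rewrite addr0; under [RHS]eq_bigr do rewrite /F ltn_ord.
rewrite -(key _ (fun k i => leval (D k i) x)); apply: eq_bigr => k _.
rewrite leval_cat -[_ ++ _]/(flatten [seq D k i | i <- iota 0 k.+1]).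
by rewrite !leval_flatten.
Qed.

(** The product [qp p (t * x ^ n) k] multiplied out without collecting terms: nothing cancels, hence
    the exact norm in [lnorm_qlist]. *)
Fixpoint qlist (p t : K) (n : int) k : lpoly K :=
  if k is j.+1 then qlist p t n j ++ lmul (qlist p t n j) [:: (- (t * p ^+ j), n)]
  else [:: (1, 0)].

Lemma leval_qlist p t n k x : x != 0 -> leval (qlist p t n k) x = qp p (t * x ^ n) k.
Proof.
move=> x0; elim: k => [|k IH]; first by rewrite qp0 /leval big_seq1 expr0z mulr1.
by rewrite /= leval_cat leval_mul // IH qpSr /leval big_seq1 /=; ring.
Qed.

Lemma lnorm_qlist p t n k r : 0 < r ->
  lnorm (qlist p t n k) r = \prod_(i < k) (1 + nm t * r ^ n * nm p ^+ i).
Proof.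
move=> r0; elim: k => [|k IH].
  by rewrite /lnorm big_seq1 big_ord0 expr0z mulr1 nm1.
rewrite /= lnorm_cat lnorm_mul // IH big_ord_recr /= {1}/lnorm big_seq1 /=.
by rewrite nmN nmM nmX; ring.
Qed.

Lemma lnorm_qlist_le p t n k r : nm p < 1 -> 0 < r ->
  lnorm (qlist p t n k) r <= ebd p (nm t * r ^ n).
Proof.
by move=> p1 r0; rewrite lnorm_qlist // prod_le_ebd // mulr_ge0 ?nm_ge0 // exprz_ge0 // ltW.
Qed.

Lemma laurent_qp (p t : K) (n : int) k : nm p < 1 ->
  laurent (fun x => qp p (t * x ^ n) k) (fun r => ebd p (nm t * r ^ n)).
Proof.
move=> p1; exists (fun j => if j is 0%N then qlist p t n k else [::]); split=> [r r0 j|x x0].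
  case: j => [|j]; first by rewrite big_ord0 ebd_ge0.
  rewrite big_ord_recl big1 ?addr0 => [|i _]; last by rewrite /lnorm big_nil.
  exact: lnorm_qlist_le.
apply: (@clim_unshift _ _ _ _ 1); apply: clim_ext (clim_cst _) => j.
rewrite addn1 big_ord_recl big1 ?addr0 => [|i _]; last by rewrite /leval big_nil.
by rewrite leval_qlist.
Qed.

Lemma laurent_qinf (p t : K) (n : int) : nm p < 1 ->
  laurent (fun x => qinf p (t * x ^ n)) (fun r => ebd p (nm t * r ^ n)).
Proof.
move=> p1.
(* The monomials added from [qlist p t n j] to the next list; by [cumul] the partial sums are the
   values on [qlist]. *)
pose D k := if k is j.+1 then lmul (qlist p t n j) [:: (- (t * p ^+ j), n)] else [:: (1, 0)].
have cumul (A : nmodType) (F : lpoly K -> A) k :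
    (forall P Q, F (P ++ Q) = F P + F Q) ->
    \sum_(j < k.+1) F (D j) = F (qlist p t n k).
  move=> FD; elim: k => [|k IH]; first by rewrite big_ord1.
  by rewrite big_ord_recr /= IH FD.
exists D; split=> [r r0 [|k]|x x0].
- by rewrite big_ord0 ebd_ge0.
- rewrite (cumul _ (fun P => lnorm P r)) => [|P Q]; last exact: lnorm_cat.
  exact: lnorm_qlist_le.
- apply: (@clim_unshift _ _ _ _ 1); apply: clim_ext (qinf_clim p1 (t * x ^ n)) => k.
  rewrite addn1 (cumul _ (fun P => leval P x)) => [|P Q]; last exact: leval_cat.
  by rewrite leval_qlist.
Qed.

Lemma laurent_prod (I : Type) (s : seq I) (F : I -> K -> K) (N : I -> R -> R) :
  (forall i, laurent (F i) (N i)) ->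
  laurent (fun x => \prod_(i <- s) F i x) (fun r => \prod_(i <- s) N i r).
Proof.
move=> hF; elim: s => [|i s [D [hN hD]]].
  have [D [hN hD]] := laurent_cst 1; exists D; split=> [r r0 n|x x0].
    by rewrite big_nil -(nm1 K); exact: hN.
  by rewrite big_nil; exact: hD.
have [E [hM hE]] := laurentM (hF i) (ex_intro _ D (conj hN hD)).
exists E; split=> [r r0 n|x x0]; first by rewrite big_cons; exact: hM.
by rewrite big_cons; exact: hE.
Qed.

(** Coefficients read off some expansion of f; [lcoefs_unique] shows that they depend only on f. *)
Definition lcoefs f c := exists D, exists N,
  lexpansion D f N /\ forall n, c n = csum (fun k => lcoef (D k) n).

Lemma laurent_lcoefs f N : laurent f N -> exists c, lcoefs f c.
Proof.
by move=> [D hD]; exists (fun n => csum (fun k => lcoef (D k) n)); exists D, N.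
Qed.

Lemma lexpansion_lcoef D f N n k : lexpansion D f N -> nm (lcoef (D k) n) <= lnorm (D k) 1.
Proof. by move=> _; have := nm_lcoef (D k) n ltr01; rewrite exp1rz mulr1. Qed.

Lemma lcoef_clim D f N n : lexpansion D f N ->
  clim (fun m => \sum_(k < m) lcoef (D k) n) (csum (fun k => lcoef (D k) n)).
Proof.
move=> hD; apply: csumP (lexpansion_bsum hD ltr01) _ => k.
exact: lexpansion_lcoef hD.
Qed.

Lemma nm_part_tail D f N x (T : R) m : lexpansion D f N -> x != 0 ->
  (forall j, \sum_(k < j) lnorm (D (m + k)%N) (nm x) <= T) ->
  nm (f x - leval (lpart D m) x) <= T.
Proof.
move=> hD x0 hT; rewrite leval_part.
have nx : 0 < nm x by rewrite nm_gt0.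
have := csum_tail (lexpansion_bsum hD nx) (fun k => nm_leval (D k) x) hT.
by rewrite (csum_unique (hD.2 x x0)).
Qed.

(** On the unit circle the partial sums are uniformly close to f = 0, so [nm_lcoef_sup] makes their
    coefficients small. *)
Lemma lcoefs_eq0 f c : lcoefs f c -> (forall x, x != 0 -> f x = 0) -> forall n, c n = 0.
Proof.
move=> [D [N [hD hc]]] f0 n; rewrite hc.
apply: (clim_unique (lcoef_clim n hD)) => e e0.
have [L hL] := bsum_tail (lexpansion_bsum hD ltr01) (divr_gt0 e0 (ltr0Sn _ 1)).
exists L => m Lm; rewrite subr0 -lcoef_part.
apply: (@le_lt_trans _ _ (e / 2)); last by lra.
apply: nm_lcoef_sup => x nx.
have x0 : x != 0 by rewrite -nm_gt0 nx.
rewrite -nmN -[- _]add0r -(f0 x x0); apply: nm_part_tail hD x0 _ => j.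
rewrite nx (le_trans _ (ltW (hL (m - L + j)%N))) // big_split_ord /=.
rewrite ler_wpDl //; first by rewrite sumr_ge0 // => k _; rewrite lnorm_ge0.
by rewrite le_eqVlt; apply/orP; left; apply/eqP; apply: eq_bigr => k _; rewrite addnA subnKC.
Qed.

Lemma lcoefs_inj f c : lcoefs f c -> (forall n, c n = 0) -> forall x, x != 0 -> f x = 0.
Proof.
move=> [D [N [hD hc]]] c0 x x0.
have nx : 0 < nm x by rewrite nm_gt0.
suff h0 : clim (fun m => leval (lpart D m) x) 0.
  apply: (clim_unique _ h0); apply: clim_ext (hD.2 x x0) => m.
  by rewrite leval_part.
move=> e e0; have e2 : 0 < e / 2 by rewrite divr_gt0.
have [M hM] := bsum_tail (lexpansion_bsum hD nx) e2.
exists M => m Mm; rewrite subr0.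
pose I := undup [seq a.2 | a <- lpart D m].
have uI : uniq I by exact: undup_uniq.
(* The part of the j-th partial sum supported on the exponents of the m-th. It is the whole m-th sum
   for j = m, tends to 0 as j grows since all [c n] vanish, and varies from m on by at most a tail
   of the majorant. *)
pose E j := \sum_(n <- I) lcoef (lpart D j) n * x ^ n.
have Em : E m = leval (lpart D m) x.
  rewrite /E leval_coef // /leval big_seq_cond [RHS]big_seq; apply: eq_bigl => a.
  by rewrite andb_idr // => aP; rewrite mem_undup map_f.
have E0 : clim E 0.
  have -> : 0 = \sum_(n <- I) 0 * x ^ n :> K by rewrite big1 // => n _; rewrite mul0r.
  apply: clim_sum => n; apply: climM; last exact: clim_cst.
  rewrite -(c0 n) hc; apply: clim_ext (lcoef_clim n hD) => j.
  by rewrite lcoef_part.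
rewrite -Em; have [J hJ] := E0 _ e2.
have {}hJ := hJ (m + J)%N (leq_addl _ _); rewrite subr0 in hJ.
have dE : nm (E (m + J)%N - E m) <= \sum_(k < J) lnorm (D (m + k)%N) (nm x).
  have -> : E (m + J)%N - E m =
      \sum_(k < J) \sum_(n <- I) lcoef (D (m + k)%N) n * x ^ n.
    rewrite exchange_big -sumrB; apply: eq_bigr => n _.
    rewrite !lcoef_part big_split_ord /= mulrDl addrAC subrr add0r.
    by rewrite mulr_suml.
  rewrite (le_trans (nm_sum _ _ _)) // ler_sum // => k _.
  rewrite leval_coef // (le_trans (nm_sum _ _ _)) // big_mkcond /lnorm ler_sum // => a _.
  by case: ifP => _; rewrite ?nmM ?nmXz // mulr_ge0 ?nm_ge0 // exprz_ge0 ?nm_ge0.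
have h2 : \sum_(k < J) lnorm (D (m + k)%N) (nm x) < e / 2.
  apply: le_lt_trans (hM (m - M + J)%N); rewrite big_split_ord /=.
  rewrite ler_wpDl //; first by rewrite sumr_ge0 // => k _; rewrite lnorm_ge0.
  by rewrite le_eqVlt; apply/orP; left; apply/eqP; apply: eq_bigr => k _; rewrite addnA subnKC.
have := nm_triangle (E m) (E (m + J)%N) 0; rewrite !subr0 nm_distC.
by lra.
Qed.

Lemma lcoefs_ext f g c : (forall x, x != 0 -> f x = g x) -> lcoefs f c -> lcoefs g c.
Proof.
move=> fg [D [N [[hN hf] hc]]]; exists D, N; split=> //; split=> // x x0.
by rewrite -fg //; exact: hf.
Qed.

(* Substitutions x -> u x^(+-1) and multiplication by powers of x.             *)
Lemma lcoefs_map f c (w : int -> K) (s t : int -> int) (m r' : R -> R) (k x' : K -> K) :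
  cancel s t -> cancel t s ->
  (forall r, 0 < r -> 0 < r' r) ->
  (forall r n, 0 < r -> nm (w n) * r ^ s n = m r * r' r ^ n) ->
  (forall x, x != 0 -> x' x != 0) ->
  (forall x n, x != 0 -> w n * x ^ s n = k x * x' x ^ n) ->
  lcoefs f c -> lcoefs (fun x => k x * f (x' x)) (fun n => w (t n) * c (t n)).
Proof.
move=> st ts r'0 hm x'0 hk [D [N [hD hc]]].
pose E j := [seq (w a.2 * a.1, s a.2) | a <- D j].
exists E, (fun r => m r * N (r' r)); split; last first.
  move=> n; rewrite hc -(csumZ _ (lexpansion_bsum hD ltr01)) => [|j]; last exact: lexpansion_lcoef hD.
  apply: eq_csum => j; rewrite /lcoef big_map /= mulr_sumr.
  apply: eq_big => [a|a /eqP <-] //.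
  by rewrite -(can_eq st) ts.
have nE r j : 0 < r -> lnorm (E j) r = m r * lnorm (D j) (r' r).
  move=> r0; rewrite /lnorm big_map mulr_sumr; apply: eq_bigr => a _ /=.
  by rewrite nmM mulrAC hm // -mulrA (mulrC (nm _)).
split=> [r r0 n|x x0].
  have m0 : 0 <= m r by have := hm r 0 r0; rewrite expr0z mulr1 => <-; rewrite mulr_ge0 ?nm_ge0 // exprz_ge0 // ltW.
  under eq_bigr do rewrite nE //.
  by rewrite -mulr_sumr ler_wpM2l // (hD.1 _ (r'0 _ r0)).
apply: clim_ext (climZ (k x) (hD.2 _ (x'0 _ x0))) => n.
rewrite mulr_sumr; apply: eq_bigr => j _.
rewrite /leval big_map mulr_sumr; apply: eq_bigr => a _ /=.
by rewrite mulrAC hk // -mulrA (mulrC (_ ^ _)).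
Qed.

Lemma lcoefs_scale f c u : u != 0 -> lcoefs f c -> lcoefs (fun x => f (u * x)) (fun n => u ^ n * c n).
Proof.
move=> u0 hf.
have := @lcoefs_map f c (fun n => u ^ n) id id (fun=> 1) (fun r => nm u * r) (fun=> 1) (fun x => u * x).
move=> /(_ (fun=> erefl) (fun=> erefl)) h; apply: lcoefs_ext (h _ _ _ _ hf) => [x _|r r0|r n r0|x x0|x n x0].
- by rewrite mul1r.
- by rewrite mulr_gt0 ?nm_gt0.
- by rewrite mul1r nmXz expfzMl.
- by rewrite mulf_neq0.
- by rewrite mul1r expfzMl.
Qed.

Lemma lcoefs_shift f c (m : int) : lcoefs f c -> lcoefs (fun x => x ^ m * f x) (fun n => c (n - m)).
Proof.
move=> hf.
have := @lcoefs_map f c (fun=> 1) (fun n => n + m) (fun n => n - m) (fun r => r ^ m) id (fun x => x ^ m) id.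
move=> /(_ (addrK m) (subrK m)) h.
have {h} := h _ _ _ _ hf; have -> : (fun n => 1 * c (n - m)) = (fun n => c (n - m)).
  by apply/funext => n; rewrite mul1r.
apply=> // [r n r0|x n x0]; first by rewrite nm1 mul1r addrC expfzDr ?gt_eqF.
by rewrite mul1r addrC expfzDr.
Qed.

Lemma lcoefs_inv f c : lcoefs f c -> lcoefs (fun x => f x^-1) (fun n => c (- n)).
Proof.
move=> hf.
have := @lcoefs_map f c (fun=> 1) -%R -%R (fun=> 1) GRing.inv (fun=> 1) GRing.inv.
move=> /(_ (@opprK _) (@opprK _)) h; have {h} := h _ _ _ _ hf.
have -> : (fun n => 1 * c (- n)) = (fun n => c (- n)).
  by apply/funext => n; rewrite mul1r.
have -> : (fun x => 1 * f x^-1) = (fun x => f x^-1).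
  by apply/funext => n; rewrite mul1r.
apply=> [r r0|r n r0|x x0|x n x0]; rewrite ?invr_gt0 ?invr_eq0 //.
  by rewrite nm1 exprz_inv.
by rewrite exprz_inv.
Qed.

Lemma lcoefsZ f c a : lcoefs f c -> lcoefs (fun x => a * f x) (fun n => a * c n).
Proof.
move=> hf.
have := @lcoefs_map f c (fun=> a) id id (fun=> nm a) id (fun=> a) id.
by apply.
Qed.

Lemma lcoefsD f g c d : lcoefs f c -> lcoefs g d ->
  lcoefs (fun x => f x + g x) (fun n => c n + d n).
Proof.
move=> [D [N [hD hc]]] [E [M [hE hd]]].
exists (fun k => D k ++ E k), (fun r => N r + M r); split; last first.
  move=> n; rewrite hc hd.
  have hb k := lexpansion_lcoef n k hD; have hb' k := lexpansion_lcoef n k hE.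
  rewrite -(csumD (lexpansion_bsum hD ltr01) hb (lexpansion_bsum hE ltr01) hb').
  by apply: eq_csum => k; rewrite /lcoef big_cat.
split=> [r r0 n|x x0].
  by under eq_bigr do rewrite lnorm_cat; rewrite big_split lerD ?hD.1 ?hE.1 // ?(hD.1 _ r0) ?(hE.1 _ r0).
apply: clim_ext (climD (hD.2 x x0) (hE.2 x x0)) => n /=.
by rewrite -big_split; apply: eq_bigr => k _; rewrite leval_cat.
Qed.

Lemma lcoefs_unique f g c d : (forall x, x != 0 -> f x = g x) ->
  lcoefs f c -> lcoefs g d -> forall n, c n = d n.
Proof.
move=> fg hf hg n; have := lcoefsD hf (lcoefsZ (-1) hg).
move/lcoefs_eq0 => /(_ _ n); rewrite mulN1r => h.
by apply/eqP; rewrite -subr_eq0 h // => x x0; rewrite fg // mulN1r subrr.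
Qed.

(** Elements of [V] are determined by their coefficients i and j, so independence of g and h makes
    the 2 by 2 determinant [dt] of these coefficients nonzero, and Cramer's rule gives a and b.
    Independence is stated on functions because it is checked by evaluation at points. *)
Lemma laurent_span2 (V : (K -> K) -> Prop) (i j : int) f g h :
  (forall F G a b, V F -> V G -> V (fun x => a * F x + b * G x)) ->
  (forall F, V F -> exists c, lcoefs F c) ->
  (forall F c, V F -> lcoefs F c -> c i = 0 -> c j = 0 -> forall n, c n = 0) ->
  V f -> V g -> V h ->
  (forall a b, (forall x, x != 0 -> a * g x + b * h x = 0) -> a = 0 /\ b = 0) ->
  exists a, exists b, forall x, x != 0 -> f x = a * g x + b * h x.
Proof.
move=> VD Vc Vdet Vf Vg Vh free.
have [cf hf] := Vc _ Vf; have [cg hg] := Vc _ Vg; have [ch hh] := Vc _ Vh.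
have comb a b : a * cg i + b * ch i = 0 -> a * cg j + b * ch j = 0 -> a = 0 /\ b = 0.
  move=> ei ej; apply: free => x x0.
  have Vab := VD _ _ a b Vg Vh.
  have hab := lcoefsD (lcoefsZ a hg) (lcoefsZ b hh).
  exact: (lcoefs_inj hab (Vdet _ _ Vab hab ei ej)).
pose dt := cg i * ch j - cg j * ch i.
have dt0 : dt != 0.
  (* A vanishing determinant makes (ch i, - cg i) and (ch j, - cg j) relations between g and h, so
     all four coefficients are 0, and then 1 * g + 0 * h = 0 is a relation too. *)
  apply/eqP => dt0.
  have [|| hi0 gi0] := comb (ch i) (- cg i); first by ring.
    by rewrite -oppr0 -dt0 /dt; ring.
  have [|| hj0 gj0] := comb (ch j) (- cg j); first by rewrite -dt0 /dt; ring.
    by ring.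
  have [||/eqP] := comb 1 0; last by rewrite oner_eq0.
    by rewrite mul0r addr0 mul1r -[LHS]opprK gi0 oppr0.
  by rewrite mul0r addr0 mul1r -[LHS]opprK gj0 oppr0.
pose a := (cf i * ch j - cf j * ch i) / dt.
pose b := (cg i * cf j - cg j * cf i) / dt.
exists a, b => x x0.
have V3 := VD _ _ 1 (-1) Vf (VD _ _ a b Vg Vh).
have h3 := lcoefsD (lcoefsZ 1 hf) (lcoefsZ (-1) (lcoefsD (lcoefsZ a hg) (lcoefsZ b hh))).
have ei : 1 * cf i + -1 * (a * cg i + b * ch i) = 0.
  by rewrite /a /b /dt in dt0 *; field.
have ej : 1 * cf j + -1 * (a * cg j + b * ch j) = 0.
  by rewrite /a /b /dt in dt0 *; field.
have := lcoefs_inj h3 (Vdet _ _ V3 h3 ei ej) x0.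
by rewrite mul1r mulN1r => /subr0_eq.
Qed.

End LaurentFunctions.

(** The recurrence propagates the zeros of one period upwards, and downwards because [k n] never
    vanishes. *)
Lemma periodic_recurrence_eq0 (K : idomainType) (m : nat) (c k : int -> K) :
  (0 < m)%N -> (forall n, k n != 0) -> (forall n, c n = k n * c (n - m%:Z)) ->
  (forall i : nat, (i < m)%N -> c i = 0) -> forall n, c n = 0.
Proof.
move=> m0 k0 ck c0.
have up (j : nat) : forall i : nat, (i < m)%N -> c ((i + j * m)%N : int) = 0.
  elim: j => [|j IH] i im; first by rewrite mul0n addn0 c0.
  rewrite ck (_ : ((i + j.+1 * m)%N : int) - m%:Z = (i + j * m)%N) ?IH ?mulr0 //.
  by rewrite mulSn; lia.
have down (j : nat) : forall i : nat, (i < m)%N -> c (i%:Z - (j * m)%N%:Z) = 0.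
  elim: j => [|j IH] i im; first by rewrite mul0n subr0 c0.
  have := ck (i%:Z - (j * m)%N%:Z); rewrite IH // => /esym/eqP.
  rewrite mulf_eq0 (negbTE (k0 _)) => /eqP <-; congr c.
  by rewrite mulSn; lia.
case=> n; first by rewrite (divn_eq n m) addnC up // ltn_mod.
have h : (n %% m < m)%N by rewrite ltn_mod.
have := down (n %/ m).+1 (m - (n %% m).+1)%N; rewrite (_ : (m - (n %% m).+1 < m)%N); last by lia.
move=> /(_ isT) <-; congr c; rewrite NegzE {1}(divn_eq n m) mulSn.
by lia.
Qed.

Lemma thetaE (R : realType) (K : modulusField R) (z p : K) :
  theta z p = qinf p z * qinf p (p / z).
Proof. by rewrite /theta /qinfs big_cons big_seq1. Qed.

(** * Theta functions *)

Section Theta.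
Variables (R : realType) (K : modulusField R) (q : K).
Hypotheses (q1 : nm q < 1) (q0 : q != 0).
Implicit Types x y z p : K.

Lemma theta_shift z : z != 0 -> theta (q * z) q = - (theta z q / z).
Proof.
move=> z0; rewrite !thetaE (qinf_recl q1 z) (mulrC q z).
have -> : q / (z * q) = z^-1 by rewrite invfM mulrCA mulfV ?mulr1.
by rewrite (qinf_recl q1 z^-1) (mulrC z^-1 q); field.
Qed.

Lemma theta_refl z : z != 0 -> theta (q / z) q = theta z q.
Proof. by move=> z0; rewrite !thetaE mulrC invf_div mulrCA mulfV ?mulr1. Qed.

Lemma theta_inv z : z != 0 -> theta z^-1 q = - (theta z q / z).
Proof. by move=> z0; rewrite -theta_shift // -[RHS]theta_refl ?mulf_neq0 // invfM mulVKf. Qed.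

Lemma theta1 : theta 1 q = 0.
Proof. by rewrite thetaE qinf1 ?mul0r. Qed.

Lemma thetaqN : theta (-1) q = 2 * qinf q (- q) ^+ 2.
Proof. by rewrite thetaE qinf_recl // invrN1 mulrN1 mulN1r; ring. Qed.

Lemma one_sub_expr_neq0 x n : nm x < 1 -> 1 - x * q ^+ n != 0.
Proof.
move=> x1; rewrite subr_eq0; apply/eqP => /(congr1 nm).
rewrite nm1 nmM nmX => e.
have : nm x * nm q ^+ n < 1; last by rewrite -e ltxx.
by rewrite (le_lt_trans _ x1) // ler_piMr ?nm_ge0 // exprn_ile1 ?nm_ge0 // ltW.
Qed.

Lemma qinf_neq0_small x : nm x < 1 -> qinf q x != 0.
Proof. by move=> x1; apply: qinf_neq0 => // n; exact: one_sub_expr_neq0. Qed.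

Lemma thetaN1_neq0 : theta (-1) q != 0.
Proof.
by rewrite thetaqN mulf_neq0 ?pnatr_eq0 // expf_neq0 // qinf_neq0_small // nmN.
Qed.

Lemma laurent_theta (t p : K) (n : int) : nm p < 1 ->
  exists N, laurent (fun x => theta (t * x ^ n) p) N.
Proof.
move=> p1; exists (fun r => ebd p (nm t * r ^ n) * ebd p (nm (p / t) * r ^ (- n))).
apply: laurent_ext (laurentM (laurent_qinf t n p1) (laurent_qinf (p / t) (- n) p1)).
by move=> x x0; rewrite thetaE invfM -invr_expz mulrA.
Qed.

Lemma theta_base2 z : theta z (q ^+ 2) * theta (q * z) (q ^+ 2) = theta z q.
Proof.
(* At z = 0 the convention 0^-1 = 0 makes every factor [qinf] of 0, that is 1. *)
have [->|z0] := eqVneq z 0.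
  by rewrite !thetaE mulr0 invr0 !mulr0 !qinf0 ?mulr1 ?sqr_lt1.
rewrite !thetaE (qinf_double q1 z) (qinf_double q1 (q / z)).
have -> : q ^+ 2 / (q * z) = q / z by field; apply/andP.
have -> : q ^+ 2 / z = q / z * q by field.
by rewrite (mulrC q z); ring.
Qed.

End Theta.

(** * Addition formulas for theta functions *)

Section ThetaIdentities.
Variables (R : realType) (K : modulusField R) (q : K).
Hypotheses (q1 : nm q < 1) (q0 : q != 0).
Implicit Types x y z p u v w : K.

(* Both sides, as functions of [y], satisfy f(q^2 y) = f(y) / (q y^2), a       *)
(* relation whose Laurent solutions are spanned by theta(y) and theta(-y).     *)
Lemma theta_mul_base2 p y : p != 0 -> y != 0 ->
  theta (p * y) (q ^+ 2) * theta (q * p / y) (q ^+ 2) * theta (-1) q =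
  theta (- p) q * theta y q + theta p q * theta (- y) q.
Proof.
move=> p0 y0.
have q21 := sqr_lt1 q1; have q20 : q ^+ 2 != 0 by rewrite expf_neq0.
pose V F := (exists N, laurent F N) /\ forall x, x != 0 -> q * (x ^ 2 * F (q ^+ 2 * x)) = F x.
pose f x := theta (p * x) (q ^+ 2) * theta (q * p / x) (q ^+ 2).
have shift2 z : z != 0 -> theta (q ^+ 2 * z) q = theta z q / (q * z ^+ 2).
  move=> z0; rewrite expr2 -mulrA !(theta_shift q1 q0) ?mulf_neq0 //.
  by field; apply/andP.
have Vt (s : K) : s ^+ 2 = 1 -> V (fun x => theta (s * x) q).
  move=> s2; have s0 : s != 0 by apply/eqP => h; move: s2; rewrite h expr0n => /eqP; rewrite eq_sym oner_eq0.
  split; first by have [N hN] := laurent_theta s 1 q1; exists N.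
  move=> x x0; rewrite (mulrCA s) shift2 ?mulf_neq0 // exprMn s2 mul1r -[x ^ 2]/(x ^+ 2).
  by field; apply/andP.
have [|||||||a [b fE]] := @laurent_span2 R K V 0 1 f (fun x => theta (1 * x) q) (fun x => theta (-1 * x) q).
- move=> F G a b [[N hN] hF] [[M hM] hG]; split.
    by eexists; exact: laurentD (laurentZ a hN) (laurentZ b hM).
  by move=> x x0; rewrite -[in RHS]hF // -[in RHS]hG //; ring.
- by move=> F [[N hN] _]; exact: laurent_lcoefs hN.
- move=> F c [_ hF] hc; move=> c0 c1.
  apply: (@periodic_recurrence_eq0 K 2 c (fun n => q * (q ^+ 2) ^ (n - 2))) => //.
  - by move=> n; rewrite mulf_neq0 // expfz_neq0.
  - move=> n; have h := lcoefsZ q (lcoefs_shift 2 (lcoefs_scale q20 hc)).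
    by rewrite -(lcoefs_unique hF h hc) mulrA.
  - by case=> [|[|]].
- split.
    have [N hN] := laurent_theta p 1 q21; have [M hM] := laurent_theta (q * p) (-1) q21.
    by eexists; exact: laurentM hN hM.
  move=> x x0; rewrite /f.
  have th2 z := theta_shift q21 q20 (z := z).
  rewrite (mulrCA p) th2 ?mulf_neq0 //.
  have -> : theta (q * p / x) (q ^+ 2) = - (theta (q * p / (q ^+ 2 * x)) (q ^+ 2) / (q * p / (q ^+ 2 * x))).
    rewrite -th2 ?mulf_neq0 ?invr_eq0 ?mulf_neq0 //.
    by congr theta; field; apply/andP.
  by rewrite -[x ^ 2]/(x ^+ 2); field; do ?[apply/andP; split].
- by apply: Vt; rewrite expr1n.
- by apply: Vt; rewrite sqrrN expr1n.
- move=> a b h; have t0 := thetaN1_neq0 q1; have n10 : (-1 : K) != 0 by rewrite oppr_eq0 oner_eq0.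
  split; apply/eqP.
    have /eqP := h _ n10.
    by rewrite mul1r mulN1r opprK (theta1 q1) mulr0 addr0 mulf_eq0 (negbTE t0) orbF.
  have /eqP := h _ (oner_neq0 _).
  by rewrite mul1r mulN1r (theta1 q1) mulr0 add0r mulf_eq0 (negbTE t0) orbF.
have {}fE x : x != 0 -> f x = a * theta x q + b * theta (- x) q.
  by move=> x0; rewrite fE // mul1r mulN1r.
have n10 : (-1 : K) != 0 by rewrite oppr_eq0 oner_eq0.
have e1 : b * theta (-1) q = theta p q.
  have := fE 1 (oner_neq0 _); rewrite /f (theta1 q1) mulr0 add0r => <-.
  by rewrite mulr1 divr1 theta_base2.
have e2 : a * theta (-1) q = theta (- p) q.
  have := fE _ n10; rewrite /f opprK (theta1 q1) mulr0 addr0 => <-.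
  by rewrite invrN1 !mulrN1 -mulrN theta_base2.
rewrite -[X in X * _]/(f y) fE // -e1 -e2; ring.
Qed.

(** This is [theta_mul_base2] at q y: quasi-periodicity turns the sum into a difference. *)
Lemma theta_mul_base2_shift x y : x != 0 -> y != 0 ->
  y * (theta (q * (x * y)) (q ^+ 2) * theta (x / y) (q ^+ 2)) * theta (-1) q =
  theta x q * theta (- y) q - theta (- x) q * theta y q.
Proof.
move=> x0 y0; have := theta_mul_base2 x0 (mulf_neq0 q0 y0).
rewrite -mulrN !(theta_shift q1 q0) ?oppr_eq0 // mulrCA.
have -> : q * x / (q * y) = x / y by field; apply/andP.
by rewrite -!mulrA => ->; field.
Qed.

(** The left side is regrouped into products of the sums and differences of [theta_mul_base2] and
    its shift, hence into theta functions to the base q^2. Since p v = u / w, two of these merge by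
    [theta_base2], and the others are the sum and difference belonging to the pair u / v, v w. *)
Lemma theta_three_term u v w : u != 0 -> v != 0 -> w != 0 ->
  theta (- (u / (v * w))) q * theta (- u) q * theta v q * theta w q +
  theta (u / (v * w)) q * theta u q * theta (- v) q * theta (- w) q =
  theta (-1) q * theta (u / v) q * theta (- (v * w)) q * theta (u / w) q.
Proof.
move=> u0 v0 w0; set p := u / (v * w).
have p0 : p != 0 by rewrite mulf_neq0 ?invr_eq0 ?mulf_neq0.
have t0 := thetaN1_neq0 q1.
have a1 := theta_mul_base2 p0 v0; have b1 := theta_mul_base2_shift p0 v0.
have a2 := theta_mul_base2 u0 w0; have b2 := theta_mul_base2_shift u0 w0.
have uv0 : u / v != 0 by rewrite mulf_neq0 ?invr_eq0.
have vw0 := mulf_neq0 v0 w0.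
have a3 := theta_mul_base2 uv0 vw0; have b3 := theta_mul_base2_shift uv0 vw0.
have e1 : p * v = u / w by rewrite /p; field; apply/andP.
have e2 : u / v * (v * w) = u * w by field.
have e3 : q * (u / v) / (v * w) = q * p / v by rewrite /p; field; apply/andP.
have e4 : u / v / (v * w) = p / v by rewrite /p; field; apply/andP.
have e5 : q * u / w = q * (u / w) by rewrite mulrA.
rewrite e1 in a1 b1; rewrite e5 in a2; rewrite e2 e3 in a3; rewrite e2 e4 in b3.
have d := theta_base2 q1 q0 (u / w).
move: (theta (-1) q) t0 a1 b1 a2 b2 a3 b3 => t t0 a1 b1 a2 b2 a3 b3.
apply: (mulfI (_ : 4 != 0 :> K)); first by rewrite pnatr_eq0.
set P := theta p q in a1 b1 *; set P' := theta (- p) q in a1 b1 *.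
set V := theta v q in a1 b1 *; set V' := theta (- v) q in a1 b1 *.
set U := theta u q in a2 b2 *; set U' := theta (- u) q in a2 b2 *.
set W := theta w q in a2 b2 *; set W' := theta (- w) q in a2 b2 *.
have -> : 4 * (P' * U' * V * W + P * U * V' * W') =
  2 * ((P' * V + P * V') * (U' * W + U * W') + (P * V' - P' * V) * (U * W' - U' * W)).
  by ring.
rewrite -a1 -b1 -a2 -b2.
set T := theta (u / v) q in a3 b3 *; set T' := theta (- (u / v)) q in a3 b3 *.
set Z := theta (v * w) q in a3 b3 *; set Z' := theta (- (v * w)) q in a3 b3 *.
have -> : 4 * (t * T * Z' * theta (u / w) q) =
  2 * (t * theta (u / w) q * ((T' * Z + T * Z') + (T * Z' - T' * Z))) by ring.
by rewrite -a3 -b3 -d; ring.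
Qed.

(** The difference of squares factors into the sum and the difference of the two preceding product
    formulas. *)
Lemma theta_square_diff w y : w != 0 -> y != 0 ->
  w * theta (-1) q ^+ 2 * theta (y / w) q * theta (y * w) q =
  theta (- w) q ^+ 2 * theta y q ^+ 2 - theta w q ^+ 2 * theta (- y) q ^+ 2.
Proof.
move=> w0 y0; have wy0 := mulf_neq0 w0 y0.
have a := theta_mul_base2 w0 y0; have b := theta_mul_base2_shift w0 y0.
have d1 := theta_base2 q1 q0 (w / y); have d2 := theta_base2 q1 q0 (w * y).
have i : theta (w / y) q = - (theta (y / w) q / (y / w)).
  by rewrite -(theta_inv q1 q0) ?invf_div // mulf_neq0 ?invr_eq0.
have -> : theta (- w) q ^+ 2 * theta y q ^+ 2 - theta w q ^+ 2 * theta (- y) q ^+ 2 =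
  - ((theta (- w) q * theta y q + theta w q * theta (- y) q) *
     (theta w q * theta (- y) q - theta (- w) q * theta y q)) by ring.
rewrite -a -b -(mulrA q).
transitivity (- (y * theta (-1) q ^+ 2 * theta (w / y) q * theta (w * y) q)).
  by rewrite i (mulrC y w); field; apply/andP.
by rewrite -d1 -d2; ring.
Qed.

(** The link between the two 8Psi8: for u, v, w, y equal to sqrt(q)/sqrt(cd) times b, a, 1, c, the
    two sums in parentheses are the ones in their evaluations. Expanding the base q^2 product by
    [theta_mul_base2] and applying [theta_three_term] at w and at - w leaves a remainder given by
    [theta_square_diff]. *)
Lemma theta_relation u v w y : u != 0 -> v != 0 -> w != 0 -> y != 0 ->
  theta (u / (v * w) * y) (q ^+ 2) * theta (q * (u / (v * w)) / y) (q ^+ 2) * theta (- w) q *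
   (theta u q * theta y q * theta (- v) q * theta (- w) q +
    theta (- u) q * theta (- y) q * theta v q * theta w q) =
  theta (u / v) q * theta (- y) q *
   (theta (- (v * w)) q * theta y q * theta (u / w) q * theta (- w) q +
    theta (v * w) q * theta (- y) q * theta (- (u / w)) q * theta w q) +
  w * theta (-1) q * theta (y / w) q * theta (y * w) q *
   theta (- v) q * theta u q * theta (- (u / (v * w))) q.
Proof.
move=> u0 v0 w0 y0; set p := u / (v * w).
have p0 : p != 0 by rewrite mulf_neq0 ?invr_eq0 ?mulf_neq0.
have nw0 : - w != 0 by rewrite oppr_eq0.
have r1 := theta_three_term u0 v0 w0; rewrite -/p in r1.
have r2 := theta_three_term u0 v0 nw0.
rewrite opprK mulrN opprK !invrN !mulrN !opprK -/p in r2.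
have a := theta_mul_base2 p0 y0; have s := theta_square_diff w0 y0.
apply: (mulfI (thetaN1_neq0 q1)).
move: (theta (-1) q) r1 r2 a s => t r1 r2 a s.
set A := theta (p * y) _ in a *; set B := theta (q * p / y) _ in a *.
transitivity ((A * B * t) * theta (- w) q *
   (theta u q * theta y q * theta (- v) q * theta (- w) q +
    theta (- u) q * theta (- y) q * theta v q * theta w q)); first by ring.
rewrite a.
transitivity (theta (- y) q * theta y q * theta (- w) q *
     (t * theta (u / v) q * theta (- (v * w)) q * theta (u / w) q) +
   theta (- y) q ^+ 2 * theta w q *
     (t * theta (u / v) q * theta (v * w) q * theta (- (u / w)) q) +
   (w * t ^+ 2 * theta (y / w) q * theta (y * w) q) *
   (theta (- v) q * theta u q * theta (- p) q)); last by ring.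
by rewrite -r1 -r2 s; ring.
Qed.

End ThetaIdentities.

(** * Whipple's sum *)

Section Whipple.
Variables (R : realType) (K : modulusField R) (q : K).
Hypotheses (q1 : nm q < 1) (q0 : q != 0).
Implicit Types (nu A D x : K) (k n : nat).

Lemma nm_prod_le (s : seq K) (f : K -> K) (E : R) :
  {in s, forall x, nm (f x) <= E} -> nm (\prod_(x <- s) f x) <= E ^+ size s.
Proof.
elim: s => [|x s IH] fE; first by rewrite big_nil nm1 expr0.
rewrite big_cons nmM exprS ler_pM ?nm_ge0 //; first exact/fE/mem_head.
by apply: IH => y ys; apply: fE; rewrite in_cons ys orbT.
Qed.

Lemma nm_expq_le k : nm (q ^+ k) <= 1.
Proof. by rewrite nmX exprn_ile1 ?nm_ge0 // ltW. Qed.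

Lemma clim_prod_map (s : seq ((nat -> K) * K)) (F : K -> K) :
  (forall u l, clim u l -> clim (fun n => F (u n)) (F l)) ->
  foldr (fun p P => clim p.1 p.2 /\ P) True s ->
  clim (fun n => \prod_(x <- [seq p.1 n | p <- s]) F x) (\prod_(x <- [seq p.2 | p <- s]) F x).
Proof.
move=> FC; elim: s => [|p s IH] /=.
  by rewrite big_nil => _; exact: clim_cst.
move=> [/FC hp /IH hs]; rewrite big_cons.
by apply: clim_ext (climM hp hs) => n /=; rewrite big_cons.
Qed.

Lemma climN u (l : K) : clim u l -> clim (fun n => - u n) (- l).
Proof. by move=> ul; rewrite -mulN1r; apply: clim_ext (climZ (-1) ul) => n; rewrite mulN1r. Qed.

Lemma climMr u (l x : K) : clim u l -> clim (fun n => u n * x) (l * x).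
Proof. by move=> ul; apply: climM => //; exact: clim_cst. Qed.

Lemma qp_cont u (l : K) k : clim u l -> clim (fun n => qp q (u n) k) (qp q l k).
Proof.
move=> ul; apply: clim_prod => i; apply: climB; first exact: clim_cst.
exact: climMr.
Qed.

(** Term of the very-well-poised 8phi7 with a = nu, parameters - nu, A, q/A, D, q/D and argument -
    nu, multiplied by 1 - nu and the infinite products of its denominators. Thus cleared, it makes
    sense at nu = 0. *)
Definition whipple_term nu A D k : K :=
  (- nu) ^+ k * (1 - nu * (q ^+ k) ^+ 2) *
  \prod_(x <- [:: nu; - nu; A; q / A; D; q / D]) qp q x k *
  \prod_(x <- [:: q * q ^+ k; - (q * q ^+ k); nu * (q / A) * q ^+ k; nu * A * q ^+ k;
                  nu * (q / D) * q ^+ k; nu * D * q ^+ k]) qinf q x.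

(* The certificate of the creative telescoping in [whipple_telescope]: it      *)
(* tends to 0, so that the sum at (nu, A) is [whipple_ratio] times the sum at  *)
(* (nu q, A q).                                                                *)
Definition whipple_gap nu A D n : K :=
  - ((- nu) ^+ n.+1 * (1 - nu ^+ 2 * A * q ^+ n.+1) *
     \prod_(x <- [:: nu; A; D; q / D]) qp q x n.+1 *
     \prod_(x <- [:: - (nu * q); q / A]) qp q x n *
     \prod_(x <- [:: q ^+ n.+1; - q ^+ n.+1; nu / A * q ^+ n.+1; nu * A * q ^+ n.+2;
                     nu / D * q ^+ n.+2; nu * D * q ^+ n.+1]) qinf q x).

Lemma qinf_next x y : x * q = y -> qinf q x = (1 - x) * qinf q y.
Proof. by move=> <-; exact: qinf_recl. Qed.

Definition whipple_ratio nu A D : K := (1 - nu) ^+ 2 * (1 - nu * A * D) * (1 - nu * A * (q / D)).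

(** Induction on n: once all q-products are reduced to common ones, the step is a rational identity
    in q^n. *)
Lemma whipple_telescope nu A D n : A != 0 -> D != 0 ->
  \sum_(k < n.+1) (whipple_term nu A D k -
     whipple_ratio nu A D * whipple_term (nu * q) (A * q) D k) = whipple_gap nu A D n.
Proof.
move=> A0 D0; elim: n => [|n IH].
  rewrite big_ord1 /whipple_term /whipple_gap /whipple_ratio !big_cons !big_nil.
  rewrite !qpSr !qp0 !expr0 !expr1 !mulr1 !mul1r.
  rewrite (_ : nu * q * (q / (A * q)) = nu / A * q); last by field; apply/andP.
  rewrite (_ : nu * (q / A) = nu / A * q); last by ring.
  rewrite (@qinf_next (nu * A) (nu * A * q)) // (@qinf_next (nu * A * q) (nu * A * q ^+ 2)); last by ring.
  rewrite (@qinf_next (nu * (q / D)) (nu / D * q ^+ 2)); last by ring.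
  rewrite (@qinf_next (nu * D) (nu * D * q)) //.
  rewrite (_ : nu * q * (A * q) = nu * A * q ^+ 2); last by ring.
  rewrite (_ : nu * q * (q / D) = nu / D * q ^+ 2); last by ring.
  rewrite (_ : nu * q * D = nu * D * q); last by ring.
  by field; do ?[apply/andP; split].
rewrite big_ord_recr /= {}IH /whipple_term /whipple_gap /whipple_ratio !big_cons !big_nil !mulr1.
have -> : q / (A * q) = A^-1 by field; apply/andP.
have -> : qp q nu n.+2 = (1 - nu) * (qp q (nu * q) n * (1 - nu * q * q ^+ n)) by rewrite qpS qpSr.
have -> : qp q (A * q) n.+1 = qp q (A * q) n * (1 - A * q * q ^+ n) by rewrite qpSr.
have -> : qp q A n.+2 = (1 - A) * (qp q (A * q) n * (1 - A * q * q ^+ n)) by rewrite qpS qpSr.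
rewrite (qpS q nu n) (qpS q (- nu) n) (qpS q A n) (qpS q A^-1 n) mulNr.
rewrite (qpSr q (nu * q) n) (qpSr q (- (nu * q)) n) (qpSr q (q / A) n) (mulrC A^-1 q).
rewrite (qpSr q D n.+1) (qpSr q (q / D) n.+1).
have E1 : q ^+ n.+1 = q * q ^+ n by rewrite exprS.
have E2 : q ^+ n.+2 = q * q * q ^+ n by rewrite !exprS mulrA.
have E3 : q ^+ n.+3 = q * q * q * q ^+ n by rewrite !exprS !mulrA.
have EP : (- (nu * q)) ^+ n.+1 = (- nu) ^+ n.+1 * (q * q ^+ n).
  by rewrite -mulNr exprMn E1.
rewrite EP E1 E2 E3 (exprS (- nu) n.+1).
move: (q ^+ n) ((- nu) ^+ n.+1) => X P {E1 E2 E3 EP}.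
have -> : q * (q * X) = q * q * X by rewrite mulrA.
have -> : nu * (q / A) * (q * X) = nu / A * (q * q * X) by ring.
have -> : nu * q * A^-1 * (q * X) = nu / A * (q * q * X) by ring.
have -> : nu * q * (A * q) * (q * X) = nu * A * (q * q * q * X) by ring.
have -> : nu * q * (q / D) * (q * X) = nu / D * (q * q * q * X) by ring.
have -> : nu * q * D * (q * X) = nu * D * (q * q * X) by ring.
have -> : nu * (q / D) * (q * X) = nu / D * (q * q * X) by ring.
rewrite (@qinf_next (nu * A * (q * X)) (nu * A * (q * q * X))); last by ring.
rewrite (@qinf_next (nu * A * (q * q * X)) (nu * A * (q * q * q * X))); last by ring.
rewrite (@qinf_next (nu / D * (q * q * X)) (nu / D * (q * q * q * X))); last by ring.
rewrite (@qinf_next (nu * D * (q * X)) (nu * D * (q * q * X))); last by ring.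
rewrite (@qinf_next (nu / A * (q * X)) (nu / A * (q * q * X))); last by ring.
rewrite (@qinf_next (q * X) (q * q * X)); last by ring.
rewrite (@qinf_next (- (q * X)) (- (q * q * X))); last by ring.
move: (qinf q (q * q * X)) (qinf q (- (q * q * X))) (qinf q (nu / A * _)) (qinf q (nu * A * _))
  (qinf q (nu / D * _)) (qinf q (nu * D * _)) => I1 I2 I3 I4 I5 I6.
move: (qp q (nu * q) n) (qp q (- (nu * q)) n) (qp q (A * q) n) (qp q (q / A) n)
  (qp q D n.+1) (qp q (q / D) n.+1) => P1 P2 P3 P4 P5 P6.
by field; apply/andP.
Qed.

Lemma whipple_term_sym nu A D k : A != 0 -> whipple_term nu (q / A) D k = whipple_term nu A D k.
Proof.
move=> A0; rewrite /whipple_term !big_cons !big_nil.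
have -> : q / (q / A) = A by field; apply/andP.
by ring.
Qed.

Definition whipple_bound A D : R := 1 + nm A + nm (q / A) + nm D + nm (q / D).

Let wb_ge A D : [/\ 1 <= whipple_bound A D, nm A <= whipple_bound A D,
  nm (q / A) <= whipple_bound A D, nm D <= whipple_bound A D & nm (q / D) <= whipple_bound A D].
Proof.
have := nm_ge0 A; have := nm_ge0 (q / A); have := nm_ge0 D; have := nm_ge0 (q / D).
by rewrite /whipple_bound => *; split; lra.
Qed.

Lemma nmM_le1l x y (t : R) : nm x <= 1 -> nm y <= t -> nm (x * y) <= t.
Proof. by move=> x1 yt; rewrite nmM (le_trans _ yt) // ler_piMl ?nm_ge0. Qed.

Lemma nmM_le1r x y (t : R) : nm x <= t -> nm y <= 1 -> nm (x * y) <= t.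
Proof. by move=> xt y1; rewrite mulrC nmM_le1l. Qed.

Lemma whipple_term_bound nu A D k : nm nu <= 1 ->
  nm (whipple_term nu A D k) <=
  2 * ebd q (whipple_bound A D) ^+ 6 * ebd q (whipple_bound A D) ^+ 6 * nm nu ^+ k.
Proof.
move=> nu1; have [T1 TA TqA TD TqD] := wb_ge A D.
have qk := nm_expq_le k; have nq : nm q <= 1 by exact: ltW.
have E0 := ebd_ge0 q (whipple_bound A D).
have le1 (y : K) : nm y <= 1 -> nm y <= whipple_bound A D by move=> /le_trans; apply.
rewrite /whipple_term !nmM nmX nmN [leRHS]mulrC -2!(mulrA (nm nu ^+ k)).
rewrite ler_wpM2l ?exprn_ge0 ?nm_ge0 //.
apply: ler_pM; rewrite ?mulr_ge0 ?nm_ge0 //.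
  apply: ler_pM; rewrite ?nm_ge0 //.
    rewrite (le_trans (nmB _ _)) // nm1 -[leRHS]/(1 + 1) lerD2l.
    by rewrite -exprM nmM_le1l ?nm_expq_le.
  apply: (@nm_prod_le [:: nu; - nu; A; q / A; D; q / D]) => y.
  rewrite !inE => /or4P[/eqP->|/eqP->|/eqP->|/or3P[] /eqP->]; apply: nm_qp => //.
    exact: le1.
  by apply: le1; rewrite nmN.
apply: (@nm_prod_le [:: _; _; _; _; _; _]) => y.
rewrite !inE => /or4P[/eqP->|/eqP->|/eqP->|/or3P[] /eqP->]; apply: nm_qinf => //.
- by apply: le1; rewrite nmM_le1l.
- by apply: le1; rewrite nmN nmM_le1l.
- by rewrite nmM_le1r // nmM_le1l.
- by rewrite nmM_le1r // nmM_le1l.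
- by rewrite nmM_le1r // nmM_le1l.
- by rewrite nmM_le1r // nmM_le1l.
Qed.

Lemma whipple_gap_clim nu A D : nm nu < 1 -> clim (whipple_gap nu A D) 0.
Proof.
move=> nu1 e e0; have [T1 TA TqA TD TqD] := wb_ge A D.
set T := whipple_bound A D in T1 TA TqA TD TqD *.
have nu1' := ltW nu1; have nq : nm q <= 1 by exact: ltW.
set C := (1 + T) * (ebd q T ^+ 4 * (ebd q T ^+ 2 * ebd q T ^+ 6)).
have E0 := ebd_ge0 q T.
have C0 : 0 <= C by rewrite !mulr_ge0 ?exprn_ge0 //; lra.
have e1 : 0 < e / (C + 1) by rewrite divr_gt0 // ltr_wpDl.
have [N hN] := clim_geo nu1 e1; exists N => n Nn.
have le1 (y : K) : nm y <= 1 -> nm y <= T by move=> /le_trans; apply.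
have h : nm (whipple_gap nu A D n) <= nm (nu ^+ n.+1) * C.
  rewrite nmX /whipple_gap -!(mulrA ((- nu) ^+ n.+1)) nmN (nmM ((- nu) ^+ n.+1)) nmX (nmN nu).
  rewrite ler_wpM2l ?exprn_ge0 ?nm_ge0 //.
  rewrite -!(mulrA (1 - _)) nmM; apply: ler_pM; rewrite ?nm_ge0 //.
    rewrite (le_trans (nmB _ _)) // nm1 lerD2l.
    by rewrite nmM_le1r ?nm_expq_le // nmM_le1l // nmX exprn_ile1 ?nm_ge0.
  rewrite -(mulrA (\prod_(x <- [:: nu; A; D; q / D]) _)) nmM; apply: ler_pM; rewrite ?nm_ge0 //.
    apply: (@nm_prod_le [:: _; _; _; _]) => y.
    rewrite !inE => /or4P[] /eqP->; apply: nm_qp => //; exact: le1.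
  rewrite nmM; apply: ler_pM; rewrite ?nm_ge0 //.
    apply: (@nm_prod_le [:: _; _]) => y; rewrite !inE => /orP[] /eqP->; apply: nm_qp => //.
    by apply: le1; rewrite nmN nmM_le1l.
  apply: (@nm_prod_le [:: _; _; _; _; _; _]) => y.
  have s1 x k : nu / x * q ^+ k.+1 = nu * (q / x) * q ^+ k by rewrite exprS; ring.
  rewrite !inE !s1 => /or4P[/eqP->|/eqP->|/eqP->|/or3P[] /eqP->]; apply: nm_qinf => //.
  - by apply: le1; rewrite nm_expq_le.
  - by apply: le1; rewrite nmN nm_expq_le.
  - by rewrite nmM_le1r ?nm_expq_le // nmM_le1l.
  - by rewrite nmM_le1r ?nm_expq_le // nmM_le1l.
  - by rewrite nmM_le1r ?nm_expq_le // nmM_le1l.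
  - by rewrite nmM_le1r ?nm_expq_le // nmM_le1l.
rewrite subr0 (le_lt_trans h) //.
have {hN} := hN n.+1 (leqW Nn); rewrite subr0 => hN.
rewrite (@le_lt_trans _ _ (nm (nu ^+ n.+1) * (C + 1))) //.
  by rewrite ler_wpM2l ?nm_ge0 // lerDl.
by rewrite -ltr_pdivlMr // ltr_wpDl.
Qed.

Lemma whipple_bsum nu A D : nm nu < 1 ->
  bsum (fun k => 2 * ebd q (whipple_bound A D) ^+ 6 * ebd q (whipple_bound A D) ^+ 6 * nm nu ^+ k)
       (2 * ebd q (whipple_bound A D) ^+ 6 * ebd q (whipple_bound A D) ^+ 6 / (1 - nm nu)).
Proof. by move=> nu1; apply: bsum_geo; rewrite ?nu1 ?nm_ge0 ?mulr_ge0 ?exprn_ge0 ?ebd_ge0. Qed.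

Lemma nmMq_lt1 nu : nm nu < 1 -> nm (nu * q) < 1.
Proof. by move=> nu1; rewrite nmM mulr_ilt1 ?nm_ge0. Qed.

Lemma whipple_sum_shift nu A D : nm nu < 1 -> A != 0 -> D != 0 ->
  csum (whipple_term nu A D) =
  whipple_ratio nu A D * csum (whipple_term (nu * q) (A * q) D).
Proof.
move=> nu1 A0 D0.
have s1 := csumP (whipple_bsum A D nu1) (fun k => whipple_term_bound A D k (ltW nu1)).
have nu2 := nmMq_lt1 nu1.
have s2 := csumP (whipple_bsum (A * q) D nu2) (fun k => whipple_term_bound (A * q) D k (ltW nu2)).
apply/eqP; rewrite -subr_eq0; apply/eqP.
have := clim_shift 1 (climB s1 (climZ (whipple_ratio nu A D) s2)).
move/clim_unique; apply; apply: clim_ext (whipple_gap_clim A D nu1) => n.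
by rewrite -whipple_telescope // addn1 sumrB mulr_sumr.
Qed.

Definition whipple_value nu A D : K := qinf q q * qinf q (- q) * qinf q nu ^+ 2 *
  \prod_(x <- [:: nu * A * D; nu * A * (q / D); nu * (q / A) * D; nu * (q / A) * (q / D)])
     qinf (q ^+ 2) x.

(** The shift sends A to A q, the symmetry A -> q / A turns this into 1 / A, and a second shift
    gives q / A, which is A again by symmetry, with nu multiplied by q^2. *)
Lemma whipple_sum_shift2 nu A D : nm nu < 1 -> A != 0 -> D != 0 ->
  csum (whipple_term nu A D) = whipple_ratio nu A D * whipple_ratio (nu * q) (A^-1) D *
    csum (whipple_term (nu * q ^+ 2) A D).
Proof.
move=> nu1 A0 D0; rewrite whipple_sum_shift // -mulrA; congr (_ * _).
transitivity (csum (whipple_term (nu * q) A^-1 D)).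
  apply: eq_csum => k; rewrite -whipple_term_sym ?mulf_neq0 //.
  by congr whipple_term; field; apply/andP.
rewrite whipple_sum_shift ?invr_eq0 ?nmMq_lt1 //; congr (_ * _).
apply: eq_csum => k; rewrite -[RHS]whipple_term_sym //.
by rewrite expr2 mulrA (mulrC A^-1).
Qed.

Lemma whipple_value_shift nu A D : A != 0 ->
  whipple_value nu A D = whipple_ratio nu A D * whipple_ratio (nu * q) (A^-1) D *
    whipple_value (nu * q ^+ 2) A D.
Proof.
move=> A0; have q21 := sqr_lt1 q1.
rewrite /whipple_value /whipple_ratio !big_cons !big_nil.
have S x y : x * q ^+ 2 = y -> qinf (q ^+ 2) x = (1 - x) * qinf (q ^+ 2) y.
  by move=> <-; exact: qinf_recl.
rewrite (@qinf_next nu (nu * q)) // (@qinf_next (nu * q) (nu * q ^+ 2)); last by ring.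
rewrite (S (nu * A * D) (nu * q ^+ 2 * A * D)); last by ring.
rewrite (S (nu * A * (q / D)) (nu * q ^+ 2 * A * (q / D))); last by ring.
rewrite (S (nu * (q / A) * D) (nu * q ^+ 2 * (q / A) * D)); last by ring.
rewrite (S (nu * (q / A) * (q / D)) (nu * q ^+ 2 * (q / A) * (q / D))); last by ring.
move: (qinf _ _) => I1; ring.
Qed.

Lemma whipple_term_cont u nu A D k : clim u nu ->
  clim (fun n => whipple_term (u n) A D k) (whipple_term nu A D k).
Proof.
move=> un; have cst := @clim_cst R K.
apply: climM; first apply: climM; first apply: climM.
- by apply: climX; exact: climN.
- by apply: climB => //; exact: climMr.
- apply: (@clim_prod_map [:: (u, nu); (fun n => - u n, - nu); (fun=> A, A); (fun=> q / A, q / A);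
    (fun=> D, D); (fun=> q / D, q / D)]) => [v l vl|]; first exact: qp_cont.
  by do ?split; rewrite //=; exact: climN.
- apply: (@clim_prod_map [:: (fun=> q * q ^+ k, q * q ^+ k); (fun=> - (q * q ^+ k), - (q * q ^+ k));
    (fun n => u n * (q / A) * q ^+ k, nu * (q / A) * q ^+ k); (fun n => u n * A * q ^+ k, nu * A * q ^+ k);
    (fun n => u n * (q / D) * q ^+ k, nu * (q / D) * q ^+ k); (fun n => u n * D * q ^+ k, nu * D * q ^+ k)])
    => [v l vl|]; first exact: qinf_cont.
  by do ?split; rewrite //=; do 2?apply: climMr.
Qed.

(* Both sides satisfy the same recurrence in nu -> nu q^2, and tend to        *)
(* [qinf q q * qinf q (- q)] as nu -> 0.                                       *)
Theorem whipple_sum nu A D : nm nu < 1 -> A != 0 -> D != 0 ->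
  csum (whipple_term nu A D) = whipple_value nu A D.
Proof.
move=> nu1 A0 D0.
pose F x := csum (whipple_term x A D); pose W x := whipple_value x A D.
pose nun n := nu * (q ^+ 2) ^+ n.
have q2le : nm (q ^+ 2) <= 1 by exact: nm_expq_le.
have nun1 n : nm (nun n) <= nm nu.
  by rewrite /nun nmM ler_piMr ?nm_ge0 // nmX exprn_ile1 ?nm_ge0.
(* Cross-multiplied so that W is never divided by; only its limit [L] has to be nonzero. *)
have cross n x : nm x < 1 -> F x * W (x * (q ^+ 2) ^+ n) = W x * F (x * (q ^+ 2) ^+ n).
  elim: n x => [|n IH] x x1; first by rewrite expr0 mulr1 [LHS]mulrC.
  have x2 : nm (x * q ^+ 2) < 1 by rewrite expr2 mulrA !nmMq_lt1.
  rewrite {1}/F {2}/W (whipple_sum_shift2 x1 A0 D0) (whipple_value_shift x D A0).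
  by rewrite (exprS (q ^+ 2)) (mulrA x) -mulrA -/(F _) -/(W _) IH // mulrA.
have nun0 : clim nun 0.
  have := climZ nu (clim_geo (sqr_lt1 q1)); rewrite mulr0; exact.
have q21 := sqr_lt1 q1.
pose L := qinf q q * qinf q (- q).
have L0 : L != 0 by rewrite mulf_neq0 // qinf_neq0_small ?nmN.
have Wlim : clim (fun n => W (nun n)) L.
  have -> : L = whipple_value 0 A D.
    by rewrite /whipple_value !big_cons big_nil !mul0r !qinf0 // expr1n !mulr1.
  apply: climM.
    by apply: climM; [exact: clim_cst|apply/climX/qinf_cont].
  apply: (@clim_ext _ _ (fun n => \prod_(x <- [:: A * D; A * (q / D); q / A * D; q / A * (q / D)])
     qinf (q ^+ 2) (nun n * x))).
    by move=> n; rewrite !big_cons !big_nil !mulrA.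
  have -> : \prod_(x <- [:: 0 * A * D; 0 * A * (q / D); 0 * (q / A) * D; 0 * (q / A) * (q / D)])
     qinf (q ^+ 2) x = \prod_(x <- [:: A * D; A * (q / D); q / A * D; q / A * (q / D)])
     qinf (q ^+ 2) (0 * x) by rewrite !big_cons !big_nil !mulrA.
  by apply: clim_prod => x; apply: qinf_cont => //; apply: climM => //; exact: clim_cst.
have Flim : clim (fun n => F (nun n)) L.
  have -> : L = csum (whipple_term 0 A D).
    apply/esym/csum_unique; apply: (@clim_unshift _ _ _ _ 1); apply: clim_ext (clim_cst _) => n.
    rewrite addn1 big_ord_recl big1 => [|k _]; last first.
      by rewrite /whipple_term oppr0 expr0n /= !mul0r.
    rewrite /whipple_term !big_cons !big_nil !qp0 !expr0 !mul0r !qinf0 // subr0 !mulr1 !mul1r.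
    by rewrite addr0.
  apply: (csum_dominated (whipple_bsum A D nu1)) => [n k|k].
    rewrite (le_trans (whipple_term_bound A D k _)) ?(le_trans (nun1 n)) ?(ltW nu1) //.
    rewrite ler_wpM2l ?mulr_ge0 ?exprn_ge0 ?ebd_ge0 //.
    by rewrite lerXn2r ?nnegrE ?nm_ge0.
  exact: whipple_term_cont.
apply: (mulIf L0); apply: (clim_unique (climZ (F nu) Wlim)).
by apply: clim_ext (climZ (W nu) Flim) => n; rewrite /nun cross.
Qed.

End Whipple.

(** * The bilateral well-poised series *)

Section WellPoised.
Variables (R : realType) (K : modulusField R) (q : K).
Hypotheses (q1 : nm q < 1) (q0 : q != 0).
Implicit Types (B : seq K) (x z : K) (k n : nat).

(** For a = x^2 and a_j = x beta this is (a_j)_k / (qa/a_j)_k times (q/a_j, qa/a_j)_oo: the product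
    of q/a_j clears the denominators of negative index, that of qa/a_j those of positive index. *)
Definition wp_factor k x (beta : K) : K :=
  qp q (x * beta) k * qinf q (q / (x * beta)) * qinf q (x / beta * q * q ^+ k).

Definition wp_term B z x k : K :=
  z ^+ k * (1 - x ^+ 2 * (q ^+ k) ^+ 2) * \prod_(beta <- B) wp_factor k x beta.

(* The bilateral well-poised series, normalized to be a Laurent function of x *)
(* (where a = x^2); its terms of negative index are rewritten by means of the  *)
(* symmetry x -> 1/x.                                                          *)
Definition wp_sum B z x : K :=
  csum (wp_term B z x) - x ^+ 2 * csum (fun k => wp_term B z x^-1 k.+1).

(** Majorant, uniform in k, of the product of the [wp_factor] when |x| = s and |1/x| = t. *)
Definition wp_cst B (s t : R) : R :=
  \prod_(beta <- B) (ebd q (nm beta * s) * ebd q (nm (q / beta) * t) * ebd q (nm (q / beta) * s)).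

Lemma wp_cst_ge0 B s t : 0 <= wp_cst B s t.
Proof. by apply: prodr_ge0 => b _; rewrite !mulr_ge0 ?ebd_ge0. Qed.

Lemma laurent_wp_term B z k :
  laurent (fun x => wp_term B z x k) (fun r => (1 + r ^+ 2) * wp_cst B r r^-1 * nm z ^+ k).
Proof.
have h1 := laurentZ (z ^+ k) (laurentD (laurent_cst 1) (laurent_monomial (- (q ^+ k) ^+ 2) 2)).
have h2 (beta : K) := laurentM (laurentM (laurent_qp beta 1 k q1) (laurent_qinf (q / beta) (-1) q1))
   (laurent_qinf (q / beta * q ^+ k) 1 q1).
apply: (laurent_ext _ (laurent_le _ (laurentM h1 (laurent_prod B h2)))) => [x x0|r r0].
  rewrite /wp_term -[x ^ 2]/(x ^+ 2) mulNr (mulrC (x ^+ 2)); congr (_ * _).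
  apply: eq_bigr => b _; rewrite /wp_factor !expr1z (mulrC b).
  have -> : q / b * x ^ (-1) = q / (x * b) by rewrite invfM exprN1 mulrAC -mulrA.
  by congr (_ * qinf q _); ring.
rewrite nm1 nmN nmX -[r ^ 2]/(r ^+ 2) [leRHS]mulrC (mulrA (nm z ^+ k)) ler_pM //.
- by rewrite mulr_ge0 ?exprn_ge0 ?nm_ge0 // addr_ge0 // mulr_ge0 ?exprn_ge0 ?nm_ge0 // ltW.
- by apply: prodr_ge0 => b _; rewrite !mulr_ge0 ?ebd_ge0.
- rewrite ler_wpM2l ?exprn_ge0 ?nm_ge0 // lerD2l ler_piMl ?exprn_ge0 ?(ltW r0) //.
  by rewrite -exprM nm_expq_le.
- apply: ler_prod => b _; rewrite !mulr_ge0 ?ebd_ge0 //= !expr1z.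
  rewrite ler_wpM2l ?mulr_ge0 ?ebd_ge0 // ebd_homo // ler_wpM2r ?(ltW r0) //.
  by rewrite nmM ler_piMr ?nm_ge0 ?nm_expq_le.
Qed.

Lemma wp_term_bound B z x k : x != 0 ->
  nm (wp_term B z x k) <= (1 + nm x ^+ 2) * wp_cst B (nm x) (nm x)^-1 * nm z ^+ k.
Proof. exact: nm_laurent (laurent_wp_term B z k). Qed.

Lemma wp_bsum B z (s t : R) : nm z < 1 ->
  bsum (fun k => (1 + s ^+ 2) * wp_cst B s t * nm z ^+ k) ((1 + s ^+ 2) * wp_cst B s t / (1 - nm z)).
Proof.
move=> z1; apply: bsum_geo; rewrite ?z1 ?nm_ge0 // mulr_ge0 ?wp_cst_ge0 //.
by rewrite addr_ge0 // sqr_ge0.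
Qed.

Lemma wp_factorS k x (b : K) : x * b != 0 ->
  wp_factor k (q * x) b = - (x * b)^-1 * wp_factor k.+1 x b.
Proof.
move=> xb0; have /andP[x0 b0] : (x != 0) && (b != 0) by rewrite -negb_or -mulf_eq0.
rewrite /wp_factor qpS (_ : x * b * q = q * x * b); last by ring.
rewrite (_ : q / (q * x * b) = (x * b)^-1); last by field; rewrite q0 x0 b0.
rewrite (qinf_recl q1 (x * b)^-1) (mulrC _ q) (exprS q k).
by rewrite (_ : q * x / b * q * q ^+ k = x / b * q * (q * q ^+ k)); [field; rewrite x0 b0|ring].
Qed.

Lemma wp_termS B z x k : x != 0 -> {in B, forall b, b != 0} ->
  z * wp_term B z (q * x) k = (\prod_(b <- B) - (x * b)^-1) * wp_term B z x k.+1.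
Proof.
move=> x0 B0; rewrite /wp_term.
have -> : \prod_(b <- B) wp_factor k (q * x) b =
   (\prod_(b <- B) - (x * b)^-1) * \prod_(b <- B) wp_factor k.+1 x b.
  rewrite -big_split !big_seq; apply: eq_bigr => b bB /=.
  by rewrite wp_factorS // mulf_neq0 // B0.
by rewrite (exprS z k) (exprS q k); ring.
Qed.

Lemma wp_term0 B z x : x != 0 -> {in B, forall b, b != 0} ->
  wp_term B z x 0 + x ^+ 2 * wp_term B z x^-1 0 = 0.
Proof.
move=> x0 B0; rewrite /wp_term !expr0.
have -> : \prod_(b <- B) wp_factor 0 x^-1 b = \prod_(b <- B) wp_factor 0 x b.
  rewrite !big_seq; apply: eq_bigr => b bB; rewrite /wp_factor !qp0 !mul1r !expr0 !mulr1.
  have b0 := B0 _ bB; rewrite mulrC; congr (qinf q _ * qinf q _); by field; apply/andP.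
by field.
Qed.

(** Inversion exchanges the two halves of the series; the two terms of index 0 cancel by
    [wp_term0]. *)
Lemma wp_sum_inv B z x : nm z < 1 -> x != 0 -> {in B, forall b, b != 0} ->
  x ^+ 2 * wp_sum B z x^-1 = - wp_sum B z x.
Proof.
move=> z1 x0 B0; have ix0 : x^-1 != 0 by rewrite invr_eq0.
have b1 := wp_bsum B (nm x) (nm x)^-1 z1; have b2 := wp_bsum B (nm x^-1) (nm x^-1)^-1 z1.
rewrite /wp_sum invrK.
rewrite (csum_recl b1 (fun k => wp_term_bound B z k x0)).
rewrite (csum_recl b2 (fun k => wp_term_bound B z k ix0)).
have h := wp_term0 z x0 B0.
transitivity (- (wp_term B z x 0 + csum (fun k => wp_term B z x k.+1)) +
  (wp_term B z x 0 + x ^+ 2 * wp_term B z x^-1 0) + x ^+ 2 * csum (fun k => wp_term B z x^-1 k.+1)).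
  by field.
by rewrite h; ring.
Qed.

(** By [wp_termS], x -> q x shifts the index by one, at the cost of the product of the - 1/(x b)
    over z. For six parameters with z times their product equal to q^2 this is 1 / (q^2 x^6). The
    term crossing from one half to the other is accounted for by [wp_term0]. *)
Lemma wp_sum_shift B z x : nm z < 1 -> z != 0 -> x != 0 -> {in B, forall b, b != 0} ->
  size B = 6%N -> z * \prod_(b <- B) b = q ^+ 2 ->
  q ^+ 2 * (x ^+ 6 * wp_sum B z (q * x)) = wp_sum B z x.
Proof.
move=> z1 z0 x0 B0 B6 Bz.
have ix0 : x^-1 != 0 by rewrite invr_eq0.
have qx0 : q * x != 0 by rewrite mulf_neq0.
have iqx0 : (q * x)^-1 != 0 by rewrite invr_eq0.
have b1 := wp_bsum B (nm x) (nm x)^-1 z1; have b2 := wp_bsum B (nm x^-1) (nm x^-1)^-1 z1.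
have prodE (y : K) : y != 0 -> \prod_(b <- B) - (y * b)^-1 = z / (q ^+ 2 * y ^+ 6).
  move=> y0; rewrite -Bz.
  have -> : \prod_(b <- B) - (y * b)^-1 = (\prod_(b <- B) - y^-1) * (\prod_(b <- B) b)^-1.
    by rewrite -prodfV -big_split; apply: eq_bigr => b _ /=; rewrite invfM mulNr.
  rewrite big_const_seq count_predT B6 /= mulr1.
  have P0 : \prod_(b <- B) b != 0 by rewrite prodf_seq_neq0; apply/allP => b /B0.
  by field; do ?[apply/andP; split].
have T1 k : wp_term B z (q * x) k = (q ^+ 2 * x ^+ 6)^-1 * wp_term B z x k.+1.
  apply: (mulfI z0); rewrite wp_termS // prodE //; by rewrite !mulrA.
have T2 k : (q * x) ^+ 2 * wp_term B z (q * x)^-1 k.+1 = (q ^+ 2 * x ^+ 6)^-1 * (x ^+ 2 * wp_term B z x^-1 k).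
  have := wp_termS z k iqx0 B0; rewrite prodE // (_ : q * (q * x)^-1 = x^-1); last by field; apply/andP.
  move=> h; apply: (mulfI z0).
  transitivity ((q * x) ^+ 2 / ((q ^+ 2 * x ^+ 6)) * (q ^+ 2 * x ^+ 6) * (z * wp_term B z (q * x)^-1 k.+1)).
    by field; apply/andP.
  transitivity ((q ^+ 2 * x ^+ 6)^-1 * x ^+ 2 * (z * wp_term B z x^-1 k)); last by ring.
  by rewrite h; field; apply/andP.
rewrite /wp_sum (eq_csum T1).
rewrite (csumZ _ (bsum_shift b1) (fun k => wp_term_bound B z k.+1 x0)).
have bqx := wp_bsum B (nm (q * x)^-1) (nm (q * x)^-1)^-1 z1.
rewrite -(csumZ _ (bsum_shift bqx) (fun k => wp_term_bound B z k.+1 iqx0)) (eq_csum T2).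
have T3 k : (q ^+ 2 * x ^+ 6)^-1 * (x ^+ 2 * wp_term B z x^-1 k) = (q ^+ 2 * x ^+ 6)^-1 * x ^+ 2 * wp_term B z x^-1 k.
  by rewrite mulrA.
rewrite (eq_csum T3) (csumZ _ b2 (fun k => wp_term_bound B z k ix0)).
rewrite (csum_recl b1 (fun k => wp_term_bound B z k x0)).
rewrite (csum_recl b2 (fun k => wp_term_bound B z k ix0)).
have h := wp_term0 z x0 B0.
set S1 := csum _; set S2 := csum _.
transitivity (S1 - x ^+ 2 * S2 - x ^+ 2 * wp_term B z x^-1 0); first by field; apply/andP.
transitivity (S1 - x ^+ 2 * S2 - x ^+ 2 * wp_term B z x^-1 0 + (wp_term B z x 0 + x ^+ 2 * wp_term B z x^-1 0)).
  by rewrite h addr0.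
by ring.
Qed.

Lemma wp_sum_lcoefs B z : nm z < 1 -> exists c, lcoefs (wp_sum B z) c.
Proof.
move=> z1.
have h1 := laurent_csum (laurent_wp_term B z) (fun r _ => wp_bsum B r r^-1 z1).
have h2 := laurent_csum (fun k => laurent_wp_term B z k.+1) (fun r _ => bsum_shift (wp_bsum B r r^-1 z1)).
have [c1 k1] := laurent_lcoefs h1; have [c2 k2] := laurent_lcoefs h2.
have h := lcoefsD k1 (lcoefsZ (-1) (lcoefs_shift 2 (lcoefs_inv k2))).
eexists; apply: lcoefs_ext h => x x0.
by rewrite /wp_sum mulN1r.
Qed.

(* The functions with the symmetries of [wp_sum] form a plane: the recurrence  *)
(* c_n = q^(n-4) c_(n-6) and the antisymmetry c_(2-n) = - c_n leave only c_0    *)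
(* and c_3 free.                                                               *)
Definition wp_space (F : K -> K) := [/\ exists c, lcoefs F c,
  forall x, x != 0 -> q ^+ 2 * (x ^+ 6 * F (q * x)) = F x &
  forall x, x != 0 -> x ^+ 2 * F x^-1 = - F x].

Lemma wp_space_lin F G (a b : K) : wp_space F -> wp_space G ->
  wp_space (fun x => a * F x + b * G x).
Proof.
move=> [[c hc] qF sF] [[d hd] qG sG]; split.
- by eexists; exact: lcoefsD (lcoefsZ a hc) (lcoefsZ b hd).
- by move=> x x0; rewrite -[in RHS]qF // -[in RHS]qG //; ring.
- by move=> x x0; rewrite mulrDr !(mulrCA (x ^+ 2)) sF // sG //; ring.
Qed.

Lemma wp_space_det F c : wp_space F -> lcoefs F c -> c 0 = 0 -> c 3 = 0 -> forall n : int, c n = 0.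
Proof.
move=> [_ qF sF] hc c0 c3.
have rec (n : int) : c n = q ^+ 2 * q ^ (n - 6) * c (n - 6).
  have h := lcoefsZ (q ^+ 2) (lcoefs_shift 6 (lcoefs_scale q0 hc)).
  by rewrite -(lcoefs_unique qF h hc) mulrA.
have sym (n : int) : c (- (n - 2)) = - c n.
  have h := lcoefs_shift 2 (lcoefs_inv hc).
  rewrite -[RHS]mulN1r -(lcoefs_unique _ h (lcoefsZ (-1) hc)) // => x x0.
  by rewrite mulN1r; exact: sF.
have self (y : K) : y = - y -> y = 0.
  move=> /eqP; rewrite -addr_eq0 -mulr2n -mulr_natl mulf_eq0 pnatr_eq0 /= => /eqP //.
(* Index 1 is fixed by n -> 2 - n. Index 4 is fixed by this reflection followed by the shift by 6,
   whose factor q^(n-4) is 1 there. *)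
have c1 : c 1 = 0 by apply: self; rewrite -sym.
have c2 : c 2 = 0 by rewrite -[LHS]opprK -sym /= c0 oppr0.
have cm1 : c (-1) = 0 by have := sym 3; rewrite c3 oppr0 => <-.
have c5 : c 5 = 0 by rewrite rec (_ : 5 - 6 = -1 :> int) // cm1 mulr0.
have c4 : c 4 = 0.
  apply: self; rewrite {1}rec -sym (_ : 4 - 6 = - (4 - 2) :> int) //.
  by rewrite (_ : q ^ (- (4 - 2)) = (q ^+ 2)^-1) // mulfV ?mul1r // expf_neq0.
apply: (@periodic_recurrence_eq0 K 6 c (fun n : int => q ^+ 2 * q ^ (n - 6))) => //.
- by move=> n; rewrite mulf_neq0 ?expf_neq0 ?expfz_neq0.
- by do 6?[case=> //].
Qed.

End WellPoised.

(** * Evaluation of the bilateral series by interpolation at x = e and x = - e *)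

Section Evaluation.
Variables (R : realType) (K : modulusField R) (q : K).
Hypotheses (q1 : nm q < 1) (q0 : q != 0).
Implicit Types (e A D x z : K) (k n : nat).

Lemma theta_shift2 z : z != 0 -> theta (q ^+ 2 * z) q = theta z q / (q * z ^+ 2).
Proof.
move=> z0; rewrite expr2 -mulrA !(theta_shift q1 q0) ?mulf_neq0 //.
by field; apply/andP.
Qed.

(** An element of the plane that vanishes at x = e; with [wp_theta (- e)], which vanishes at - e, it
    forms an interpolation basis. *)
Definition wp_theta e x := theta (x ^+ 2) q * theta (e * x) q * theta (e / x) q.

Lemma wp_theta_space e : e != 0 -> wp_space q (wp_theta e).
Proof.
move=> e0; split.
- have [N1 h1] := laurent_theta 1 2 q1; have [N2 h2] := laurent_theta e 1 q1.
  have [N3 h3] := laurent_theta e (-1) q1.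
  have [c hc] := laurent_lcoefs (laurentM (laurentM h1 h2) h3).
  by exists c; apply: lcoefs_ext hc => x x0; rewrite mul1r expr1z exprN1.
- move=> x x0; rewrite /wp_theta exprMn theta_shift2 ?expf_neq0 // (mulrCA e).
  rewrite (theta_shift q1 q0) ?mulf_neq0 //.
  have -> : theta (e / (q * x)) q = - (e / (q * x) * theta (e / x) q).
    have -> : e / x = q * (e / (q * x)) by field; apply/andP.
    by rewrite (theta_shift q1 q0) ?mulf_neq0 ?invr_eq0 ?mulf_neq0 //; field; do ?[apply/andP; split].
  by field; do ?[apply/andP; split].
- move=> x x0; rewrite /wp_theta exprVn (theta_inv q1 q0) ?expf_neq0 // invrK.
  by field.
Qed.

Definition wp_params e A D : seq K := [:: A / e; q / A / e; D / e; q / D / e; e; - e].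

Lemma wp_params_neq0 e A D : e != 0 -> A != 0 -> D != 0 -> {in wp_params e A D, forall b, b != 0}.
Proof.
move=> e0 A0 D0 b; rewrite !inE => /or4P[/eqP->|/eqP->|/eqP->|/or3P[] /eqP->];
  by rewrite ?oppr_eq0 ?mulf_neq0 ?invr_eq0.
Qed.

Lemma wp_params_prod e A D : e != 0 -> A != 0 -> D != 0 ->
  - e ^+ 2 * \prod_(b <- wp_params e A D) b = q ^+ 2.
Proof.
move=> e0 A0 D0; rewrite !big_cons big_nil.
by field; do ?[apply/andP; split].
Qed.

(** At x = e the parameter e contributes (1; q)_(k+1) = 0 to every term of negative index; the
    remaining half is Whipple's series with nu = e^2. *)
Lemma wp_sum_at_param e A D : nm e < 1 -> e != 0 -> A != 0 -> D != 0 ->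
  wp_sum q (wp_params e A D) (- e ^+ 2) e =
  theta A q * theta D q * qinf q (q / e ^+ 2) * qinf q (- (q / e ^+ 2)) *
  whipple_value q (e ^+ 2) A D.
Proof.
move=> e1 e0 A0 D0.
have nu1 : nm (e ^+ 2) < 1 by exact: sqr_lt1.
have z1 : nm (- e ^+ 2) < 1 by rewrite nmN.
rewrite /wp_sum.
have -> : csum (fun k => wp_term q (wp_params e A D) (- e ^+ 2) e^-1 k.+1) = 0.
  apply: csum_unique; apply: clim_ext (clim_cst 0) => n; rewrite big1 // => k _.
  rewrite /wp_term !big_cons (_ : wp_factor q k.+1 e^-1 e = 0); first by rewrite !(mul0r, mulr0).
  by rewrite /wp_factor mulVf // qpS subrr !mul0r.
rewrite mulr0 subr0.
set c := theta A q * _ * _ * _.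
have TE k : wp_term q (wp_params e A D) (- e ^+ 2) e k = c * whipple_term q (e ^+ 2) A D k.
  rewrite /wp_term /whipple_term !big_cons !big_nil /wp_factor /c !thetaE.
  rewrite (_ : e * (A / e) = A); last by field.
  rewrite (_ : e * (q / A / e) = q / A); last by field; apply/andP.
  rewrite (_ : e * (D / e) = D); last by field.
  rewrite (_ : e * (q / D / e) = q / D); last by field; apply/andP.
  rewrite (_ : q / (q / A) = A); last by field; apply/andP.
  rewrite (_ : q / (q / D) = D); last by field; apply/andP.
  rewrite (_ : e / (A / e) * q * q ^+ k = e ^+ 2 * (q / A) * q ^+ k); last by field; apply/andP.
  rewrite (_ : e / (q / A / e) * q * q ^+ k = e ^+ 2 * A * q ^+ k); last by field; do ?[apply/andP; split].
  rewrite (_ : e / (D / e) * q * q ^+ k = e ^+ 2 * (q / D) * q ^+ k); last by field; apply/andP.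
  rewrite (_ : e / (q / D / e) * q * q ^+ k = e ^+ 2 * D * q ^+ k); last by field; do ?[apply/andP; split].
  rewrite -!expr2 (_ : e / e * q * q ^+ k = q * q ^+ k); last by field.
  rewrite (_ : e / - e * q * q ^+ k = - (q * q ^+ k)); last by field.
  rewrite (_ : e * - e = - e ^+ 2); last by ring.
  rewrite (_ : q / - e ^+ 2 = - (q / e ^+ 2)); last by field.
  by ring.
rewrite (eq_csum TE) (csumZ _ (whipple_bsum q A D nu1)) ?(whipple_sum q1) //.
by move=> k; apply: whipple_term_bound => //; exact: ltW.
Qed.

Definition wp_value e A D x : K :=
  qinf q q * qinf q (- q) * qinf q (e ^+ 2) *
  \prod_(y <- [:: e ^+ 2 * A * D; e ^+ 2 * A * (q / D); e ^+ 2 * (q / A) * D;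
                  e ^+ 2 * (q / A) * (q / D)]) qinf (q ^+ 2) y *
  theta (x ^+ 2) q *
  (theta A q * theta D q * theta (- (e * x)) q * theta (- (e / x)) q +
   theta (- A) q * theta (- D) q * theta (e * x) q * theta (e / x) q).

Lemma wp_sum_eval_generic e A D x : nm e < 1 -> e != 0 -> A != 0 -> D != 0 -> x != 0 ->
  theta (e ^+ 2) q != 0 -> theta (- e ^+ 2) q != 0 ->
  wp_sum q (wp_params e A D) (- e ^+ 2) x * qinf q (- e ^+ 2) * theta (-1) q =
  wp_value e A D x.
Proof.
move=> e1 e0 A0 D0 x0 t0 tN0.
have ne0 : - e != 0 by rewrite oppr_eq0.
have tm0 := thetaN1_neq0 q1.
have nu1 : nm (e ^+ 2) < 1 by exact: sqr_lt1.
have z1 : nm (- e ^+ 2) < 1 by rewrite nmN.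
have z0 : - e ^+ 2 != 0 by rewrite oppr_eq0 expf_neq0.
set B := wp_params e A D.
have B0 := wp_params_neq0 e0 A0 D0.
have at1 : wp_theta (- e) e = theta (e ^+ 2) q * theta (- e ^+ 2) q * theta (-1) q.
  by rewrite /wp_theta mulNr -expr2 mulNr mulfV.
have at2 : wp_theta e e = 0 by rewrite /wp_theta mulfV // theta1 // mulr0.
have at3 : wp_theta (- e) (- e) = 0 by rewrite /wp_theta mulfV // theta1 // mulr0.
have at4 : wp_theta e (- e) = theta (e ^+ 2) q * theta (- e ^+ 2) q * theta (-1) q.
  by rewrite /wp_theta sqrrN mulrN -expr2 invrN mulrN mulfV.
set W := theta (e ^+ 2) q * _ * _ in at1 at4.
have W0 : W != 0 by rewrite !mulf_neq0.
have [|||||||a [b fE]] := @laurent_span2 R K (wp_space q) 0 3 (wp_sum q B (- e ^+ 2))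
   (wp_theta (- e)) (wp_theta e).
- by move=> F G a b; exact: wp_space_lin.
- by move=> F [].
- by move=> F c; exact: (wp_space_det q0).
- split; first exact: (wp_sum_lcoefs q1).
    by move=> y y0; apply: wp_sum_shift => //; exact: wp_params_prod.
  by move=> y y0; apply: wp_sum_inv.
- exact: wp_theta_space.
- exact: wp_theta_space.
- move=> a b h; split; apply/eqP.
    have /eqP := h e e0.
    by rewrite at1 at2 mulr0 addr0 mulf_eq0 (negbTE W0) orbF.
  have /eqP := h _ ne0.
  by rewrite at3 at4 mulr0 add0r mulf_eq0 (negbTE W0) orbF.
have Ea := fE e e0; have Eb := fE _ ne0.
rewrite at1 at2 mulr0 addr0 wp_sum_at_param // in Ea.
(* Changing the signs of e, A and D only exchanges the last two parameters, so x = - e reduces to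
   the previous evaluation. *)
have BN : wp_sum q B (- e ^+ 2) (- e) = wp_sum q (wp_params (- e) (- A) (- D)) (- (- e) ^+ 2) (- e).
  have TE y k : wp_term q B (- e ^+ 2) y k = wp_term q (wp_params (- e) (- A) (- D)) (- (- e) ^+ 2) y k.
    rewrite /wp_term sqrrN !big_cons !big_nil opprK !invrN !mulrN !mulNr !opprK.
    by rewrite (mulrCA (wp_factor q k y e)).
  rewrite /wp_sum (eq_csum (TE _)); congr (_ - _ * _).
  by apply: eq_csum => k; exact: TE.
rewrite at3 at4 mulr0 add0r BN wp_sum_at_param ?nmN ?oppr_eq0 // sqrrN in Eb.
have WV : whipple_value q (e ^+ 2) (- A) (- D) = whipple_value q (e ^+ 2) A D.
  by rewrite /whipple_value !invrN !(mulrN, mulNr, opprK).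
rewrite WV in Eb.
have qn0 : qinf q (q / e ^+ 2) != 0 by move: t0; rewrite thetaE mulf_eq0 negb_or => /andP[].
have qn1 : qinf q (- (q / e ^+ 2)) != 0.
  by move: tN0; rewrite thetaE mulf_eq0 negb_or invrN mulrN => /andP[].
have qn2 : qinf q (e ^+ 2) != 0 by move: t0; rewrite thetaE mulf_eq0 negb_or => /andP[].
have WE : W = qinf q (e ^+ 2) * qinf q (q / e ^+ 2) * qinf q (- e ^+ 2) * qinf q (- (q / e ^+ 2)) * theta (-1) q.
  by rewrite /W !thetaE invrN mulrN; ring.
apply: (mulIf (mulf_neq0 (mulf_neq0 qn0 qn1) qn2)).
transitivity (W * wp_sum q B (- e ^+ 2) x).
  by rewrite WE; ring.
rewrite (fE x x0).
transitivity ((a * W) * wp_theta (- e) x + (b * W) * wp_theta e x); first by ring.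
rewrite -Ea -Eb /wp_value /whipple_value /wp_theta !mulNr.
by ring.
Qed.

Lemma climV u (l : K) : clim u l -> l != 0 -> clim (fun n => (u n)^-1) l^-1.
Proof.
move=> ul l0 e e0; have nl : 0 < nm l by rewrite nm_gt0.
have h1 : 0 < nm l / 2 by rewrite divr_gt0.
have h2 : 0 < e * (nm l / 2) * nm l by rewrite !mulr_gt0.
have [N1 k1] := ul _ h1; have [N2 k2] := ul _ h2.
exists (maxn N1 N2) => n; rewrite geq_max => /andP[/k1 {}k1 /k2 {}k2].
have un : nm l / 2 < nm (u n).
  by have := nm_triangle l (u n) 0; rewrite !subr0 (nm_distC l); lra.
have u0 : u n != 0 by rewrite -nm_gt0 (lt_trans h1).
have -> : (u n)^-1 - l^-1 = (l - u n) / (u n * l) by field; apply/andP.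
rewrite nmM nmV nmM nm_distC ltr_pdivrMr; last by rewrite mulr_gt0 // nm_gt0.
by rewrite (lt_trans k2) // [ltRHS]mulrA ltr_pM2r // ltr_pM2l.
Qed.

Lemma theta_cont u (l : K) : clim u l -> l != 0 -> clim (fun n => theta (u n) q) (theta l q).
Proof.
move=> ul l0; rewrite thetaE.
apply: (@clim_ext _ _ (fun n => qinf q (u n) * qinf q (q / u n))) => [n|]; first by rewrite thetaE.
apply: climM; first exact: qinf_cont.
by apply: qinf_cont => //; apply: climZ; exact: climV.
Qed.

Lemma wp_cst_uniform (s : seq ((nat -> K) * K)) (a b : R) : 0 < a -> 0 < b ->
  foldr (fun p P => [/\ clim p.1 p.2, p.2 != 0 & P]) True s ->
  exists C : R, forall n, wp_cst q [seq p.1 n | p <- s] a b <= C.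
Proof.
move=> a0 b0; elim: s => [|p s IH] /=.
  by exists 1 => n; rewrite /wp_cst big_nil.
move=> [hp p0 /IH[C hC]].
have [T1 T10 hT1] := clim_bounded hp.
have [T2 T20 hT2] := clim_bounded (climZ q (climV hp p0)).
exists (ebd q (T1 * a) * ebd q (T2 * b) * ebd q (T2 * a) * C) => n.
rewrite /wp_cst big_cons ler_pM ?mulr_ge0 ?ebd_ge0 ?hC //.
  exact: wp_cst_ge0.
have a0' := ltW a0; have b0' := ltW b0.
do 2?apply: ler_pM; rewrite ?mulr_ge0 ?ebd_ge0 //; apply: ebd_homo => //; exact: ler_wpM2r.
Qed.

Lemma wp_term_cont (s : seq ((nat -> K) * K)) zn z x k : x != 0 -> clim zn z ->
  foldr (fun p P => [/\ clim p.1 p.2, p.2 != 0 & P]) True s ->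
  clim (fun n => wp_term q [seq p.1 n | p <- s] (zn n) x k) (wp_term q [seq p.2 | p <- s] z x k).
Proof.
move=> x0 hz hs; rewrite /wp_term; apply: climM.
  by apply: climM; [exact: climX|exact: clim_cst].
elim: s hs => [|p s IH] /=; first by rewrite big_nil => _; exact: clim_cst.
move=> [hp p0 /IH hs]; rewrite big_cons.
apply: (clim_ext _ (climM _ hs)) => [n /=|]; first by rewrite big_cons.
have hi := climV hp p0.
have hxp := climZ x hp; have hxi := climZ x hi.
apply: climM; first apply: climM.
- exact: qp_cont.
- apply: qinf_cont => //; apply: climZ; apply: climV => //.
  by rewrite mulf_neq0.
- by apply: qinf_cont => //; do 2?apply: climMr.
Qed.

Lemma wp_sum_cont (s : seq ((nat -> K) * K)) zn z x (rho : R) : x != 0 -> clim zn z ->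
  rho < 1 -> (forall n, nm (zn n) <= rho) ->
  foldr (fun p P => [/\ clim p.1 p.2, p.2 != 0 & P]) True s ->
  clim (fun n => wp_sum q [seq p.1 n | p <- s] (zn n) x) (wp_sum q [seq p.2 | p <- s] z x).
Proof.
move=> x0 hz rho1 hrho hs.
have rho0 : 0 <= rho by exact: le_trans (nm_ge0 _) (hrho 0%N).
have half (y : K) (h : nat -> nat) : y != 0 -> (forall k, (k <= h k)%N) ->
   clim (fun n => csum (fun k => wp_term q [seq p.1 n | p <- s] (zn n) y (h k)))
        (csum (fun k => wp_term q [seq p.2 | p <- s] z y (h k))).
  move=> y0 hk; have ny : 0 < nm y by rewrite nm_gt0.
  have nyi : 0 < (nm y)^-1 by rewrite invr_gt0.
  have [C hC] := wp_cst_uniform ny nyi hs.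
  have C0 : 0 <= C by apply: le_trans (hC 0%N); exact: wp_cst_ge0.
  have c0 : 0 <= (1 + nm y ^+ 2) * C by rewrite mulr_ge0 // addr_ge0 // sqr_ge0.
  have bb : bsum (fun k => (1 + nm y ^+ 2) * C * rho ^+ k) ((1 + nm y ^+ 2) * C / (1 - rho)).
    by apply: bsum_geo; rewrite ?rho0.
  apply: (csum_dominated bb) => [n k|k]; last exact: wp_term_cont.
  rewrite (le_trans (wp_term_bound q1 _ _ _ y0)) //.
  apply: ler_pM; rewrite ?mulr_ge0 ?wp_cst_ge0 ?exprn_ge0 ?nm_ge0 ?addr_ge0 ?sqr_ge0 //.
    by rewrite ler_wpM2l // addr_ge0 // sqr_ge0.
  rewrite (@le_trans _ _ (rho ^+ h k)) //.
    by rewrite lerXn2r ?nnegrE ?nm_ge0.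
  by rewrite ler_wiXn2l // ltW.
apply: climB; first exact: (half x id).
by apply: climZ; apply: (half x^-1 succn); rewrite ?invr_eq0.
Qed.

(* The values at x = e and x = - e determine an element of [wp_space] unless   *)
(* e^2 or - e^2 is a power of q; the exceptional e are limits of other ones.   *)
Lemma perturbation e : e != 0 -> nm e < 1 -> exists u : nat -> K, exists rho : R,
  [/\ clim u e, rho < 1, forall n, nm (u n ^+ 2) <= rho, forall n, u n != 0 &
   forall n m, nm (u n ^+ 2) != nm q ^+ m].
Proof.
move=> e0 e1; have nu1 : nm (e ^+ 2) < 1 by exact: sqr_lt1.
have nu0 : 0 < nm (e ^+ 2) by rewrite nm_gt0 expf_neq0.
have ex : exists j, nm q ^+ j <= nm (e ^+ 2).
  have [N /(_ N (leqnn _))] := clim_geo q1 nu0.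
  by rewrite subr0 nmX => /ltW; exists N.
have [j hj minj] := ex_minnP ex.
have j0 : (0 < j)%N by case: j hj {minj} => //; rewrite expr0 leNgt nu1.
have hj1 : nm (e ^+ 2) < nm q ^+ j.-1.
  by rewrite ltNge; apply/negP => /minj; rewrite -ltnS prednK // ltnn.
have qj1 : nm q ^+ j.-1 <= 1 by rewrite exprn_ile1 ?nm_ge0 // ltW.
pose t n : K := (2 ^+ n)^-1.
have nt n : nm (t n) = (2 ^+ n)^-1 by rewrite /t nmV nmX (modulus_nat K 2).
have tn0 : clim t 0.
  have h : nm (2^-1 : K) < 1 by rewrite nmV (modulus_nat K 2); lra.
  by apply: clim_ext (clim_geo h) => n; rewrite exprVn.
pose v n := e * (1 + t n).
have n1t n : nm (1 + t n) = 1 + (2 ^+ n)^-1.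
  have -> : 1 + t n = (2 ^ n + 1)%:R / (2 ^ n)%:R.
    rewrite /t natrD natrX; field.
    by rewrite expf_neq0 // pnatr_eq0.
  rewrite nmM nmV !(modulus_nat K) natrD natrX; field.
  by rewrite expf_neq0 // pnatr_eq0.
have ve : clim v e.
  rewrite -[e in clim _ e]mulr1 -[1]addr0; apply: climZ; apply: climD => //.
  exact: clim_cst.
(* By minimality of j, |q|^j <= |e^2| < |q|^(j-1). Slightly enlarging |e| and staying below this
   midpoint puts |u_n^2| strictly between consecutive powers of |q|. *)
pose rho := (nm (e ^+ 2) + nm q ^+ j.-1) / 2.
have d0 : 0 < rho - nm (e ^+ 2) by rewrite /rho; lra.
have [N hN] := climX 2 ve d0.
have up n : nm (v (n + N)%N ^+ 2) < rho.
  have := hN _ (leq_addl n N); have := nm_triangle (v (n + N)%N ^+ 2) (e ^+ 2) 0.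
  by rewrite !subr0; lra.
have lo n : nm (e ^+ 2) < nm (v n ^+ 2).
  rewrite /v exprMn (nmM (e ^+ 2)) ltr_pMr // nmX n1t -[ltLHS](expr1n R 2) ltrXn2r ?nnegrE //.
    by rewrite ltrDl invr_gt0 exprn_gt0.
exists (fun n => v (n + N)%N), rho; split.
- exact: clim_shift.
- by rewrite /rho; lra.
- by move=> n; exact: ltW.
- by move=> n; rewrite -sqrf_eq0 -nm_gt0 (lt_trans nu0).
- move=> n m; have [jm|mj] := leqP j m.
    rewrite gt_eqF // (le_lt_trans _ (lo _)) // (le_trans _ hj) //.
    by rewrite ler_wiXn2l ?nm_ge0 // ltW.
  rewrite lt_eqF // (lt_le_trans (up _)) // (@le_trans _ _ (nm q ^+ j.-1)) //.
    by rewrite /rho; lra.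
  by rewrite ler_wiXn2l ?nm_ge0 ?(ltW q1) // -ltnS prednK.
Qed.

Theorem wp_sum_eval e A D x : nm e < 1 -> e != 0 -> A != 0 -> D != 0 -> x != 0 ->
  wp_sum q (wp_params e A D) (- e ^+ 2) x * qinf q (- e ^+ 2) * theta (-1) q =
  wp_value e A D x.
Proof.
move=> e1 e0 A0 D0 x0.
have [u [rho [ue rho1 urho u0 uq]]] := perturbation e0 e1.
have cst := @clim_cst R K.
have ue2 := climX 2 ue; have uen := climN ue2; have ui := climV ue e0.
have u1 n : nm (u n) < 1.
  have : nm (u n ^+ 2) < 1 by exact: le_lt_trans rho1.
  by rewrite nmX expr_lt1 ?nm_ge0.
have gen n : wp_sum q (wp_params (u n) A D) (- u n ^+ 2) x * qinf q (- u n ^+ 2) * theta (-1) q =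
  wp_value (u n) A D x.
  have un2 : u n ^+ 2 != 0 by rewrite expf_neq0.
  have nz (s : K) : nm s = 1 -> theta (s * u n ^+ 2) q != 0.
    move=> s1; have s0 : s != 0 by rewrite -nm_gt0 s1.
    rewrite thetaE mulf_neq0 //.
      apply: qinf_neq0_small => //.
      by rewrite nmM s1 mul1r; exact: le_lt_trans rho1.
    apply: qinf_neq0 => // m; rewrite subr_eq0; apply/eqP => h.
    have := uq n m.+1; rewrite -nmX.
    have -> : q ^+ m.+1 = s * u n ^+ 2 * (q / (s * u n ^+ 2) * q ^+ m).
      by rewrite exprS; field; apply/andP.
    by rewrite -h mulr1 nmM s1 mul1r eqxx.
  apply: wp_sum_eval_generic => //.
    by rewrite -[u n ^+ 2]mul1r nz // nm1.
  by rewrite -[u n ^+ 2]mul1r -mulNr nz // nmN nm1.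
have L : clim (fun n => wp_sum q (wp_params (u n) A D) (- u n ^+ 2) x * qinf q (- u n ^+ 2) * theta (-1) q)
   (wp_sum q (wp_params e A D) (- e ^+ 2) x * qinf q (- e ^+ 2) * theta (-1) q).
  apply: climM => //; apply: climM; last exact: qinf_cont.
  apply: (@wp_sum_cont [:: (fun n => A / u n, A / e); (fun n => q / A / u n, q / A / e);
    (fun n => D / u n, D / e); (fun n => q / D / u n, q / D / e); (u, e); (fun n => - u n, - e)] _ _ _ rho) => //.
    by move=> n; rewrite nmN.
  by do ?split; rewrite /= ?oppr_eq0 ?mulf_neq0 ?invr_eq0 //; [exact: climZ..|exact: climN].
apply: (clim_unique L); apply: (clim_ext (fun n => esym (gen n))).
rewrite /wp_value; apply: climM.
  apply: climM => //; apply: climM; first by apply: climM => //; exact: qinf_cont.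
  have q21 := sqr_lt1 q1.
  apply: (@clim_prod_map _ _ [:: (fun n => u n ^+ 2 * A * D, e ^+ 2 * A * D);
     (fun n => u n ^+ 2 * A * (q / D), e ^+ 2 * A * (q / D));
     (fun n => u n ^+ 2 * (q / A) * D, e ^+ 2 * (q / A) * D);
     (fun n => u n ^+ 2 * (q / A) * (q / D), e ^+ 2 * (q / A) * (q / D))]) => [v l vl|].
    exact: qinf_cont.
  by do ?split; rewrite //=; do 2?apply: climMr.
have h1 := climMr x ue; have h2 := climMr x^-1 ue.
have ex0 : e * x != 0 by rewrite mulf_neq0.
have exi0 : e / x != 0 by rewrite mulf_neq0 ?invr_eq0.
apply: climD; (apply: climM; [apply: climM => //|]); apply: theta_cont; rewrite ?oppr_eq0 //; exact: climN.
Qed.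

End Evaluation.

(** * From the 8Psi8 series to its normalized Laurent function *)

Section Psi8.
Variables (R : realType) (K : modulusField R) (q : K).
Hypotheses (q1 : nm q < 1) (q0 : q != 0).
Implicit Types (B : seq K) (a b c d x y z beta : K) (k n : nat).

Definition wp_norm B x : K :=
  (1 - x ^+ 2) * \prod_(b <- B) (qinf q (q / (x * b)) * qinf q (x / b * q)).

(** Reversal of the factors, 1 - y q^-i = - y q^-i (1 - q^i / y), in denominator-free form. *)
Lemma qpoch_negE x beta n : x != 0 -> beta != 0 ->
  (\prod_(i < n) (1 - x / beta * q * q ^- i.+1)) * qp q (q / (x * beta)) n * beta ^+ 2 ^+ n =
  q ^+ n * qp q (x^-1 * beta) n * \prod_(i < n) (1 - x * beta * q ^- i.+1).
Proof.
move=> x0 b0; elim: n => [|n IH]; first by rewrite !big_ord0 !qp0 !expr0 !mulr1.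
rewrite !big_ord_recr /= !qpSr (exprS q n) (exprSr (beta ^+ 2) n).
set P := \prod_(i < n) _ in IH *; set P' := \prod_(i < n) _ in IH *.
have qn0 : q ^+ n != 0 by rewrite expf_neq0.
transitivity ((P * qp q (q / (x * beta)) n * beta ^+ 2 ^+ n) *
  ((1 - x / beta * q * (q * q ^+ n)^-1) * (1 - q / (x * beta) * q ^+ n) * beta ^+ 2)); first by ring.
rewrite IH.
transitivity (q ^+ n * qp q (x^-1 * beta) n * P' *
   (q * (1 - x^-1 * beta * q ^+ n) * (1 - x * beta * (q * q ^+ n)^-1))); last by ring.
congr (_ * _); field; do ?[apply/andP; split] => //.
Qed.

Lemma wp_factor_pos x beta n : x != 0 -> beta != 0 -> qinf q (x / beta * q) != 0 ->
  qpoch q (x * beta) (Posz n) / qpoch q (q * x ^+ 2 / (x * beta)) (Posz n) *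
  (qinf q (q / (x * beta)) * qinf q (x / beta * q)) = wp_factor q n x beta.
Proof.
move=> x0 b0 nz.
have -> : q * x ^+ 2 / (x * beta) = x / beta * q by field; apply/andP.
rewrite /wp_factor (qinf_split q1 (x / beta * q) n) /= -!/(qp _ _ _) in nz *.
move: nz; rewrite mulf_eq0 negb_or => /andP[nz _].
by field.
Qed.

Lemma wp_factor_neg x beta n : x != 0 -> beta != 0 ->
  (forall i, 1 - x * beta * q ^- i.+1 != 0) ->
  qpoch q (x * beta) (Negz n) / qpoch q (q * x ^+ 2 / (x * beta)) (Negz n) *
  (qinf q (q / (x * beta)) * qinf q (x / beta * q)) =
  (q / beta ^+ 2) ^+ n.+1 * wp_factor q n.+1 x^-1 beta.
Proof.
move=> x0 b0 nz.
have -> : q * x ^+ 2 / (x * beta) = x / beta * q by field; apply/andP.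
have h := qpoch_negE n.+1 x0 b0.
rewrite /wp_factor /= invrK (qinf_split q1 (q / (x * beta)) n.+1).
have -> : q / (x^-1 * beta) = x / beta * q by field; apply/andP.
have -> : x^-1 / beta * q * q ^+ n.+1 = q / (x * beta) * q ^+ n.+1 by rewrite invfM; ring.
set P := \prod_(i < n.+1) (1 - x / beta * q * _) in h *.
set P' := \prod_(i < n.+1) (1 - x * beta * _) in h *.
have P0 : P' != 0 by apply/prodf_neq0 => i _; exact: nz.
have bn0 : beta ^+ 2 ^+ n.+1 != 0 by rewrite !expf_neq0.
rewrite expr_div_n.
apply: (mulfI P0); apply: (mulfI bn0).
transitivity ((P * qp q (q / (x * beta)) n.+1 * beta ^+ 2 ^+ n.+1) *
  (qinf q (q / (x * beta) * q ^+ n.+1) * qinf q (x / beta * q))); first by field.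
by rewrite h; field.
Qed.

Lemma clim_series (f : nat -> K) l : clim (fun n => \sum_(k < n) f k) l ->
  (series (fun n => (f n : (K : numFieldType)))) @ \oo --> (l : (K : numFieldType)).
Proof.
move=> h; apply: clim_cvg; apply: clim_ext h => n.
by rewrite seriesEord.
Qed.

Lemma psi8_wp_sum (b3 b4 b5 b6 b7 b8 x z : K) :
  let B := [:: b3; b4; b5; b6; b7; b8] in
  x != 0 -> {in B, forall b, b != 0} -> z != 0 -> nm z < 1 -> z * \prod_(b <- B) b = q ^+ 2 ->
  psi8_den_neq0 (x ^+ 2) (x * b3) (x * b4) (x * b5) (x * b6) (x * b7) (x * b8) q ->
  [/\ wp_norm B x != 0,
      psi8_cvg (x ^+ 2) (x * b3) (x * b4) (x * b5) (x * b6) (x * b7) (x * b8) q z &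
      psi8 (x ^+ 2) (x * b3) (x * b4) (x * b5) (x * b6) (x * b7) (x * b8) q z * wp_norm B x =
      wp_sum q B z x].
Proof.
move=> B x0 B0 z0 z1 zB [a1 den].
have ix0 : x^-1 != 0 by rewrite invr_eq0.
have dn b n : b \in B -> 1 - x / b * q * q ^+ n != 0 /\ 1 - x * b * q ^- n.+1 != 0.
  move=> bB; have [] := den (x * b) _ n; first by move: bB; rewrite !inE => /or4P[|||/or3P[]] /eqP->; rewrite eqxx ?orbT.
  have -> : q * x ^+ 2 / (x * b) = x / b * q by field; rewrite x0 (B0 _ bB).
  by [].
(* If (q/a_j) q^n were 1, then a_j q^-(n+1) would be 1, which the hypothesis on the terms of
   negative index excludes. *)
have qi b : b \in B -> qinf q (q / (x * b)) != 0.
  move=> bB; apply: qinf_neq0 => // n; have [_] := dn b n bB.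
  have b0 := B0 _ bB; have qn0 : q ^+ n.+1 != 0 by rewrite expf_neq0.
  apply: contra_neq => /subr0_eq h.
  have -> : x * b = q ^+ n.+1.
    have -> : x * b = x * b * (q / (x * b) * q ^+ n) by rewrite -h mulr1.
    by rewrite exprS; field; apply/andP.
  by rewrite mulfV // subrr.
have qj b : b \in B -> qinf q (x / b * q) != 0.
  by move=> bB; apply: qinf_neq0 => // n; case: (dn b n bB).
have N0 : wp_norm B x != 0.
  rewrite mulf_neq0 // prodf_seq_neq0; apply/allP => b bB /=.
  by apply: mulf_neq0; [exact: qi|exact: qj].
set f := psi8_term (x ^+ 2) (x * b3) (x * b4) (x * b5) (x * b6) (x * b7) (x * b8) q z.
have fprod (k : int) : f k = (1 - x ^+ 2 * q ^ (2 * k)) / (1 - x ^+ 2) *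
    (\prod_(b <- B) (qpoch q (x * b) k / qpoch q (q * x ^+ 2 / (x * b)) k)) * z ^ k.
  by rewrite /f /psi8_term !big_cons !big_nil.
have fpos n : f (Posz n) * wp_norm B x = wp_term q B z x n.
  rewrite fprod /wp_norm /wp_term.
  have -> : \prod_(b <- B) wp_factor q n x b =
     (\prod_(b <- B) (qpoch q (x * b) n / qpoch q (q * x ^+ 2 / (x * b)) n)) *
     \prod_(b <- B) (qinf q (q / (x * b)) * qinf q (x / b * q)).
    rewrite -big_split !big_seq; apply: eq_bigr => b bB /=.
    exact: esym (wp_factor_pos n x0 (B0 _ bB) (qj _ bB)).
  rewrite -[q ^ (2 * n)]/(q ^+ (2 * n)) mulnC exprM.
  by rewrite -[z ^ n]/(z ^+ n); field.
have fneg n : f (Negz n) * wp_norm B x = - x ^+ 2 * wp_term q B z x^-1 n.+1.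
  rewrite fprod /wp_norm /wp_term.
  have E : (\prod_(b <- B) (qpoch q (x * b) (Negz n) / qpoch q (q * x ^+ 2 / (x * b)) (Negz n))) *
     \prod_(b <- B) (qinf q (q / (x * b)) * qinf q (x / b * q)) =
     (z * q) ^+ 2 ^+ n.+1 * \prod_(b <- B) wp_factor q n.+1 x^-1 b.
    rewrite -big_split.
    transitivity (\prod_(b <- B) ((q / b ^+ 2) ^+ n.+1 * wp_factor q n.+1 x^-1 b)).
      rewrite !big_seq; apply: eq_bigr => b bB /=.
      by apply: (wp_factor_neg n x0 (B0 _ bB)) => i; case: (dn b i bB).
    (* Over the six parameters the product of the q / b^2 is q^6 / (q^2 / z)^2 = (z q)^2. *)
    rewrite big_split /= prodrXl; congr (_ ^+ _ * _).
    rewrite big_split prodfV /= prodrXl big_const_seq count_predT /= mulr1.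
    have PB : \prod_(b <- B) b = q ^+ 2 / z by rewrite -zB mulrC mulKf.
    by rewrite PB; field; apply/andP.
  have -> : q ^ (2 * Negz n) = (q ^+ n.+1 ^+ 2)^-1.
    by rewrite NegzE mulrN -exprnN -exprM mulnC.
  have -> : z ^ (Negz n) = (z ^+ n.+1)^-1 by [].
  set P := \prod_(b <- B) _ in E *; set P' := \prod_(b <- B) _ in E *.
  set W := \prod_(b <- B) _ in E *.
  have zn0 : z ^+ n.+1 != 0 by rewrite expf_neq0.
  have qn0 : q ^+ n.+1 != 0 by rewrite expf_neq0.
  transitivity ((1 - x ^+ 2 / q ^+ n.+1 ^+ 2) * (P * P') / z ^+ n.+1).
    by field; do ?[apply/andP; split].
  have -> : P * P' = (z ^+ n.+1 * q ^+ n.+1) ^+ 2 * W by rewrite E -exprM mulnC exprM exprMn.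
  move: (z ^+ n.+1) (q ^+ n.+1) zn0 qn0 => Z Q Z0 Q0.
  by field; do ?[apply/andP; split].
have b1 := wp_bsum q B (nm x) (nm x)^-1 z1.
have b2 := wp_bsum q B (nm x^-1) (nm x^-1)^-1 z1.
have h1 : clim (fun n => \sum_(k < n) f (Posz k)) (csum (wp_term q B z x) / wp_norm B x).
  apply: (clim_ext _ (climMr (wp_norm B x)^-1 (csumP b1 (fun k => wp_term_bound q1 B z k x0)))) => n /=.
  by rewrite mulr_suml; apply: eq_bigr => k _; rewrite -fpos mulfK.
have h2 : clim (fun n => \sum_(k < n) f (Negz k))
    (- x ^+ 2 * csum (fun k => wp_term q B z x^-1 k.+1) / wp_norm B x).
  have s2 := csumP (bsum_shift b2) (fun k => wp_term_bound q1 B z k.+1 ix0).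
  apply: (clim_ext _ (climMr (wp_norm B x)^-1 (climZ (- x ^+ 2) s2))) => n /=.
  by rewrite mulr_sumr mulr_suml; apply: eq_bigr => k _; rewrite -fneg mulfK.
have l1 := @clim_series (fun n => f (Posz n)) _ h1; have l2 := @clim_series (fun n => f (Negz n)) _ h2.
split=> //; first by split; apply/cvg_ex; eexists; [exact: l1|exact: l2].
rewrite /psi8 /bisum -/f (cvg_lim _ l1) // (cvg_lim _ l2) //.
by rewrite /wp_sum; field.
Qed.

End Psi8.

(** * The 8Psi8 as a sum of two products of four theta functions *)

Section Psi8Evaluation.
Variables (R : realType) (K : modulusField R) (q : K).
Hypotheses (q1 : nm q < 1) (q0 : q != 0).
Implicit Types (B : seq K) (a b c d x y z : K) (k n : nat).

Lemma wp_sum_perm B B' z x : perm_eq B B' -> wp_sum q B z x = wp_sum q B' z x.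
Proof.
move=> BB'; have E y k : wp_term q B z y k = wp_term q B' z y k.
  by rewrite /wp_term (perm_big _ BB').
rewrite /wp_sum (eq_csum (E x)); congr (_ - _ * _).
by apply: eq_csum => k.
Qed.

Definition psi8_norm a (L : seq K) : K :=
  (1 - a) * \prod_(y <- L) (qinf q (q / y) * qinf q (q * a / y)).

(** With x = sqrt(a), e = r x / s, A = r b / s and D = r c / s, the x multiples of
    [wp_params q e A D] are b, cd/b, c, d, r a/s, - r a/s, and e^2 = qa/(cd), so the convergence
    condition says |e| < 1. The permutation accommodates the different orders in which the two
    series list their parameters. *)
Lemma psi8_eval (r s a b c d b3 b4 b5 b6 b7 b8 : K) :
  r ^+ 2 = q -> s ^+ 2 = c * d -> a != 0 -> b != 0 -> c != 0 -> d != 0 ->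
  nm (q * a) < nm (c * d) ->
  perm_eq [:: b3; b4; b5; b6; b7; b8] [:: b; c * d / b; c; d; r * a / s; - (r * a / s)] ->
  psi8_den_neq0 a b3 b4 b5 b6 b7 b8 q ->
  [/\ psi8_norm a [:: b3; b4; b5; b6; b7; b8] != 0,
      psi8_cvg a b3 b4 b5 b6 b7 b8 q (- (q * a / (c * d))) &
      psi8 a b3 b4 b5 b6 b7 b8 q (- (q * a / (c * d))) *
        psi8_norm a [:: b3; b4; b5; b6; b7; b8] *
        qinf q (- (q * a / (c * d))) * theta (-1) q =
      qinf q q * qinf q (- q) * qinf q (q * a / (c * d)) *
      \prod_(y <- [:: q ^+ 2 * a * b / (c * d ^+ 2); q ^+ 2 * a * b / (c ^+ 2 * d);
                      q ^+ 2 * a / (b * d); q ^+ 2 * a / (b * c)]) qinf (q ^+ 2) y *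
      theta a q *
      (theta (r * b / s) q * theta (r * c / s) q * theta (- (r * a / s)) q * theta (- (r / s)) q +
       theta (- (r * b / s)) q * theta (- (r * c / s)) q * theta (r * a / s) q * theta (r / s) q)].
Proof.
move=> rq sE a0 b0 c0 d0 conv perm den.
have cd0 : c * d != 0 by rewrite mulf_neq0.
have s0 : s != 0 by rewrite -sqrf_eq0 sE.
have r0 : r != 0 by rewrite -sqrf_eq0 rq.
have dE : d = s ^+ 2 / c by rewrite sE mulrC mulKf.
pose x := sqrtC a; have xa : x ^+ 2 = a by exact: sqrtCK.
have x0 : x != 0 by rewrite -sqrf_eq0 xa.
pose e := r * x / s; have e0 : e != 0 by rewrite !mulf_neq0 ?invr_eq0.
have nuE : q * a / (c * d) = e ^+ 2 by rewrite -rq -xa -sE /e; field.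
have nu1 : nm (e ^+ 2) < 1.
  by rewrite -nuE nmM nmV ltr_pdivrMr ?mul1r // nm_gt0.
have e1 : nm e < 1 by move: nu1; rewrite nmX expr_lt1 ?nm_ge0.
have z0 : - e ^+ 2 != 0 by rewrite oppr_eq0 expf_neq0.
have z1 : nm (- e ^+ 2) < 1 by rewrite nmN.
pose A := r * b / s; pose D := r * c / s.
have A0 : A != 0 by rewrite !mulf_neq0 ?invr_eq0.
have D0 : D != 0 by rewrite !mulf_neq0 ?invr_eq0.
pose L := [:: b3; b4; b5; b6; b7; b8].
pose B := [seq y / x | y <- L].
have BP : perm_eq B (wp_params q e A D).
  have -> : wp_params q e A D = [seq y / x | y <- [:: b; c * d / b; c; d; r * a / s; - (r * a / s)]].
    rewrite /wp_params /= -sE dE -xa -rq /e /A /D.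
    by congr [:: _; _; _; _; _; _]; field; do ?[apply/andP; split].
  exact: perm_map.
have B0 : {in B, forall y, y != 0}.
  by move=> y; rewrite (perm_mem BP); exact: wp_params_neq0.
have zB : - e ^+ 2 * \prod_(y <- B) y = q ^+ 2.
  by rewrite (perm_big _ BP) wp_params_prod.
have xk y : x * (y / x) = y by rewrite mulrC divfK.
have := @psi8_wp_sum R K q q1 q0 (b3 / x) (b4 / x) (b5 / x) (b6 / x) (b7 / x) (b8 / x) x (- e ^+ 2)
  x0 B0 z0 z1 zB.
rewrite !xk xa -/B => /(_ den).
have -> : wp_norm q B x = psi8_norm a L.
  rewrite /wp_norm /psi8_norm xa big_map; congr (_ * _); apply: eq_bigr => y _.
  rewrite xk; congr (_ * qinf q _).
  by rewrite invf_div -xa expr2; ring.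
rewrite nuE => -[N0 cv ->]; split=> //.
rewrite (wp_sum_perm _ _ BP) (wp_sum_eval q1 q0 e1 e0 A0 D0 x0) /wp_value xa.
have -> : e * x = r * a / s by rewrite -xa /e; ring.
have -> : e / x = r / s by rewrite /e; field; apply/andP.
rewrite -/A -/D; congr (_ * _ * _ * _).
rewrite !big_cons !big_nil.
have -> : e ^+ 2 * A * D = q ^+ 2 * a * b / (c * d ^+ 2).
  by rewrite /e /A /D -xa -rq dE; field; do ?[apply/andP; split].
have -> : e ^+ 2 * A * (q / D) = q ^+ 2 * a * b / (c ^+ 2 * d).
  by rewrite /e /A /D -xa -rq dE; field; do ?[apply/andP; split].
have -> : e ^+ 2 * (q / A) * D = q ^+ 2 * a / (b * d).
  by rewrite /e /A /D -xa -rq dE; field; do ?[apply/andP; split].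
have -> : e ^+ 2 * (q / A) * (q / D) = q ^+ 2 * a / (b * c).
  by rewrite /e /A /D -xa -rq; field; do ?[apply/andP; split].
by [].
Qed.

End Psi8Evaluation.

(** * Assembling the transformation *)

(** Every q-product is abstracted to a variable, leaving algebra for [field]: the first two
    equations solve for the two series, the third eliminates [H1] in favour of [H2] and the extra
    product with [t1]. *)
Lemma combine_evaluations (F : fieldType)
  (psi1 psi2 oa oA qb qab qc qac qd qad rsa rs mrsa mrs qbg qabg mnu nu mq q_ n1 n2 n3 n4
   m3 m4 qa qia H1 H2 mqb k1 k2 k3 k4 bcd u mu mrsb bc2 bd2 mw ba my my2 w c_ d_ mv rsb t1
   e1 e3 : F) :
  psi1 * (oa * (qb * qab * (qc * qac * (qd * qad * (rsa * rs * (mrsa * mrs * (qbg * qabg)))))))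
    * mnu * (2 * mq ^+ 2) = q_ * mq * nu * (n3 * n4 * m3 * m4) * (oa * qa * qia) * H1 ->
  psi2 * (oA * (qb * mrs * (mqb * rs * (qc * k2 * (qd * k1 * (mrsa * bcd * (k3 * qabg)))))))
    * u * (2 * mq ^+ 2) = q_ * mq * mu * (n3 * n4 * n2 * n1) * (oA * mrsb * k4) * H2 ->
  bc2 * m4 * (bd2 * m3) * (mw * mrs) * H1 = ba * qab * (my * my2) * H2 +
    w * (2 * mq ^+ 2) * (c_ * qc) * (qd * d_) * (mv * mrsa) * (u * rsb) * t1 ->
  e1 * mq = 1 -> 2 != 0 :> F -> w != 0 ->
  all (fun y => y != 0) [:: oa; oA; qb; qab; qc; qac; qd; qad; rsa; rs; mrsa; mrs; qbg; qabg;
    mnu; mqb; k1; k2; k3; bcd; mrsb; bc2; n1; bd2; n2; mw; mu; k4; u; e3; nu] ->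
  psi1 = (qa * qia * mqb * ba * my * my2 * nu * u * bcd * k1 * k2 * k3) /
      (mrs * mrsb * qac * qad * (bc2 * n1) * (bd2 * n2) * qbg * rsa * mw * mu * k4 * mnu) * psi2 +
    (q_ * qa * qia * c_ * d_ * nu * nu * mv * rsb * (u * mu * e3)) * t1 * (n1 * n2 * n3 * n4) /
    ((qb * qab * qac * qad * (bc2 * n1) * (bd2 * n2) * rsa * qbg * mu * qabg) * (mw * mrs / w) *
     (e1 * (rs * mrs) * e3 * (nu * mnu))).
Proof.
move=> h1 h2 hT emq t0 w0 /=; do 31?[case/andP=> ?]; move=> _.
have mq0 : mq != 0 by apply/eqP => h; move: emq; rewrite h mulr0 => /eqP; rewrite eq_sym oner_eq0.
have e10 : e1 != 0 by apply/eqP => h; move: emq; rewrite h mul0r => /eqP; rewrite eq_sym oner_eq0.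
have eE : e1 = mq^-1 by apply: (mulIf mq0); rewrite emq mulVf.
have hX : m3 * m4 * H1 = (ba * qab * (my * my2) * H2 +
    w * (2 * mq ^+ 2) * (c_ * qc) * (qd * d_) * (mv * mrsa) * (u * rsb) * t1) /
    (bc2 * bd2 * (mw * mrs)).
  by rewrite -hT; field; do ?[apply/andP; split].
set P1 := oa * (qb * qab * (qc * qac * _)) in h1.
have P10 : P1 * mnu * (2 * mq ^+ 2) != 0 by rewrite !mulf_neq0 ?expf_neq0.
have -> : psi1 = q_ * mq * nu * (n3 * n4 * (m3 * m4 * H1)) * (oa * qa * qia) /
   (P1 * mnu * (2 * mq ^+ 2)).
  apply: (mulIf P10); rewrite divfK //.
  by transitivity (psi1 * P1 * mnu * (2 * mq ^+ 2)); [ring|rewrite h1; ring].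
set P2 := oA * (qb * mrs * (mqb * rs * _)) in h2.
have P20 : P2 * u * (2 * mq ^+ 2) != 0 by rewrite !mulf_neq0 ?expf_neq0.
have -> : psi2 = q_ * mq * mu * (n3 * n4 * n2 * n1) * (oA * mrsb * k4) * H2 /
   (P2 * u * (2 * mq ^+ 2)).
  apply: (mulIf P20); rewrite divfK //.
  by transitivity (psi2 * P2 * u * (2 * mq ^+ 2)); [ring|rewrite h2].
rewrite /P1 /P2 {P1 P2 P10 P20 h1 h2}.
rewrite hX eE.
by field; do ?[apply/andP; split].
Qed.

Lemma perm_eq6_last_second (T : eqType) (b c d e f g : T) :
  perm_eq [:: b; c; d; e; f; g] [:: b; g; c; d; e; f].
Proof. by apply/permP => p /=; lia. Qed.

Lemma perm_eq6_pair_first (T : eqType) (b c d e f g : T) :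
  perm_eq [:: b; e; c; d; f; g] [:: f; g; c; d; e; b].
Proof. by apply/permP => p /=; lia. Qed.

(* [hsq : sq ^+ 2 = q] and [dE : d = scd ^+ 2 / c] eliminate q and d, after which *)
(* the arguments of the q-products are rational functions of sq, scd, a, b, c. *)
Ltac solve_arg hsq dE := rewrite -?hsq ?dE; field; do ?[apply/andP; split] => //.

Section Main.
Variables (R : realType) (K : modulusField R).

Theorem psi8_transformation (q a b c d sq scd : K)
  (q1 : nm q < 1) (q0 : q != 0)
  (ha : a != 0) (hb : b != 0) (hc : c != 0) (hd : d != 0)
  (hsq : sq ^+ 2 = q) (hscd : scd ^+ 2 = c * d)
  (hconv1 : nm (q * a) < nm (c * d))
  (hconv2 : nm (sq * b) < nm scd)
  (hden1 : psi8_den_neq0 a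
     b c d (sq * a / scd) (- (sq * a / scd)) (c * d / b) q)
  (hden2 : psi8_den_neq0 (- (scd * b / sq))
     b (- b) c d (- (sq * a / scd)) (- (scd ^+ 3 / (sq * a))) q)
  (hden3 : qinfs q
     [:: - (sq * scd); - (sq * scd * b); q * a / c; q * a / d; b * c / a;
         b * d / a; q * b / (c * d); sq * scd / a; - (sq / scd);
         - (sq * b / scd); - (sq ^+ 3 / (scd * b)); - (q * a / (c * d))] != 0)
  (hden6 : qinfs (q ^+ 2)
     [:: q; q * c * d; q ^+ 2 * b ^+ 2 / (c * d);
         q ^+ 2 * a ^+ 2 / (c ^+ 2 * d ^+ 2)] != 0) :
  [/\ psi8_cvg a
        b c d (sq * a / scd) (- (sq * a / scd)) (c * d / b)
        q (- (q * a / (c * d))),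
      psi8_cvg (- (scd * b / sq))
        b (- b) c d (- (sq * a / scd)) (- (scd ^+ 3 / (sq * a)))
        q (sq * b / scd)
    & psi8 a
        b c d (sq * a / scd) (- (sq * a / scd)) (c * d / b)
        q (- (q * a / (c * d)))
      =
      qinfs q
        [:: q * a; q / a; - (q / b); b / a; - (sq * c / scd); - (sq * d / scd);
            q * a / (c * d); sq * b / scd; b * c * d / a;
            - (sq * c / scd * b); - (sq * d / scd * b);
            - (sq ^+ 3 * a / scd ^+ 3)]
      / qinfs q
        [:: - (sq * scd); - (sq * scd * b); q * a / c; q * a / d; b * c / a;
            b * d / a; q * b / (c * d); sq * scd / a; - (sq / scd);
            - (sq * b / scd); - (sq ^+ 3 / (scd * b)); - (q * a / (c * d))]
      * psi8 (- (scd * b / sq))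
          b (- b) c d (- (sq * a / scd)) (- (scd ^+ 3 / (sq * a)))
          q (sq * b / scd)
      + (qinfs q
           [:: q; q * a; q / a; c; d; q * a / (c * d); q * a / (c * d);
               - (sq * a / scd); sq * scd / b; q * b ^+ 2 / (c * d)]
         * theta (- (scd / sq * (b / a))) q
         * qinfs (q ^+ 2)
           [:: q * b * c / a; q * b * d / a; q ^+ 2 * a * b / (c ^+ 2 * d);
               q ^+ 2 * a * b / (c * d ^+ 2)])
        / (qinfs q
             [:: q / b; q * a / b; q * a / c; q * a / d; b * c / a; b * d / a;
                 sq * scd / a; q * b / (c * d); - (sq * b / scd);
                 q * a * b / (c * d)]
           * theta (- (scd / sq)) q
           * qinfs (q ^+ 2)
             [:: q; q * c * d; q ^+ 2 * b ^+ 2 / (c * d);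
                 q ^+ 2 * a ^+ 2 / (c ^+ 2 * d ^+ 2)])].
Proof.
have cd0 : c * d != 0 by rewrite mulf_neq0.
have s0 : scd != 0 by rewrite -sqrf_eq0 hscd.
have r0 : sq != 0 by rewrite -sqrf_eq0 hsq.
have dE : d = scd ^+ 2 / c by rewrite hscd mulrC mulKf.
(* For the second series [A] replaces a and [b'] replaces b; then cd/b' is its last parameter and
   the pair +- sq A/scd becomes -+ b. *)
pose A := - (scd * b / sq); pose b' := - (sq * a / scd).
have A0 : A != 0 by rewrite oppr_eq0 !mulf_neq0 ?invr_eq0.
have b'0 : b' != 0 by rewrite oppr_eq0 !mulf_neq0 ?invr_eq0.
have zE : - (q * A / (c * d)) = sq * b / scd.
  by rewrite -hsq -hscd /A; field; apply/andP.
have rA : sq * A / scd = - b by rewrite /A; field; apply/andP.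
have gE : c * d / b' = - (scd ^+ 3 / (sq * a)).
  by rewrite -hscd /b'; field; do ?[apply/andP; split].
have conv2 : nm (q * A) < nm (c * d).
  rewrite -hscd -hsq /A (_ : sq ^+ 2 * - (scd * b / sq) = - (scd * (sq * b))); last by field.
  by rewrite nmN nmM nmX expr2 ltr_pM2l // nm_gt0.
have p1 : perm_eq [:: b; c; d; sq * a / scd; - (sq * a / scd); c * d / b]
     [:: b; c * d / b; c; d; sq * a / scd; - (sq * a / scd)].
  exact: perm_eq6_last_second.
have p2 : perm_eq [:: b; - b; c; d; - (sq * a / scd); - (scd ^+ 3 / (sq * a))]
     [:: b'; c * d / b'; c; d; sq * A / scd; - (sq * A / scd)].
  by rewrite rA gE opprK; exact: perm_eq6_pair_first.
have [N1 cv1 ev1] := psi8_eval q1 q0 hsq hscd ha hb hc hd hconv1 p1 hden1.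
have [N2 cv2 ev2] := psi8_eval q1 q0 hsq hscd A0 b'0 hc hd conv2 p2 hden2.
rewrite zE in cv2 ev2; split=> //.
pose H1 := theta (sq * b / scd) q * theta (sq * c / scd) q * theta (- (sq * a / scd)) q * theta (- (sq / scd)) q
  + theta (- (sq * b / scd)) q * theta (- (sq * c / scd)) q * theta (sq * a / scd) q * theta (sq / scd) q.
pose H2 := theta (- (q * a / (c * d))) q * theta (sq * c / scd) q * theta b q * theta (- (sq / scd)) q
  + theta (q * a / (c * d)) q * theta (- (sq * c / scd)) q * theta (- b) q * theta (sq / scd) q.
pose Q := qinf q; pose P := qinf (q ^+ 2).
have tN1 := thetaqN q1.
set psi1 := psi8 a _ _ _ _ _ _ _ _ in ev1 *.
set psi2 := psi8 A _ _ _ _ _ _ _ _ in ev2 *.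
have nE1 : psi8_norm q a [:: b; c; d; sq * a / scd; - (sq * a / scd); c * d / b] =
  (1 - a) * (Q (q / b) * Q (q * a / b) * (Q (q / c) * Q (q * a / c) *
    (Q (q / d) * Q (q * a / d) * (Q (sq * scd / a) * Q (sq * scd) * (Q (- (sq * scd / a)) * Q (- (sq * scd)) *
    (Q (q * b / (c * d)) * Q (q * a * b / (c * d)))))))).
  rewrite /psi8_norm !big_cons !big_nil mulr1.
  rewrite (_ : q / (sq * a / scd) = sq * scd / a); last by solve_arg hsq dE.
  rewrite (_ : q * a / (sq * a / scd) = sq * scd); last by solve_arg hsq dE.
  rewrite (_ : q / - (sq * a / scd) = - (sq * scd / a)); last by solve_arg hsq dE.
  rewrite (_ : q * a / - (sq * a / scd) = - (sq * scd)); last by solve_arg hsq dE.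
  rewrite (_ : q / (c * d / b) = q * b / (c * d)); last by field; do ?[apply/andP; split].
  by rewrite (_ : q * a / (c * d / b) = q * a * b / (c * d)); last by field; do ?[apply/andP; split].
have nE2 : psi8_norm q A [:: b; - b; c; d; - (sq * a / scd); - (scd ^+ 3 / (sq * a))] =
  (1 - A) * (Q (q / b) * Q (- (sq * scd)) * (Q (- (q / b)) * Q (sq * scd) *
    (Q (q / c) * Q (- (sq * d / scd * b)) * (Q (q / d) * Q (- (sq * c / scd * b)) *
    (Q (- (sq * scd / a)) * Q (b * c * d / a) * (Q (- (sq ^+ 3 * a / scd ^+ 3)) * Q (q * a * b / (c * d)))))))).
  rewrite /psi8_norm !big_cons !big_nil mulr1 /A.
  rewrite (_ : q * - (scd * b / sq) / b = - (sq * scd)); last by solve_arg hsq dE.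
  rewrite (_ : q / - b = - (q / b)); last by solve_arg hsq dE.
  rewrite (_ : q * - (scd * b / sq) / - b = sq * scd); last by solve_arg hsq dE.
  rewrite (_ : q * - (scd * b / sq) / c = - (sq * d / scd * b)); last by solve_arg hsq dE.
  rewrite (_ : q * - (scd * b / sq) / d = - (sq * c / scd * b)); last by solve_arg hsq dE.
  rewrite (_ : q / - (sq * a / scd) = - (sq * scd / a)); last by solve_arg hsq dE.
  rewrite (_ : q * - (scd * b / sq) / - (sq * a / scd) = b * c * d / a); last by solve_arg hsq dE.
  rewrite (_ : q / - (scd ^+ 3 / (sq * a)) = - (sq ^+ 3 * a / scd ^+ 3)); last by solve_arg hsq dE.
  by rewrite (_ : q * - (scd * b / sq) / - (scd ^+ 3 / (sq * a)) = q * a * b / (c * d)); last by solve_arg hsq dE.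
rewrite nE1 in N1 ev1; rewrite nE2 in N2 ev2.
have h1 : psi1 * ((1 - a) * (Q (q / b) * Q (q * a / b) * (Q (q / c) * Q (q * a / c) *
    (Q (q / d) * Q (q * a / d) * (Q (sq * scd / a) * Q (sq * scd) * (Q (- (sq * scd / a)) * Q (- (sq * scd)) *
    (Q (q * b / (c * d)) * Q (q * a * b / (c * d)))))))))
    * Q (- (q * a / (c * d))) * (2 * Q (- q) ^+ 2) =
  Q q * Q (- q) * Q (q * a / (c * d)) * (P (q ^+ 2 * a * b / (c ^+ 2 * d)) * P (q ^+ 2 * a * b / (c * d ^+ 2)) *
    P (q ^+ 2 * a / (b * d)) * P (q ^+ 2 * a / (b * c))) * ((1 - a) * Q (q * a) * Q (q / a)) * H1.
  move: ev1; rewrite tN1 (thetaE a) (qinf_recl q1 a) !big_cons !big_nil -/H1 (mulrC a q) => ->.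
  by rewrite /Q /P; ring.
have h2 : psi2 * ((1 - A) * (Q (q / b) * Q (- (sq * scd)) * (Q (- (q / b)) * Q (sq * scd) *
    (Q (q / c) * Q (- (sq * d / scd * b)) * (Q (q / d) * Q (- (sq * c / scd * b)) *
    (Q (- (sq * scd / a)) * Q (b * c * d / a) * (Q (- (sq ^+ 3 * a / scd ^+ 3)) * Q (q * a * b / (c * d)))))))))
    * Q (sq * b / scd) * (2 * Q (- q) ^+ 2) =
  Q q * Q (- q) * Q (- (sq * b / scd)) * (P (q ^+ 2 * a * b / (c ^+ 2 * d)) * P (q ^+ 2 * a * b / (c * d ^+ 2)) *
    P (q * b * d / a) * P (q * b * c / a)) * ((1 - A) * Q (- (sq * scd * b)) * Q (- (sq ^+ 3 / (scd * b)))) * H2.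
  move: ev2; rewrite tN1 (thetaE A) (qinf_recl q1 A) !big_cons !big_nil rA opprK.
  rewrite (_ : sq * b' / scd = - (q * a / (c * d))); last by rewrite -hscd -hsq /b'; field.
  rewrite !opprK -/H2.
  rewrite (_ : q * A / (c * d) = - (sq * b / scd)); last by rewrite -zE opprK.
  rewrite (_ : A * q = - (sq * scd * b)); last by rewrite -hsq /A; field.
  rewrite (_ : q / A = - (sq ^+ 3 / (scd * b))); last by rewrite -hsq /A; field; do ?[apply/andP; split].
  rewrite (_ : q ^+ 2 * A * b' / (c * d ^+ 2) = q ^+ 2 * a * b / (c * d ^+ 2)); last by rewrite /A /b'; field; do ?[apply/andP; split].
  rewrite (_ : q ^+ 2 * A * b' / (c ^+ 2 * d) = q ^+ 2 * a * b / (c ^+ 2 * d)); last by rewrite /A /b'; field; do ?[apply/andP; split].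
  rewrite (_ : q ^+ 2 * A / (b' * d) = q * b * c / a); last by rewrite /A /b' -hsq dE; field; do ?[apply/andP; split].
  rewrite (_ : q ^+ 2 * A / (b' * c) = q * b * d / a); last by rewrite /A /b' -hsq dE; field; do ?[apply/andP; split].
  by move=> ->; rewrite /Q /P; ring.
(* [theta_relation] with its theta functions expanded into q-products. *)
have hT : P (b * c / a) * P (q ^+ 2 * a / (b * c)) * (P (b * d / a) * P (q ^+ 2 * a / (b * d))) *
   (Q (- (sq / scd)) * Q (- (sq * scd))) * H1 =
   Q (b / a) * Q (q * a / b) * (Q (- (sq * c / scd)) * Q (- (sq * d / scd))) * H2 +
   sq / scd * (2 * Q (- q) ^+ 2) * (Q c * Q (q / c)) * (Q (q / d) * Q d) *
   (Q (- (sq * a / scd)) * Q (- (sq * scd / a))) * (Q (sq * b / scd) * Q (sq * scd / b)) *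
   theta (- (scd / sq * (b / a))) q.
  have u0 : sq * b / scd != 0 by rewrite !mulf_neq0 ?invr_eq0.
  have v0 : sq * a / scd != 0 by rewrite !mulf_neq0 ?invr_eq0.
  have w0 : sq / scd != 0 by rewrite !mulf_neq0 ?invr_eq0.
  have y0 : sq * c / scd != 0 by rewrite !mulf_neq0 ?invr_eq0.
  have := theta_relation q1 q0 u0 v0 w0 y0.
  rewrite (_ : sq * b / scd / (sq * a / scd * (sq / scd)) = scd / sq * (b / a)); last by field; do ?[apply/andP; split].
  rewrite (_ : scd / sq * (b / a) * (sq * c / scd) = b * c / a); last by field; do ?[apply/andP; split].
  rewrite (_ : q * (scd / sq * (b / a)) / (sq * c / scd) = b * d / a); last by solve_arg hsq dE.
  rewrite (_ : sq * b / scd / (sq * a / scd) = b / a); last by field; do ?[apply/andP; split].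
  rewrite (_ : sq * a / scd * (sq / scd) = q * a / (c * d)); last by rewrite -hscd -hsq; field.
  rewrite (_ : sq * b / scd / (sq / scd) = b); last by field; do ?[apply/andP; split].
  rewrite (_ : sq * c / scd / (sq / scd) = c); last by field; do ?[apply/andP; split].
  rewrite (_ : sq * c / scd * (sq / scd) = q / d); last by solve_arg hsq dE.
  rewrite -/H1 -/H2 tN1 (thetaE (b * c / a)) (thetaE (b * d / a)) (thetaE (- (sq / scd))) (thetaE (b / a))
    (thetaE (- (sq * c / scd))) (thetaE c) (thetaE (q / d)) (thetaE (- (sq * a / scd))) (thetaE (sq * b / scd)).
  rewrite (_ : q ^+ 2 / (b * c / a) = q ^+ 2 * a / (b * c)); last by field; do ?[apply/andP; split].
  rewrite (_ : q ^+ 2 / (b * d / a) = q ^+ 2 * a / (b * d)); last by field; do ?[apply/andP; split].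
  rewrite (_ : q / - (sq / scd) = - (sq * scd)); last by solve_arg hsq dE.
  rewrite (_ : q / (b / a) = q * a / b); last by field; do ?[apply/andP; split].
  rewrite (_ : q / - (sq * c / scd) = - (sq * d / scd)); last by solve_arg hsq dE.
  rewrite (_ : q / (q / d) = d); last by field; do ?[apply/andP; split].
  rewrite (_ : q / - (sq * a / scd) = - (sq * scd / a)); last by solve_arg hsq dE.
  rewrite (_ : q / (sq * b / scd) = sq * scd / b); last by solve_arg hsq dE.
  move=> E; transitivity (P (b * c / a) * P (q ^+ 2 * a / (b * c)) * (P (b * d / a) * P (q ^+ 2 * a / (b * d))) *
   (Q (- (sq / scd)) * Q (- (sq * scd))) * H1); first by [].
  by rewrite /Q /P E; ring.
have q21 := sqr_lt1 q1.
(* Euler's identity: (q;q)(-q;q) = (q^2;q^2) and (q;q) = (q;q^2)(q^2;q^2). *)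
have Pq : P q * Q (- q) = 1.
  have qq0 : Q q != 0 by exact: qinf_neq0_small.
  apply: (mulfI qq0); rewrite mulr1 mulrCA (qinf_sqr q1 q) [RHS](qinf_double q1 q).
  by rewrite -expr2.
have t20 : 2 != 0 :> K by rewrite pnatr_eq0.
have w0 : sq / scd != 0 by rewrite !mulf_neq0 ?invr_eq0.
have u1 : nm (sq * b / scd) < 1 by rewrite nmM nmV ltr_pdivrMr ?mul1r // nm_gt0.
have u0 : Q (sq * b / scd) != 0 by exact: qinf_neq0_small.
(* The products of the statement mix bases q and q^2; these rewritings bring them to the factors
   occurring in [h1], [h2] and [hT]. *)
have eqd x (y : K) : x * q = y -> Q x = P x * P y by move=> <-; exact: qinf_double.
have ebc : Q (b * c / a) = P (b * c / a) * P (q * b * c / a) by apply: eqd; ring.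
have ebd : Q (b * d / a) = P (b * d / a) * P (q * b * d / a) by apply: eqd; ring.
have eqb : Q (q * b ^+ 2 / (c * d)) =
    Q (sq * b / scd) * Q (- (sq * b / scd)) * P (q ^+ 2 * b ^+ 2 / (c * d)).
  rewrite (qinf_sqr q1) (_ : (sq * b / scd) ^+ 2 = q * b ^+ 2 / (c * d)); last by rewrite -hscd -hsq; field.
  by apply: eqd; ring.
have ers : P (q * c * d) = Q (sq * scd) * Q (- (sq * scd)).
  by rewrite (qinf_sqr q1) exprMn hsq hscd mulrA.
have enu : P (q ^+ 2 * a ^+ 2 / (c ^+ 2 * d ^+ 2)) = Q (q * a / (c * d)) * Q (- (q * a / (c * d))).
  by rewrite (qinf_sqr q1); congr qinf; field; apply/andP.
have etw : theta (- (scd / sq)) q = Q (- (sq / scd)) * Q (- (sq * scd)) / (sq / scd).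
  rewrite (_ : - (scd / sq) = (- (sq / scd))^-1); last by field; apply/andP.
  rewrite (theta_inv q1 q0) ?oppr_eq0 // thetaE.
  rewrite (_ : q / - (sq / scd) = - (sq * scd)); last by solve_arg hsq dE.
  by rewrite /Q invrN mulrN opprK.
have nonzero : all (fun y => y != 0) [:: 1 - a; 1 - A; Q (q / b); Q (q * a / b); Q (q / c);
    Q (q * a / c); Q (q / d); Q (q * a / d); Q (sq * scd / a); Q (sq * scd); Q (- (sq * scd / a));
    Q (- (sq * scd)); Q (q * b / (c * d)); Q (q * a * b / (c * d)); Q (- (q * a / (c * d)));
    Q (- (q / b)); Q (- (sq * c / scd * b)); Q (- (sq * d / scd * b)); Q (- (sq ^+ 3 * a / scd ^+ 3));
    Q (b * c * d / a); Q (- (sq * scd * b)); P (b * c / a); P (q * b * c / a); P (b * d / a);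
    P (q * b * d / a); Q (- (sq / scd)); Q (- (sq * b / scd)); Q (- (sq ^+ 3 / (scd * b)));
    Q (sq * b / scd); P (q ^+ 2 * b ^+ 2 / (c * d)); Q (q * a / (c * d))].
  move: N1; rewrite !mulf_eq0 !negb_or -!andbA => /andP[z_oa /andP[z_qb /andP[z_qab /andP[z_qc
    /andP[z_qac /andP[z_qd /andP[z_qad /andP[z_rsa /andP[z_rs /andP[z_mrsa /andP[z_mrs
    /andP[z_qbg z_qabg]]]]]]]]]]]].
  move: N2; rewrite !mulf_eq0 !negb_or -!andbA => /andP[z_oA /andP[_ /andP[_ /andP[z_mqb
    /andP[_ /andP[_ /andP[z_k2 /andP[_ /andP[z_k1 /andP[_ /andP[z_bcd /andP[z_k3 _]]]]]]]]]]]].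
  move: hden3; rewrite /qinfs !big_cons !big_nil -/Q ebc ebd !mulf_eq0 !negb_or -!andbA =>
    /andP[_ /andP[z_mrsb /andP[_ /andP[_ /andP[z_bc /andP[z_n1 /andP[z_bd /andP[z_n2 /andP[_
    /andP[_ /andP[z_mw /andP[z_mu /andP[z_k4 /andP[z_mnu _]]]]]]]]]]]]]].
  move: hden6; rewrite /qinfs !big_cons !big_nil -/P enu !mulf_eq0 !negb_or -!andbA => /andP[_
    /andP[_ /andP[z_e3 /andP[z_nu _]]]].
  rewrite /=.
  apply/andP; split; first exact: z_oa.
  apply/andP; split; first exact: z_oA.
  apply/andP; split; first exact: z_qb.
  apply/andP; split; first exact: z_qab.
  apply/andP; split; first exact: z_qc.
  apply/andP; split; first exact: z_qac.
  apply/andP; split; first exact: z_qd.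
  apply/andP; split; first exact: z_qad.
  apply/andP; split; first exact: z_rsa.
  apply/andP; split; first exact: z_rs.
  apply/andP; split; first exact: z_mrsa.
  apply/andP; split; first exact: z_mrs.
  apply/andP; split; first exact: z_qbg.
  apply/andP; split; first exact: z_qabg.
  apply/andP; split; first exact: z_mnu.
  apply/andP; split; first exact: z_mqb.
  apply/andP; split; first exact: z_k1.
  apply/andP; split; first exact: z_k2.
  apply/andP; split; first exact: z_k3.
  apply/andP; split; first exact: z_bcd.
  apply/andP; split; first exact: z_mrsb.
  apply/andP; split; first exact: z_bc.
  apply/andP; split; first exact: z_n1.
  apply/andP; split; first exact: z_bd.
  apply/andP; split; first exact: z_n2.
  apply/andP; split; first exact: z_mw.
  apply/andP; split; first exact: z_mu.
  apply/andP; split; first exact: z_k4.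
  apply/andP; split; first exact: u0.
  apply/andP; split; first exact: z_e3.
  apply/andP; split; first exact: z_nu.
  by [].
rewrite /qinfs !big_cons !big_nil !mulr1 -/Q -/P ebc ebd eqb ers enu etw.
apply: etrans (combine_evaluations h1 h2 hT Pq t20 w0 nonzero) _.
congr (_ / _ * _ + _ / _).
by rewrite !mulrA.
by rewrite !mulrA.
by rewrite !mulrA.
by rewrite !mulrA.

Qed.

End Main.

(** * The field of complex numbers *)

Section RealSeries.
Variable R : realType.
Implicit Types (b f : nat -> R) (B : R).

Lemma nonneg_series_limit b B : bsum b B -> exists l : R,
  forall e : R, 0 < e -> exists N, forall n, (N <= n)%N ->
  `|\sum_(k < n) b k - l| < e.
Proof.
move=> [b0 hB].
pose S := [set x : R | exists n, x = \sum_(k < n) b k].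
have S0 : S !=set0 by exists 0; exists 0%N; rewrite big_ord0.
have hS : has_sup S by split=> //; exists B => x [n ->].
exists (sup S) => e e0; have [x [N xN] hx] := sup_adherent e0 hS.
exists N => n Nn.
have le1 : \sum_(k < n) b k <= sup S.
  by apply: ub_le_sup; [case: hS|exists n].
rewrite ler0_norm ?subr_le0 // opprB ltrBlDr -ltrBlDl.
by rewrite (lt_le_trans hx) // xN -(subnKC Nn) big_split_ord /= lerDl sumr_ge0.
Qed.

(** Write f as (f + b) - b, a difference of nonnegative series with bounded partial sums. *)
Lemma dominated_series_limit b B f :
  bsum b B -> (forall k, `|f k| <= b k) -> exists l : R,
  forall e : R, 0 < e -> exists N, forall n, (N <= n)%N ->
  `|\sum_(k < n) f k - l| < e.
Proof.
move=> bB fb; have [l1 h1] := nonneg_series_limit bB.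
have bB2 : bsum (fun k => f k + b k) (B + B).
  split=> [k|n]; first by rewrite -lerBlDr sub0r; have := fb k; rewrite ler_norml => /andP[].
  rewrite big_split lerD //; last by case: bB.
  case: bB => _ hB; rewrite (le_trans _ (hB n)) // ler_sum // => k _.
  by rewrite (le_trans (ler_norm _)).
have [l2 h2] := nonneg_series_limit bB2.
exists (l2 - l1) => e e0; have e2 : 0 < e / 2 by rewrite divr_gt0.
have [N1 k1] := h1 _ e2; have [N2 k2] := h2 _ e2.
exists (maxn N1 N2) => n; rewrite geq_max => /andP[n1 n2].
have -> : \sum_(k < n) f k - (l2 - l1) =
   (\sum_(k < n) (f k + b k) - l2) - (\sum_(k < n) b k - l1).
  by rewrite big_split /=; ring.
by rewrite (le_lt_trans (ler_normB _ _)) // (splitr e) ltrD ?k1 ?k2.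
Qed.

End RealSeries.

Section ComplexModulus.
Variable R : realType.
Implicit Types x y : R[i].
Local Notation normc := (@Normc.normc R).

Lemma normrE_normc x : `|x| = (normc x)%:C.
Proof. by case: x => a b; rewrite normc_def. Qed.

Lemma normc_realE (a : R) : normc a%:C = `|a|.
Proof. by rewrite /= expr0n /= addr0 sqrtr_sqr. Qed.

Lemma normc_natE n : normc n%:R = n%:R.
Proof. by rewrite -(rmorph_nat (real_complex R)) normc_realE normr_nat. Qed.

Lemma normc_nneg x : 0 <= normc x.
Proof. by case: x => a b; exact: sqrtr_ge0. Qed.

Lemma normc_eq0 x : (normc x == 0) = (x == 0).
Proof. by apply/eqP/eqP => [/Normc.eq0_normc //|->]; rewrite Normc.normc0. Qed.

Lemma normc_ltE x y : (`|x| < `|y|) = (normc x < normc y).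
Proof. by rewrite !normrE_normc ltcR. Qed.

Lemma normc_small (e : R[i]) : 0 < e -> exists2 r : R, 0 < r &
  forall x, normc x < r -> `|x| < e.
Proof.
case: e => e1 e2; rewrite ltcE /= => /andP[/eqP -> e0].
by exists e1 => // x h; rewrite normrE_normc -[_ +i* _]/(e1%:C) ltcR.
Qed.

Lemma normr_Re_le x : `|complex.Re x| <= normc x.
Proof. by have := normc_ge_Re x; rewrite normrE_normc lecR. Qed.

Lemma normr_Im_le x : `|complex.Im x| <= normc x.
Proof.
case: x => a b /=; rewrite -sqrtr_sqr ler_sqrt ?addr_ge0 ?sqr_ge0 //.
by rewrite lerDr sqr_ge0.
Qed.

Lemma normc_le_ReIm x : normc x <= `|complex.Re x| + `|complex.Im x|.
Proof.
rewrite {1}(complexE x) (le_trans (le_normcD _ _)) // Normc.normcM !normc_realE.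
by rewrite /= expr0n /= expr1n add0r sqrtr1 mul1r.
Qed.

Lemma normc_complete (f : nat -> R[i]) (b : nat -> R) (B : R) :
  (forall k, normc (f k) <= b k) -> (forall n, \sum_(k < n) b k <= B) ->
  exists l, forall e : R, 0 < e -> exists N, forall n, (N <= n)%N ->
    normc (\sum_(k < n) f k - l) < e.
Proof.
move=> fb hB.
have bB : bsum b B by split=> // k; exact: le_trans (normc_nneg _) (fb k).
have [l1 h1] := dominated_series_limit bB (fun k => le_trans (normr_Re_le (f k)) (fb k)).
have [l2 h2] := dominated_series_limit bB (fun k => le_trans (normr_Im_le (f k)) (fb k)).
exists (l1 +i* l2) => e e0; have e2 : 0 < e / 2 by rewrite divr_gt0.
have [N1 k1] := h1 _ e2; have [N2 k2] := h2 _ e2.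
exists (maxn N1 N2) => n; rewrite geq_max => /andP[n1 n2].
rewrite (le_lt_trans (normc_le_ReIm _)) // (splitr e) ltrD //.
  by move: (k1 _ n1); congr (`|_| < _); rewrite raddfB /=; congr (_ - _); rewrite
    (big_morph _ (raddfD (@complex.Re R : {additive R[i] -> R})) (raddf0 _)).
by move: (k2 _ n2); congr (`|_| < _); rewrite raddfB /=; congr (_ - _); rewrite
    (big_morph _ (raddfD (@complex.Im R : {additive R[i] -> R})) (raddf0 _)).
Qed.

Definition complexModulus : modulusField R :=
  @ModulusField R R[i] normc (@Normc.normcM R) (@le_normcD R) normc_natE normc_nneg
    normc_eq0 normc_small normc_complete.

End ComplexModulus.

(* sq and scd are the chosen square roots of q and of cd *)
Theorem corollary3p18 (R : realType) (q a b c d sq scd : R[i])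
  (hq : 0 < `|q| < 1)
  (ha : a != 0) (hb : b != 0) (hc : c != 0) (hd : d != 0)
  (hsq : sq ^+ 2 = q) (hscd : scd ^+ 2 = c * d)
  (hconv1 : `|q * a| < `|c * d|)
  (hconv2 : `|sq * b| < `|scd|)
  (hden1 : psi8_den_neq0 a
     b c d (sq * a / scd) (- (sq * a / scd)) (c * d / b) q)
  (hden2 : psi8_den_neq0 (- (scd * b / sq))
     b (- b) c d (- (sq * a / scd)) (- (scd ^+ 3 / (sq * a))) q)
  (hden3 : qinfs q
     [:: - (sq * scd); - (sq * scd * b); q * a / c; q * a / d; b * c / a;
         b * d / a; q * b / (c * d); sq * scd / a; - (sq / scd);
         - (sq * b / scd); - (sq ^+ 3 / (scd * b)); - (q * a / (c * d))] != 0)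
  (hden4 : qinfs q
     [:: q / b; q * a / b; q * a / c; q * a / d; b * c / a; b * d / a;
         sq * scd / a; q * b / (c * d); - (sq * b / scd);
         q * a * b / (c * d)] != 0)
  (hden5 : theta (- (scd / sq)) q != 0)
  (hden6 : qinfs (q ^+ 2)
     [:: q; q * c * d; q ^+ 2 * b ^+ 2 / (c * d);
         q ^+ 2 * a ^+ 2 / (c ^+ 2 * d ^+ 2)] != 0) :
  [/\ psi8_cvg a
        b c d (sq * a / scd) (- (sq * a / scd)) (c * d / b)
        q (- (q * a / (c * d))),
      psi8_cvg (- (scd * b / sq))
        b (- b) c d (- (sq * a / scd)) (- (scd ^+ 3 / (sq * a)))
        q (sq * b / scd)
    & psi8 a
        b c d (sq * a / scd) (- (sq * a / scd)) (c * d / b)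
        q (- (q * a / (c * d)))
      =
      qinfs q
        [:: q * a; q / a; - (q / b); b / a; - (sq * c / scd); - (sq * d / scd);
            q * a / (c * d); sq * b / scd; b * c * d / a;
            - (sq * c / scd * b); - (sq * d / scd * b);
            - (sq ^+ 3 * a / scd ^+ 3)]
      / qinfs q
        [:: - (sq * scd); - (sq * scd * b); q * a / c; q * a / d; b * c / a;
            b * d / a; q * b / (c * d); sq * scd / a; - (sq / scd);
            - (sq * b / scd); - (sq ^+ 3 / (scd * b)); - (q * a / (c * d))]
      * psi8 (- (scd * b / sq))
          b (- b) c d (- (sq * a / scd)) (- (scd ^+ 3 / (sq * a)))
          q (sq * b / scd)
      + (qinfs q
           [:: q; q * a; q / a; c; d; q * a / (c * d); q * a / (c * d);
               - (sq * a / scd); sq * scd / b; q * b ^+ 2 / (c * d)]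
         * theta (- (scd / sq * (b / a))) q
         * qinfs (q ^+ 2)
           [:: q * b * c / a; q * b * d / a; q ^+ 2 * a * b / (c ^+ 2 * d);
               q ^+ 2 * a * b / (c * d ^+ 2)])
        / (qinfs q
             [:: q / b; q * a / b; q * a / c; q * a / d; b * c / a; b * d / a;
                 sq * scd / a; q * b / (c * d); - (sq * b / scd);
                 q * a * b / (c * d)]
           * theta (- (scd / sq)) q
           * qinfs (q ^+ 2)
             [:: q; q * c * d; q ^+ 2 * b ^+ 2 / (c * d);
                 q ^+ 2 * a ^+ 2 / (c ^+ 2 * d ^+ 2)])].
Proof.

move/andP: hq => [q_gt0 q_lt1].
have q0 : q != 0 by rewrite -normr_gt0.
have q1 : Normc.normc q < 1 by rewrite -ltcR -normrE_normc.
move: hconv1 hconv2; rewrite !normc_ltE => conv1 conv2.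
(* The carrier of [complexModulus R] is [R[i]] itself, so the hypotheses and conclusions agree by
   conversion. *)
have [cvg1 cvg2 eq12] := @psi8_transformation R (complexModulus R) q a b c d sq scd
  q1 q0 ha hb hc hd hsq hscd conv1 conv2 hden1 hden2 hden3 hden6.
by split; [exact: cvg1|exact: cvg2|exact: eq12].
Qed.
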